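(* Consider the control system $\dot x=\sum_{k=1}^m f_k(x,t)u_k$ on a domain $D\subseteq\mathbb R^n$, and a function $P:D\times\mathbb R^+\to\mathbb R$, and suppose that Assumptions 1, 2, 3 and 4 formulated in the context are satisfied. Then there exist a $\bar\gamma>0$ and a function $\bar\varepsilon:[\bar\gamma,+\infty)\to\mathbb R_{>0}$ such that, for any $\gamma\ge\bar\gamma$ and any $\varepsilon\in(0,\bar\varepsilon(\gamma)]$, the $\pi_\varepsilon$-solution $x_\pi(t)$ of the system with the controls $u_k=u_k^\varepsilon(a(x,t),t)$ (defined in the context from $P$, $\gamma$, $\varepsilon$) and the initial data $x_\pi(t_0)=x^0\in D$, $t_0\ge0$, is well-defined and $x_\pi(t)\in\mathcal L_t^{P,P(x^0,t_0)+\lambda}$ for all $t\ge t_0$, and there exists a $T\ge0$ such that $$P(x_\pi(t),t)\le\sup_{\tau\ge t_0+T}\ \sup_{\xi\in\mathcal L_\tau^{\nabla P,\rho}}P(\xi,\tau)\quad\text{for all }t\ge t_0+T,$$ where $\lambda,\rho$ are the positive numbers from Assumption 4.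
   Context: Notation. $\mathbb R^+=[0,\infty)$; $\mathbb R_{>0}=(0,\infty)$; $\|\cdot\|$ is the Euclidean norm (and induced matrix norm); $\delta_{ij}$ is the Kronecker delta; $\nabla_xP(x,t)$ is the gradient in $x$. For vector fields, $L_gf(x,t)=\lim_{s\to0}\frac{f(x+sg(x,t),t)-f(x,t)}{s}$ and $[f,g]=L_fg-L_gf$. The state is $x\in D\subseteq\mathbb R^n$ ($D$ a domain), the control is $u=(u_1,\dots,u_m)^\top\in\mathbb R^m$, and $f_k:D\times\mathbb R^+\to\mathbb R^n$. For $c\in\mathbb R$ and $t\ge0$: $\mathcal L_t^{P,c}=\{x\in D:P(x,t)\le c\}$, $\mathcal L_t^{\nabla P,c}=\{x\in D:\|\nabla_xP(x,t)\|\le c\}$. Assumption 1. The $f_k$ are twice continuously differentiable w.r.t. $x$; $f_k$ and $L_{f_j}f_k$ are continuously differentiable w.r.t. $t$ for all $j,k$. For any family of compact subsets $\widetilde{\mathcal D}_t\subset D$, $t\ge0$, there exist constants $M_f,L_{fx},L_{2f}>0$, $L_{ft},H_{fx},H_{ft}\ge0$ such that for all $t\ge0$, $x,y\in\widetilde{\mathcal D}_t$, $j,k,l\in\{1,\dots,m\}$: (1.1) $\|f_k(x,t)\|\le M_f$; (1.2) $\|f_k(x,t)-f_k(y,t)\|\le L_{fx}\|x-y\|$, $\|\partial f_k(x,t)/\partial t\|\le L_{ft}$, $\|L_{f_j}f_k(x,t)\|\le L_{2f}$; (1.3) $\|L_{f_l}L_{f_j}f_k(x,t)\|\le H_{fx}$,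 $\|\partial(L_{f_j}f_k(x,t))/\partial t\|\le H_{ft}$. Assumption 2. (2.1) There exist index sets $S_1\subseteq\{1,\dots,m\}$, $S_2\subseteq\{1,\dots,m\}^2$ with $|S_1|+|S_2|=n$ and $\mathrm{span}\{f_i(x,t),[f_{j_1},f_{j_2}](x,t):i\in S_1,(j_1,j_2)\in S_2\}=\mathbb R^n$ for all $t\ge0$, $x\in D$. (2.2) Let $\mathcal F(x,t)$ be the (nonsingular) $n\times n$ matrix with columns $f_i(x,t)$, $i\in S_1$, followed by $[f_{j_1},f_{j_2}](x,t)$, $(j_1,j_2)\in S_2$. For any family of compact subsets $\widetilde{\mathcal D}_t\subset D$, $t\ge0$, there exists $M_F>0$ such that $\|\mathcal F^{-1}(x,t)\|\le M_F$ for all $t\ge0$, $x\in\widetilde{\mathcal D}_t$. Assumption 3. $P:D\times\mathbb R^+\to\mathbb R$ is twice continuously differentiable w.r.t. $x$. For any family of compact subsets $\widetilde{\mathcal D}_t\subset D$, $t\ge0$, there exist constants $m_P\in\mathbb R$, $L_{Px}>0$, $L_{2Px},L_{2Pt},L_{Pt},H_{Px}\ge0$ such that for all $t,\tau\ge0$, $x\in\widetilde{\mathcal D}_t$, $y\in\widetilde{\mathcal D}_\tau$: (3.1) $m_P\le P(x,t)$; (3.2) $\|\partial P(x,t)/\partial x\|\le L_{Px}$, $|P(x,t)-P(y,\tau)|\le L_{Px}\|x-y\|+L_{Pt}|t-\tau|$; (3.3) $\|\nabla_xP(x,t)-\nabla_xP(y,\tau)\|\le L_{2Px}\|x-y\|+L_{2Pt}|t-\tau|$;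 (3.4) $\sum_{i,j=1}^n|\partial^2P(x,t)/\partial x_i\partial x_j|\le H_{Px}$. Assumption 4. For every $x^0\in D$ there exist $\lambda>0$ and $\rho>0$ such that, for all $t\ge t_0\ge0$, $\mathcal L_t^{P,P(x^0,t_0)+\lambda}$ is a non-empty, compact, convex set, and $\mathcal L_t^{\nabla P,\rho}\subseteq\mathcal L_t^{P,P(x^0,t_0)+\lambda}\subset D$. Controls. Given $\gamma>0$ (gain), $\varepsilon>0$ and pairwise distinct numbers $\kappa_{j_1j_2}\in\mathbb N$ (positive integers), $(j_1,j_2)\in S_2$, set $a(x,t)=-\gamma\mathcal F^{-1}(x,t)\nabla_xP(x,t)\in\mathbb R^n$, with components denoted $a_i$ ($i\in S_1$) and $a_{j_1j_2}$ ($(j_1,j_2)\in S_2$) in the order of the columns of $\mathcal F$, and for $k=1,\dots,m$ $$u_k^\varepsilon(a,t)=\sum_{i\in S_1}a_i\delta_{ki}+\varepsilon^{-1/2}\sum_{(j_1,j_2)\in S_2}\sqrt{|a_{j_1j_2}|}\,\phi^{(k,\varepsilon)}_{j_1j_2}(t),$$ $$\phi^{(k,\varepsilon)}_{j_1j_2}(t)=2\sqrt{\pi\kappa_{j_1j_2}}\Big(\delta_{kj_1}\mathrm{sign}(a_{j_1j_2})\cos\tfrac{2\pi\kappa_{j_1j_2}t}{\varepsilon}+\delta_{kj_2}\sin\tfrac{2\pi\kappa_{j_1j_2}t}{\varepsilon}\Big).$$ $\pi_\varepsilon$-solution. For $t_0\ge0$, $\varepsilon>0$ put $t_j=t_0+\varepsilon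 j$, $I_j=[t_j,t_{j+1})$, $j=0,1,2,\dots$. The $\pi_\varepsilon$-solution of the closed-loop system with $x_\pi(t_0)=x^0$ is an absolutely continuous function $x_\pi:[t_0,\infty)\to D$ with $x_\pi(t_0)=x^0$ and $\dot x_\pi(t)=\sum_{k=1}^mf_k(x_\pi(t),t)\,u_k^\varepsilon(a(x_\pi(t_j),t_j),t)$ for $t\in I_j$, for each $j$. It is well-defined if it exists in $D$ on all of $[t_0,\infty)$. *)

(* Defs.v *)
(* R^n is 'cV[R]_n.  Fields depending on (x, t) are total
   functions, but they are only ever constrained on D x [0, +oo[. *)
From HB Require Import structures.
From mathcomp Require Import all_boot all_order all_algebra.
From mathcomp Require Import all_classical all_reals all_analysis.

Set Implicit Arguments.
Unset Strict Implicit.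
Unset Printing Implicit Defensive.

Import Order.TTheory GRing.Theory Num.Theory.
Import numFieldNormedType.Exports.

Local Open Scope classical_set_scope.
Local Open Scope ring_scope.

(* The library norm on 'cV[R]_n is the sup norm; it is used only through the
   topology it induces. *)
Definition enorm (R : realType) (n : nat) (v : 'cV[R]_n) : R :=
  Num.sqrt (\sum_i v i ord0 ^+ 2).

Definition opnorm (R : realType) (n : nat) (A : 'M[R]_n) : R :=
  sup [set enorm (A *m v) | v in [set v : 'cV[R]_n | enorm v <= 1]].

Definition is_domain (R : realType) (n : nat) (D : set 'cV[R]_n) : Prop :=
  [/\ D !=set0, open D & connected D].

Definition compact_family (R : realType) (n : nat) (D : set 'cV[R]_n)
    (K : R -> set 'cV[R]_n) : Prop :=
  forall t, 0 <= t -> compact (K t) /\ K t `<=` D.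

(* Class C^k on an open set D. *)
Fixpoint Ck_on (R : realType) (n : nat) (W : normedModType R)
    (D : set 'cV[R]_n) (k : nat) (g : 'cV[R]_n -> W) : Prop :=
  match k with
  | 0%N => forall x, D x -> {for x, continuous g}
  | k'.+1 => (forall x, D x -> differentiable g x) /\
             forall v, Ck_on D k' (fun x => 'D_v g x)
  end.

(* Difference quotients of g at t along A: the derivative relative to A is
   one-sided at an endpoint of an interval A belonging to A. *)
Definition quotients_within (R : realType) (W : normedModType R) (A : set R)
    (g : R -> W) (t : R) : set_system W :=
  (fun s => (s - t)^-1 *: (g s - g t)) @ within A t^'.

Definition dtime (R : realType) (W : normedModType R) (g : R -> W) (t : R) : W :=
  lim (quotients_within `[0, +oo[ g t).

Definition C1_time (R : realType) (W : normedModType R) (g : R -> W) : Prop :=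
  (forall t, 0 <= t -> cvg (quotients_within `[0, +oo[ g t)) /\
  {within `[0, +oo[, continuous (dtime g)}.

Definition lie (R : realType) (n : nat) (W : normedModType R)
    (g : 'cV[R]_n -> R -> 'cV[R]_n) (f : 'cV[R]_n -> R -> W)
    (x : 'cV[R]_n) (t : R) : W :=
  'D_(g x t) (f ^~ t) x.

Definition bracket (R : realType) (n : nat)
    (f g : 'cV[R]_n -> R -> 'cV[R]_n) (x : 'cV[R]_n) (t : R) : 'cV[R]_n :=
  lie f g x t - lie g f x t.

Definition unitvec (R : realType) (n : nat) (i : 'I_n) : 'cV[R]_n :=
  delta_mx i ord0.

Definition grad (R : realType) (n : nat) (P : 'cV[R]_n -> R -> R)
    (x : 'cV[R]_n) (t : R) : 'cV[R]_n :=
  \col_i 'D_(unitvec R i) (P ^~ t) x.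

Definition partial2 (R : realType) (n : nat) (P : 'cV[R]_n -> R -> R)
    (i j : 'I_n) (x : 'cV[R]_n) (t : R) : R :=
  'D_(unitvec R i) (fun y => 'D_(unitvec R j) (P ^~ t) y) x.

Definition sublevel (R : realType) (n : nat) (D : set 'cV[R]_n)
    (P : 'cV[R]_n -> R -> R) (c t : R) : set 'cV[R]_n :=
  [set x | D x /\ P x t <= c].

Definition grad_sublevel (R : realType) (n : nat) (D : set 'cV[R]_n)
    (P : 'cV[R]_n -> R -> R) (c t : R) : set 'cV[R]_n :=
  [set x | D x /\ enorm (grad P x t) <= c].

Definition assumption1 (R : realType) (n m : nat) (D : set 'cV[R]_n)
    (f : 'I_m -> 'cV[R]_n -> R -> 'cV[R]_n) : Prop :=
  [/\ forall k t, 0 <= t -> Ck_on D 2 (f k ^~ t),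
      forall k x, D x -> C1_time (f k x),
      forall j k x, D x -> C1_time (lie (f j) (f k) x)
    & forall K : R -> set 'cV[R]_n, compact_family D K ->
      exists Mf Lfx L2f Lft Hfx Hft : R,
        [/\ 0 < Mf, 0 < Lfx & 0 < L2f] /\ [/\ 0 <= Lft, 0 <= Hfx & 0 <= Hft] /\
        forall t, 0 <= t -> forall x y, K t x -> K t y ->
        forall j k l : 'I_m,
        enorm (f k x t) <= Mf /\
        [/\ enorm (f k x t - f k y t) <= Lfx * enorm (x - y),
            enorm (dtime (f k x) t) <= Lft
          & enorm (lie (f j) (f k) x t) <= L2f] /\
        enorm (lie (f l) (lie (f j) (f k)) x t) <= Hfx /\
        enorm (dtime (lie (f j) (f k) x) t) <= Hft].

(* Columns of the frame: f_i for i in S1, then [f_j1, f_j2] for (j1, j2) in S2,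
   both listed in the order of enum. *)
Definition frame_col (R : realType) (n m : nat)
    (f : 'I_m -> 'cV[R]_n -> R -> 'cV[R]_n)
    (S1 : {set 'I_m}) (S2 : {set 'I_m * 'I_m})
    (c : 'I_(#|S1| + #|S2|)) : 'cV[R]_n -> R -> 'cV[R]_n :=
  match fintype.split c with
  | inl i => f (enum_val i)
  | inr q => bracket (f (enum_val q).1) (f (enum_val q).2)
  end.

Definition frame_mx (R : realType) (n m : nat)
    (f : 'I_m -> 'cV[R]_n -> R -> 'cV[R]_n)
    (S1 : {set 'I_m}) (S2 : {set 'I_m * 'I_m}) (hn : (#|S1| + #|S2|)%N = n)
    (x : 'cV[R]_n) (t : R) : 'M[R]_n :=
  \matrix_(i, j) frame_col f (cast_ord (esym hn) j) x t i ord0.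

Definition assumption2 (R : realType) (n m : nat) (D : set 'cV[R]_n)
    (f : 'I_m -> 'cV[R]_n -> R -> 'cV[R]_n)
    (S1 : {set 'I_m}) (S2 : {set 'I_m * 'I_m}) (hn : (#|S1| + #|S2|)%N = n) :
    Prop :=
  (forall t x, 0 <= t -> D x ->
     <<[seq f i x t | i <- enum S1] ++
       [seq bracket (f p.1) (f p.2) x t | p <- enum S2]>>%VS = fullv) /\
  (forall K : R -> set 'cV[R]_n, compact_family D K ->
     exists2 MF : R, 0 < MF &
       forall t x, 0 <= t -> K t x -> opnorm (invmx (frame_mx f hn x t)) <= MF).

Definition assumption3 (R : realType) (n : nat) (D : set 'cV[R]_n)
    (P : 'cV[R]_n -> R -> R) : Prop :=
  (forall t, 0 <= t -> Ck_on (W := R) D 2 (P ^~ t)) /\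
  (forall K : R -> set 'cV[R]_n, compact_family D K ->
     exists mP LPx L2Px L2Pt LPt HPx : R,
       0 < LPx /\ [/\ 0 <= L2Px, 0 <= L2Pt, 0 <= LPt & 0 <= HPx] /\
       forall t tau, 0 <= t -> 0 <= tau -> forall x y, K t x -> K tau y ->
       mP <= P x t /\
       (enorm (grad P x t) <= LPx /\
        `|P x t - P y tau| <= LPx * enorm (x - y) + LPt * `|t - tau|) /\
       enorm (grad P x t - grad P y tau)
         <= L2Px * enorm (x - y) + L2Pt * `|t - tau| /\
       \sum_(i < n) \sum_(j < n) `|partial2 P i j x t| <= HPx).

Definition level_condition (R : realType) (n : nat) (D : set 'cV[R]_n)
    (P : 'cV[R]_n -> R -> R) (x0 : 'cV[R]_n) (lambda rho : R) : Prop :=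
  forall t0 t, 0 <= t0 -> t0 <= t ->
    let L := sublevel D P (P x0 t0 + lambda) t in
    [/\ L !=set0, compact L, convex_set L,
        grad_sublevel D P rho t `<=` L & L `<=` D].

Definition assumption4 (R : realType) (n : nat) (D : set 'cV[R]_n)
    (P : 'cV[R]_n -> R -> R) : Prop :=
  forall x0, D x0 -> exists lambda rho : R,
    [/\ 0 < lambda, 0 < rho & level_condition D P x0 lambda rho].

Definition feedback (R : realType) (n m : nat)
    (f : 'I_m -> 'cV[R]_n -> R -> 'cV[R]_n)
    (S1 : {set 'I_m}) (S2 : {set 'I_m * 'I_m}) (hn : (#|S1| + #|S2|)%N = n)
    (P : 'cV[R]_n -> R -> R) (gamma : R) (x : 'cV[R]_n) (t : R) : 'cV[R]_n :=
  - (gamma *: (invmx (frame_mx f hn x t) *m grad P x t)).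

(* phi_{j1 j2}^{(k, eps)}(t) for p = (j1, j2), where b stands for a_{j1 j2}. *)
Definition phi (R : realType) (m : nat) (kappa : 'I_m * 'I_m -> nat) (eps : R)
    (p : 'I_m * 'I_m) (k : 'I_m) (b t : R) : R :=
  2 * Num.sqrt (pi * (kappa p)%:R) *
  ((k == p.1)%:R * Num.sg b * cos (2 * pi * (kappa p)%:R * t / eps) +
   (k == p.2)%:R * sin (2 * pi * (kappa p)%:R * t / eps)).

Definition control (R : realType) (n m : nat)
    (S1 : {set 'I_m}) (S2 : {set 'I_m * 'I_m}) (hn : (#|S1| + #|S2|)%N = n)
    (kappa : 'I_m * 'I_m -> nat) (eps : R)
    (k : 'I_m) (a : 'cV[R]_n) (t : R) : R :=
  let a1 (i : 'I_#|S1|) := a (cast_ord hn (lshift #|S2| i)) ord0 in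
  let a2 (q : 'I_#|S2|) := a (cast_ord hn (rshift #|S1| q)) ord0 in
  \sum_(i < #|S1|) a1 i * (k == enum_val i)%:R +
  (Num.sqrt eps)^-1 *
  \sum_(q < #|S2|) Num.sqrt `|a2 q| * phi kappa eps (enum_val q) k (a2 q) t.

Definition abs_continuous (R : realType) (n : nat) (a b : R)
    (g : R -> 'cV[R]_n) : Prop :=
  forall e, 0 < e -> exists2 d : R, 0 < d &
    forall (N : nat) (l r : 'I_N -> R),
      (forall i, [/\ a <= l i, l i <= r i & r i <= b]) ->
      trivIset setT (fun i => `]l i, r i[%classic) ->
      \sum_i (r i - l i) < d -> \sum_i enorm (g (r i) - g (l i)) < e.

(* Absolute continuity on [t0, +oo[ is meant on each compact subinterval.  On
   I_j = [t_j, t_(j+1)[ the differential equation is understood relative to I_j,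
   i.e. with the right derivative at t_j, where the control switches. *)
Definition pi_solution (R : realType) (n m : nat) (D : set 'cV[R]_n)
    (f : 'I_m -> 'cV[R]_n -> R -> 'cV[R]_n)
    (S1 : {set 'I_m}) (S2 : {set 'I_m * 'I_m}) (hn : (#|S1| + #|S2|)%N = n)
    (kappa : 'I_m * 'I_m -> nat) (P : 'cV[R]_n -> R -> R)
    (gamma eps t0 : R) (x0 : 'cV[R]_n) (x : R -> 'cV[R]_n) : Prop :=
  let tj (j : nat) := t0 + eps * j%:R in
  let a := feedback f hn P gamma in
  [/\ forall b, t0 <= b -> abs_continuous t0 b x,
      forall t, t0 <= t -> D (x t),
      x t0 = x0
    & forall (j : nat) (t : R), tj j <= t < tj j.+1 ->
      quotients_within `[tj j, tj j.+1[ x t -->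
        \sum_(k < m) control hn kappa eps k (a (x (tj j)) (tj j)) t *:
                     f k (x t) t].

(* Main.v *)
(* Over one period of length eps, the second-order expansion of the trajectory
   gives x(t_(j+1)) = x(t_j) - eps gamma grad P + O(eps^(3/2)), while between
   the nodes x moves by O(eps^(1/2)).  Hence, for gamma large and eps small, P
   decreases from node to node at a rate at least 1 in time as long as
   |grad P| > rho/2.  Since |grad P| <= rho forces P <= P(x0, t0) + lambda, and
   since |grad P| needs a time bounded below to grow from rho/2 to rho, during
   which P loses a fixed amount, the oscillations of size O(eps^(1/2)) can be
   absorbed: the quantity P + |grad P| / G, with G bounding the growth rate of
   |grad P|, does not increase at the nodes where |grad P| > rho/2.

   Constants uniform in t0 come from the family of the largest sublevel sets
   {P(., t) <= max_(s <= t) P(x0, s) + lambda}.  A solution on one period is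
   obtained by Picard iteration and continuation: the same estimates keep it in
   compact subsets of D. *)
Require Import Defs.
From HB Require Import structures.
From mathcomp Require Import all_boot all_order all_algebra.
From mathcomp Require Import all_classical all_reals all_analysis.
From mathcomp Require Import ring lra.
Import Order.TTheory GRing.Theory Num.Theory.
Import numFieldNormedType.Exports.
Local Open Scope classical_set_scope.
Local Open Scope ring_scope.

Set Implicit Arguments.
Unset Strict Implicit.

(** The estimates look circular: every constant holds only on the family of sublevel sets, and
    membership in that family is part of the claim. Two alternative certificates of membership break
    the circle, a gradient norm below [rho] or a value of [P] below [c] by a fraction of [mu], and
    each is spent only gradually. In units of [rho], the gradient thresholds are 1/2 (descent is
    guaranteed above it), 5/8 (not exceeded one period after a node below 1/2), 3/4 (what the node
    invariant gives when [P] is not low) and 7/8 (kept during a period); the last eighth pays for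
    testing a position at another time. The allowances per period, [rho / 16] and [mu / 4], are made
    to fit between these thresholds. The conclusion concerns every solution, so the estimates are
    stated for an arbitrary trajectory on a period or on an initial part of one; existence applies
    them to partial solutions. *)

Section EuclideanNorm.
Variables (R : realType) (n : nat).
Implicit Types u v w : 'cV[R]_n.

(** * Inner product, Euclidean norm and comparison with the sup norm *)

Definition dot u v : R := \sum_i u i ord0 * v i ord0.

Lemma dotC u v : dot u v = dot v u.
Proof. by apply: eq_bigr => i _; rewrite mulrC. Qed.

Lemma dotDl u v w : dot (u + v) w = dot u w + dot v w.
Proof. by rewrite -big_split; apply: eq_bigr => i _; rewrite mxE mulrDl. Qed.

Lemma dotZl a u v : dot (a *: u) v = a * dot u v.
Proof. by rewrite mulr_sumr; apply: eq_bigr => i _; rewrite mxE mulrA. Qed.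

Lemma dotNl u v : dot (- u) v = - dot u v.
Proof. by rewrite -scaleN1r dotZl mulN1r. Qed.

Lemma dotDr u v w : dot u (v + w) = dot u v + dot u w.
Proof. by rewrite dotC dotDl !(dotC u). Qed.

Lemma dotZr a u v : dot u (a *: v) = a * dot u v.
Proof. by rewrite dotC dotZl dotC. Qed.

Lemma dotNr u v : dot u (- v) = - dot u v.
Proof. by rewrite dotC dotNl dotC. Qed.

Lemma enorm_ge0 v : 0 <= enorm v. Proof. exact: sqrtr_ge0. Qed.

Lemma dotvv v : dot v v = enorm v ^+ 2.
Proof.
rewrite sqr_sqrtr; first by apply: eq_bigr => i _; rewrite expr2.
by apply: sumr_ge0 => i _; apply: sqr_ge0.
Qed.

Lemma coord_le_enorm v i : `|v i ord0| <= enorm v.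
Proof.
rewrite -sqrtr_sqr ler_wsqrtr // (bigD1 i) //= lerDl.
by apply: sumr_ge0 => j _; apply: sqr_ge0.
Qed.

Lemma enorm_eq0 v : enorm v = 0 -> v = 0.
Proof.
move=> v0; apply/colP => i; rewrite mxE; apply/eqP.
by rewrite -normr_le0 -v0 coord_le_enorm.
Qed.

Lemma enorm0 : enorm (0 : 'cV[R]_n) = 0.
Proof.
rewrite /enorm big1 ?sqrtr0 // => i _; by rewrite mxE expr0n.
Qed.

Lemma dot0 v : dot 0 v = 0.
Proof. by rewrite /dot big1 // => i _; rewrite mxE mul0r. Qed.

Lemma dot_le u v : dot u v <= enorm u * enorm v.
Proof.
have [u0|u0] := eqVneq (enorm u) 0; first by rewrite (enorm_eq0 u0) dot0 enorm0 mul0r.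
have [v0|v0] := eqVneq (enorm v) 0.
  by rewrite (enorm_eq0 v0) dotC dot0 enorm0 mulr0.
have uv : 0 < enorm u * enorm v.
  by apply: mulr_gt0; rewrite lt0r enorm_ge0 ?u0 ?v0.
(* Cauchy-Schwarz: writing |u| for [enorm u], this square equals 2 |u| |v| (|u| |v| - [dot u v]). *)
have : 0 <= enorm (enorm v *: u - enorm u *: v) ^+ 2 by apply: sqr_ge0.
rewrite -dotvv !(dotDl, dotDr, dotNl, dotNr, dotZl, dotZr) !dotvv (dotC v u).
set a := enorm u in uv *; set b := enorm v in uv *; set d := dot u v => H.
rewrite -(ler_pM2l uv); nra.
Qed.

Lemma ler_enormD u v : enorm (u + v) <= enorm u + enorm v.
Proof.
rewrite -(@ler_pXn2r _ 2) ?nnegrE ?addr_ge0 ?enorm_ge0 //.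
rewrite -dotvv !(dotDl, dotDr) !dotvv (dotC v u); have := dot_le u v; nra.
Qed.

Lemma enormZ a v : enorm (a *: v) = `|a| * enorm v.
Proof.
apply/eqP; rewrite -(@eqrXn2 _ 2) ?mulr_ge0 ?enorm_ge0 //.
by rewrite exprMn real_normK ?num_real // -!dotvv dotZl dotZr mulrA expr2.
Qed.

Lemma enormN v : enorm (- v) = enorm v.
Proof. by rewrite -scaleN1r enormZ normrN1 mul1r. Qed.

Lemma enormBC u v : enorm (u - v) = enorm (v - u).
Proof. by rewrite -enormN opprB. Qed.

Lemma ler_enormB u v : enorm (u - v) <= enorm u + enorm v.
Proof. by rewrite -(enormN v) ler_enormD. Qed.

Lemma ler_dist_enorm u v w : enorm (u - w) <= enorm (u - v) + enorm (v - w).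
Proof. by rewrite (le_trans _ (ler_enormD _ _)) // subrKA. Qed.

Lemma enorm_leD u v : enorm u <= enorm v + enorm (u - v).
Proof. by rewrite (le_trans _ (ler_enormD _ _)) // addrC subrK. Qed.

Lemma ler_dist_dist u v : `|enorm u - enorm v| <= enorm (u - v).
Proof.
have := enorm_leD u v; have := enorm_leD v u; rewrite (enormBC v u).
by move=> *; rewrite ler_norml; apply/andP; split; lra.
Qed.

Lemma ler_enorm_sum (I : Type) (r : seq I) (Q : pred I) (F : I -> 'cV[R]_n) :
  enorm (\sum_(i <- r | Q i) F i) <= \sum_(i <- r | Q i) enorm (F i).
Proof.
apply: (big_ind2 (fun u a => enorm u <= a)) => //; first by rewrite enorm0.
by move=> u a v b ua vb; rewrite (le_trans (ler_enormD _ _)) // lerD.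
Qed.

Lemma norm_le_enorm v : `|v| <= enorm v.
Proof.
rewrite /Num.norm /= mx_normrE; apply: bigmax_le; first exact: enorm_ge0.
by move=> [i j] _ /=; rewrite (ord1 j) coord_le_enorm.
Qed.

Lemma coord_le_norm v i : `|v i ord0| <= `|v|.
Proof.
rewrite [leRHS]/Num.norm /= mx_normrE.
exact: (le_bigmax _ (fun p => `|v p.1 p.2|) (i, ord0)).
Qed.

Lemma enorm_le_coord v a : 0 <= a -> (forall i, `|v i ord0| <= a) -> enorm v <= n%:R * a.
Proof.
move=> a0 va; rewrite -[leRHS]ger0_norm ?mulr_ge0 // -sqrtr_sqr ler_wsqrtr //.
apply: (@le_trans _ _ (\sum_(i < n) a ^+ 2)).
  apply: ler_sum => i _; rewrite -(@real_normK _ (v i ord0)) ?num_real //.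
  by rewrite lerXn2r ?nnegrE.
rewrite sumr_const card_ord exprMn -[leLHS]mulr_natl; apply: ler_wpM2r; first exact: sqr_ge0.
by rewrite -natrX ler_nat; case: (n) => // k; rewrite leq_pmulr.
Qed.

Lemma enorm_le_norm v : enorm v <= n%:R * `|v|.
Proof. by apply: enorm_le_coord => // i; apply: coord_le_norm. Qed.

Lemma enorm_mulmx (A : 'M[R]_n) v : enorm (A *m v) <= opnorm A * enorm v.
Proof.
(* [opnorm] is a supremum and dominates its set only once the set is known to be bounded; the sum of
   the column norms is a crude bound. *)
have ub : has_ubound [set enorm (A *m v) | v in [set v : 'cV[R]_n | enorm v <= 1]].
  exists (\sum_j enorm (col j A)) => _ [w /= w1 <-].
  have -> : A *m w = \sum_j w j ord0 *: col j A.
    apply/colP => i; rewrite mxE summxE; apply: eq_bigr => j _.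
    by rewrite !mxE mulrC.
  apply: le_trans (ler_enorm_sum _ _ _) _; apply: ler_sum => j _.
  rewrite enormZ ler_piMl ?enorm_ge0 //; exact: le_trans (coord_le_enorm _ _) w1.
have [v0|v0] := eqVneq (enorm v) 0.
  by rewrite (enorm_eq0 v0) mulmx0 enorm0 mulr0.
have vp : 0 < enorm v by rewrite lt0r v0 enorm_ge0.
rewrite -ler_pdivrMr //; apply: (ub_le_sup ub).
exists ((enorm v)^-1 *: v); first by rewrite /= enormZ gtr0_norm ?invr_gt0 ?mulVf.
by rewrite -scalemxAr enormZ gtr0_norm ?invr_gt0 // mulrC.
Qed.

End EuclideanNorm.

(** * Mean value inequality *)

(** The set of times up to which [Q] holds has a supremum, which the limit clause puts into the set
    and the step clause forbids to lie before [b]. This serves the mean value inequality,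
    confinement and the continuation of solutions. *)
Lemma real_induction (R : realType) (a b : R) (Q : R -> Prop) :
  Q a ->
  (forall t, a <= t < b -> (forall s, a <= s <= t -> Q s) ->
    exists2 d, 0 < d & forall s, t < s < t + d -> s <= b -> Q s) ->
  (forall t, a < t <= b -> (forall s, a <= s < t -> Q s) -> Q t) ->
  forall t, a <= t <= b -> Q t.
Proof.
move=> Qa Qstep Qlim t0 /andP[at0 t0b].
have ab := le_trans at0 t0b.
pose S := [set t | a <= t <= b /\ forall s, a <= s <= t -> Q s].
have Sa : S a.
  by split=> [|s /andP[? ?]]; rewrite ?lexx //; have -> : s = a by lra.
have Sb : has_ubound S by exists b => t [/andP[]].
have supS : has_sup S by split=> //; exists a.
have as_ : a <= sup S by apply: ub_le_sup.
have sb : sup S <= b by apply: sup_le_ub => [|t [/andP[]]//]; exists a.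
have Qlt s : a <= s < sup S -> Q s.
  move=> /andP[as1 s1].
  have [t [_ Qt]] := sup_adherent (ltac:(lra) : 0 < sup S - s) supS.
  rewrite opprB addrC subrK => st; apply: Qt; lra.
have Qs : Q (sup S).
  have [<-//|asup] := eqVneq a (sup S).
  by apply: Qlim => //; rewrite lt_neqAle asup as_ sb.
have Qle s : a <= s <= sup S -> Q s.
  move=> /andP[as1]; rewrite le_eqVlt => /orP[/eqP->//|s1].
  by apply: Qlt; rewrite as1.
suff sE : sup S = b by apply: Qle; rewrite sE at0.
apply/eqP; rewrite eq_le sb /= leNgt; apply/negP => sb'.
have [d d0 Qd] := Qstep _ (ltac:(lra) : a <= sup S < b) Qle.
pose t := Num.min (sup S + d / 2) b.
have st : sup S < t by rewrite /t lt_min; apply/andP; split; lra.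
have tb : t <= b by rewrite /t ge_min lexx orbT.
have td : t < sup S + d by rewrite /t gt_min; apply/orP; left; lra.
suff : t <= sup S by lra.
apply: ub_le_sup => //; split; first lra.
move=> s /andP[as1 st1]; have [ss|ss] := leP s (sup S).
  by apply: Qle; rewrite as1.
apply: Qd; lra.
Qed.

Section MeanValue.
Variables (R : realType) (n : nat).
Implicit Types (phi psi : R -> 'cV[R]_n) (a b t : R).

Definition ccont a b phi := forall t, a <= t <= b -> forall eta, 0 < eta ->
  exists2 d, 0 < d & forall s, a <= s <= b -> `|s - t| < d ->
    enorm (phi s - phi t) <= eta.

(* [v] is a right derivative of [phi] at [t] up to an error of slope [H]: the
   data are Lipschitz in time but not jointly differentiable in (x, t), so that
   the chain rule along a trajectory is only available in this weakened form. *)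
Definition approx phi t (v : 'cV[R]_n) (H : R) := forall eta, 0 < eta ->
  exists2 d, 0 < d & forall h, 0 < h < d ->
    enorm (phi (t + h) - phi t - h *: v) <= (H + eta) * h.

(** A right derivative controls increments to the right of each time, and continuity carries the
    bound to limits from the left; hence real induction, with the slope enlarged by an [eta] that is
    finally sent to 0. *)
Lemma approx_mean_value phi (v : R -> 'cV[R]_n) (H C a b : R) :
  ccont a b phi ->
  (forall t, a <= t < b -> approx phi t (v t) H) ->
  (forall t, a <= t < b -> enorm (v t) + H <= C) ->
  forall t, a <= t <= b -> enorm (phi t - phi a) <= C * (t - a).
Proof.
move=> cphi aphi vC t0 t0ab; apply/ler_addgt0Pr => e e0.
pose eta := e / (t0 - a + 1).
have eta0 : 0 < eta by rewrite divr_gt0 //; lra.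
suff: forall t, a <= t <= b -> enorm (phi t - phi a) <= (C + eta) * (t - a).
  move=> /(_ t0 t0ab) /le_trans; apply; rewrite mulrDl lerD2l.
  rewrite /eta mulrAC ler_pdivrMr; last lra.
  by apply: ler_wpM2l; lra.
apply: real_induction.
- by rewrite !subrr enorm0 mulr0.
- move=> t tab Qt; have [d d0 dP] := aphi t tab _ eta0.
  exists d => // s std sb.
  have := dP (s - t) (ltac:(lra)); rewrite (addrC t) subrK => H1.
  have H2 := Qt t (ltac:(lra)).
  have H3 := enorm_leD (phi s - phi t) ((s - t) *: v t).
  have := ler_dist_enorm (phi s) (phi t) (phi a).
  rewrite enormZ ger0_norm in H3; last lra.
  have := vC t tab; nra.
- move=> t tab Qt; apply/ler_addgt0Pr => e1 e10.
  (* The sign of [C + eta] is not known, so the change of the bound between [s] and [t] is estimated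
     through the absolute value of [C]. *)
  pose k := e1 / 2 / (`|C| + eta + 1).
  have Cp : 0 < `|C| + eta + 1 by have := normr_ge0 C; lra.
  have k0 : 0 < k by rewrite !divr_gt0.
  have [d d0 dP] := cphi t (ltac:(lra)) (e1 / 2) (ltac:(lra)).
  pose s := Num.max a (t - Num.min (d / 2) k).
  have m0 : 0 < Num.min (d / 2) k by rewrite lt_min; apply/andP; split; lra.
  have sa : a <= s by rewrite /s le_max lexx.
  have st : s < t by rewrite /s gt_max; lra.
  have sm : t - s <= Num.min (d / 2) k.
    by rewrite lerBlDr addrC -lerBlDr /s le_max lexx orbT.
  have sd : t - s < d by apply: le_lt_trans sm _; rewrite gt_min; apply/orP; left; lra.
  have sk : t - s <= k by apply: le_trans sm _; rewrite ge_min lexx orbT.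
  have H1 := dP s (ltac:(lra)) (ltac:(by rewrite distrC gtr0_norm; lra)).
  have H2 := Qt s (ltac:(lra)).
  have H3 := ler_dist_enorm (phi t) (phi s) (phi a).
  rewrite enormBC in H1.
  have H4 : (C + eta) * (s - a) <= (C + eta) * (t - a) + e1 / 2.
    have K1 : (t - s) * (`|C| + eta + 1) <= e1 / 2 by rewrite -ler_pdivlMr.
    have K2 : 0 <= (t - s) * (`|C| + C + 2 * eta + 1).
      have := ler_norm (- C); rewrite normrN => nC.
      by apply: mulr_ge0; lra.
    clear -K1 K2; clearbody s; move: (`|C|) K1 K2 => c K1 K2; lra.
  lra.
Qed.

Lemma approxD phi psi t v w H H' : approx phi t v H -> approx psi t w H' ->
  approx (fun t => phi t + psi t) t (v + w) (H + H').
Proof.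
move=> p1 p2 eta eta0.
have [d1 d10 p1d] := p1 (eta / 2) (ltac:(lra)).
have [d2 d20 p2d] := p2 (eta / 2) (ltac:(lra)).
exists (Num.min d1 d2); first by rewrite lt_min d10.
move=> h; rewrite lt_min => /andP[h0 /andP[h1 h2]]; cbv beta.
have := p1d h (ltac:(lra)); have := p2d h (ltac:(lra)).
have := ler_enormD (phi (t + h) - phi t - h *: v) (psi (t + h) - psi t - h *: w).
have -> : phi (t + h) - phi t - h *: v + (psi (t + h) - psi t - h *: w) =
  phi (t + h) + psi (t + h) - (phi t + psi t) - h *: (v + w).
  by rewrite scalerDr [in LHS]addrACA (addrACA (phi (t + h))) -!opprD.
by rewrite !mulrDl; lra.
Qed.

Lemma approxZ phi t v H (c : R) : approx phi t v H ->
  approx (fun t => c *: phi t) t (c *: v) (`|c| * H).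
Proof.
move=> p eta eta0.
have c1 : 0 < `|c| + 1 by have := normr_ge0 c; lra.
have [d d0 pd] := p (eta / (`|c| + 1)) (divr_gt0 eta0 c1).
exists d => // h h0; have := pd h h0.
rewrite scalerA (mulrC h) -scalerA -!scalerBr enormZ => /(ler_wpM2l (normr_ge0 c)).
move=> /le_trans; apply; rewrite mulrA; apply: ler_wpM2r; first lra.
rewrite mulrDr lerD2l mulrA mulrAC ler_piMl //; first lra.
by rewrite ler_pdivrMr // mul1r; lra.
Qed.

Lemma approx_cst (c : 'cV[R]_n) t : approx (fun=> c) t 0 0.
Proof.
move=> eta eta0; exists 1 => // h h0; rewrite subrr scaler0 subr0 enorm0.
by rewrite mulr_ge0; lra.
Qed.

Lemma approx_sum (I : Type) (r : seq I) (phi : I -> R -> 'cV[R]_n)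
    (v : I -> 'cV[R]_n) t :
  (forall i, approx (phi i) t (v i) 0) ->
  approx (fun t => \sum_(i <- r) phi i t) t (\sum_(i <- r) v i) 0.
Proof.
move=> p; elim: r => [|i r IH].
  have -> : (fun t => \sum_(i <- [::]) phi i t) = fun=> 0.
    by apply/funext => s; rewrite big_nil.
  by rewrite big_nil; apply: approx_cst.
have -> : (fun t => \sum_(j <- i :: r) phi j t) =
          fun t => phi i t + \sum_(j <- r) phi j t.
  by apply/funext => s; rewrite big_cons.
by rewrite big_cons; have := approxD (p i) IH; rewrite addr0.
Qed.

Lemma ccontD phi psi a b : ccont a b phi -> ccont a b psi ->
  ccont a b (fun t => phi t + psi t).
Proof.
move=> p1 p2 t tab eta eta0.
have [d1 d10 p1d] := p1 t tab (eta / 2) (ltac:(lra)).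
have [d2 d20 p2d] := p2 t tab (eta / 2) (ltac:(lra)).
exists (Num.min d1 d2); first by rewrite lt_min d10.
move=> s sab; rewrite lt_min => /andP[s1 s2]; cbv beta.
have := p1d s sab s1; have := p2d s sab s2.
have := ler_enormD (phi s - phi t) (psi s - psi t).
by rewrite addrACA -opprD; lra.
Qed.

Lemma ccontZ phi a b (c : R) : ccont a b phi -> ccont a b (fun t => c *: phi t).
Proof.
move=> p t tab eta eta0.
have c1 : 0 < `|c| + 1 by have := normr_ge0 c; lra.
have [d d0 pd] := p t tab (eta / (`|c| + 1)) (divr_gt0 eta0 c1).
exists d => // s sab sd; have := pd s sab sd.
rewrite -scalerBr enormZ ler_pdivlMr // => H.
by apply: le_trans H; rewrite mulrC ler_wpM2l ?enorm_ge0 //; lra.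
Qed.

Lemma ccont_cst (c : 'cV[R]_n) a b : ccont a b (fun=> c).
Proof. by move=> t _ eta eta0; exists 1 => // s _ _; rewrite subrr enorm0 ltW. Qed.

Lemma ccont_sum (I : Type) (r : seq I) (phi : I -> R -> 'cV[R]_n) a b :
  (forall i, ccont a b (phi i)) -> ccont a b (fun t => \sum_(i <- r) phi i t).
Proof.
move=> p; elim: r => [|i r IH].
  have -> : (fun t => \sum_(i <- [::]) phi i t) = fun=> 0.
    by apply/funext => s; rewrite big_nil.
  exact: ccont_cst.
have -> : (fun t => \sum_(j <- i :: r) phi j t) =
          fun t => phi i t + \sum_(j <- r) phi j t.
  by apply/funext => s; rewrite big_cons.
exact: ccontD.
Qed.

Lemma ccont_sub phi a b a' b' : a <= a' -> b' <= b -> ccont a b phi -> ccont a' b' phi.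
Proof.
move=> aa bb p t tab eta eta0; have [d d0 pd] := p t (ltac:(lra)) eta eta0.
by exists d => // s sab; apply: pd; lra.
Qed.

End MeanValue.

(** * Sublevel sets *)

Section TimeRegularity.
Variables (R : realType) (n : nat) (D : set 'cV[R]_n) (P : 'cV[R]_n -> R -> R).
Hypothesis hA3 : assumption3 D P.

Lemma compact_family_cst (A : set 'cV[R]_n) : compact A -> A `<=` D ->
  compact_family D (fun=> A).
Proof. by move=> cA AD t _. Qed.

(** The constant family equal to [A] is admissible in [assumption3], and one constant then serves
    all pairs of times. *)
Lemma P_lipschitz_on_compact (A : set 'cV[R]_n) : compact A -> A `<=` D ->
  exists2 L, 0 < L & forall t s x y, 0 <= t -> 0 <= s -> A x -> A y ->
    `|P x t - P y s| <= L * (enorm (x - y) + `|t - s|) /\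
    enorm (grad P x t - grad P y s) <= L * (enorm (x - y) + `|t - s|).
Proof.
move=> cA AD; have [_ /(_ _ (compact_family_cst cA AD))] := hA3.
move=> [mP [LPx [L2Px [L2Pt [LPt [HPx [LPx0 [[L2Px0 L2Pt0 LPt0 _] H]]]]]]]].
exists (LPx + L2Px + L2Pt + LPt); first lra.
move=> t s x y t0 s0 Ax Ay.
have [_ [[_ H1] [H2 _]]] := H t s t0 s0 x y Ax Ay.
have e0 := enorm_ge0 (x - y); have a0 := normr_ge0 (t - s).
split; [apply: le_trans H1 _|apply: le_trans H2 _]; rewrite mulrDr;
  by apply: lerD; apply: ler_wpM2r => //; lra.
Qed.

(** This constant depends on [x] in an uncontrolled way; it gives the continuity in time behind the
    intermediate and extreme value theorems, and no quantitative bound. *)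
Lemma P_lipschitz_time x : D x -> exists2 L, 0 < L & forall t s, 0 <= t -> 0 <= s ->
  `|P x t - P x s| <= L * `|t - s| /\
  enorm (grad P x t - grad P x s) <= L * `|t - s|.
Proof.
move=> Dx; have [L L0 HL] := P_lipschitz_on_compact (@compact_set1 _ x)
  (ltac:(by move=> _ ->) : [set x] `<=` D).
exists L => // t s t0 s0; have := HL t s x x t0 s0 erefl erefl.
by rewrite !subrr !enorm0 !add0r.
Qed.

Lemma lipschitz_within_continuous (phi : R -> R) (L a b : R) : 0 < L ->
  (forall t s, a <= t <= b -> a <= s <= b -> `|phi t - phi s| <= L * `|t - s|) ->
  {within `[a, b], continuous phi}.
Proof.
move=> L0 H; apply/subspace_continuousP => t tab.
apply/cvgrPdist_le => e e0; rewrite near_withinE; apply/nbhs_ballP.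
exists (e / L) => /=; first exact: divr_gt0.
move=> s; rewrite /ball /= => ts sab.
apply: le_trans (H t s _ _) _; rewrite ?itvE //.
by rewrite mulrC -ler_pdivlMr // ltW.
Qed.

(** [a] and [b] come in either order because membership has to be propagated both forward and
    backward in time. *)
Lemma lipschitz_ivt (phi : R -> R) (L a b v : R) : 0 < L -> 0 <= a -> 0 <= b ->
  (forall t s, 0 <= t -> 0 <= s -> `|phi t - phi s| <= L * `|t - s|) ->
  phi a <= v <= phi b ->
  exists s, [/\ Num.min a b <= s, s <= Num.max a b & phi s = v].
Proof.
move=> L0 a0 b0 H vab.
pose a' := Num.min a b; pose b' := Num.max a b.
have a'0 : 0 <= a' by rewrite le_min a0.
have ab' : a' <= b' by rewrite /a' /b' ge_min le_max lexx.
have cphi : {within `[a', b'], continuous phi}.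
  apply: (lipschitz_within_continuous L0) => t s /andP[ta _] /andP[sa _].
  by apply: H; [exact: le_trans ta|exact: le_trans sa].
have [|s sab <-] := IVT ab' cphi (v := v).
  rewrite /a' /b'; case: (leP a b) => _; rewrite ge_min le_max.
    by case/andP: vab => -> ->; rewrite orbT.
  by case/andP: vab => -> ->; rewrite orbT.
by exists s; move: sab; rewrite in_itv /= => /andP[].
Qed.

End TimeRegularity.

Section LevelFamily.
Variables (R : realType) (n : nat) (D : set 'cV[R]_n) (P : 'cV[R]_n -> R -> R).
Hypothesis hA3 : assumption3 D P.
Variables (x0 : 'cV[R]_n) (lambda rho : R).
Hypotheses (hx0 : D x0) (hlevel : level_condition D P x0 lambda rho).

Definition level_family (t : R) : set 'cV[R]_n :=
  [set x | exists2 t0, 0 <= t0 <= t & sublevel D P (P x0 t0 + lambda) t x].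

(* The union over [t0] is the largest of the sublevel sets, because
   [P x0] attains its maximum on [0, t]; hence constants that do not depend
   on the initial time. *)
Lemma compact_level_family : compact_family D level_family.
Proof.
move=> t t0; have [L L0 HL] := P_lipschitz_time hA3 hx0.
have cP : {within `[0, t], continuous (P x0)}.
  apply: (lipschitz_within_continuous L0) => s r /andP[s0 _] /andP[r0 _].
  by have [] := HL s r s0 r0.
have [s] := EVT_max t0 cP; rewrite in_itv /= => /andP[s0 st] smax.
have [_ cL _ _ LD] := hlevel s0 st.
suff -> : level_family t = sublevel D P (P x0 s + lambda) t by [].
apply/seteqP; split => x; last by move=> Lx; exists s; rewrite ?s0.
move=> [r r0t [Dx Px]]; split=> //; apply: le_trans Px _.
by rewrite lerD2r; apply: smax; rewrite in_itv.
Qed.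

End LevelFamily.

Section LevelGeometry.
Variables (R : realType) (n : nat) (D : set 'cV[R]_n) (P : 'cV[R]_n -> R -> R).
Hypothesis hA3 : assumption3 D P.
Variables (t0 c rho : R) (K : R -> set 'cV[R]_n) (LPt L2Pt : R).
Hypotheses (ht0 : 0 <= t0) (hLPt : 0 <= LPt) (hL2Pt : 0 <= L2Pt).
Hypothesis hLK : forall t, t0 <= t -> sublevel D P c t `<=` K t.
Hypothesis hgrad : forall t, t0 <= t ->
  grad_sublevel D P rho t `<=` sublevel D P c t.
Hypothesis hKt : forall t s x, 0 <= t -> 0 <= s -> K t x -> K s x ->
  `|P x t - P x s| <= LPt * `|t - s| /\
  enorm (grad P x t - grad P x s) <= L2Pt * `|t - s|.

(** Slack that survives a time shift of [e], since [LPt] and [L2Pt] bound the rates in time of [P]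
    and of its gradient; the second alternative yields membership through [hgrad]. *)
Definition margin (e : R) (x : 'cV[R]_n) (t : R) : Prop :=
  P x t + LPt * e < c \/ enorm (grad P x t) + L2Pt * e < rho.

(* The Lipschitz bounds in time only relate times at which [x] belongs to the
   family; if [x] left the sublevel set, the intermediate value theorem would
   provide a time at which it is still in it but has already moved too far. *)
Lemma sublevel_persist t s x : t0 <= t -> t0 <= s -> D x ->
  margin `|s - t| x t -> sublevel D P c s x.
Proof.
move=> tt ts Dx m.
have [L L0 HL] := P_lipschitz_time hA3 Dx.
have t_ge0 := le_trans ht0 tt.
have s_ge0 := le_trans ht0 ts.
have absle r : Num.min t s <= r -> r <= Num.max t s -> `|r - t| <= `|s - t|.
  case: (leP t s) => ts'; rewrite ?(max_l (ltW ts')) => r1 r2.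
    by rewrite !ger0_norm; lra.
  by rewrite !ler0_norm; lra.
have minge r : Num.min t s <= r -> t0 <= r.
  by apply: le_trans; rewrite le_min tt.
have [Px|Px] := leP (P x s) c; first by [].
exfalso; have st0 := normr_ge0 (s - t); case: m => m.
  have p0 : 0 <= LPt * `|s - t| by apply: mulr_ge0.
  have [r [r1 r2 Pr]] := lipschitz_ivt (v := c) L0 t_ge0 s_ge0
    (fun t s t0 s0 => (HL t s t0 s0).1) (ltac:(lra)).
  have rt := minge _ r1.
  have Kr : K r x by apply: hLK => //; split=> //; rewrite Pr.
  have Kt : K t x by apply: hLK => //; split=> //; lra.
  have [H _] := hKt (le_trans ht0 rt) t_ge0 Kr Kt.
  have H1 := ler_wpM2l hLPt (absle _ r1 r2).
  have := ler_norm (P x r - P x t); lra.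
have p0 : 0 <= L2Pt * `|s - t| by apply: mulr_ge0.
have gs : rho <= enorm (grad P x s).
  rewrite leNgt; apply/negP => gs.
  have [_] : sublevel D P c s x by apply: hgrad => //; split=> //; exact: ltW.
  by move=> ?; lra.
have vab : enorm (grad P x t) <= rho <= enorm (grad P x s) by lra.
have [r [r1 r2 Pr]] := lipschitz_ivt (phi := fun t => enorm (grad P x t)) (v := rho)
    L0 t_ge0 s_ge0
    (fun t s t0 s0 => le_trans (ler_dist_dist _ _) (HL t s t0 s0).2) vab.
have rt := minge _ r1.
have Kr : K r x by apply/hLK/hgrad => //; split=> //; rewrite Pr.
have Kt : K t x by apply/hLK/hgrad => //; split=> //; lra.
have [_ H] := hKt (le_trans ht0 rt) t_ge0 Kr Kt.
have H1 := ler_wpM2l hL2Pt (absle _ r1 r2).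
have := enorm_leD (grad P x r) (grad P x t); lra.
Qed.

End LevelGeometry.

(** * Confinement of a trajectory to the sublevel sets over a short interval *)

Section Trajectory.
Variables (R : realType) (n : nat) (D : set 'cV[R]_n).
Variables (a b : R) (x : R -> 'cV[R]_n).
Hypotheses (a_ge0 : 0 <= a) (hx : ccont a b x).
Hypothesis hxD : forall t, a <= t <= b -> D (x t).

Lemma ccont_within_continuous : {within `[a, b], continuous x}.
Proof.
apply/subspace_continuousP => t tab.
apply/cvgrPdist_le => e e0; rewrite near_withinE; apply/nbhs_ballP.
have [d d0 dP] := hx tab e0; exists d => //= s; rewrite /ball /= => ts sab.
apply: le_trans (norm_le_enorm _) _; rewrite enormBC; apply: dP; first exact: sab.
by rewrite distrC.
Qed.

Lemma compact_trajectory : compact (x @` `[a, b]).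
Proof. exact: continuous_compact ccont_within_continuous (@segment_compact _ _ _). Qed.

Lemma trajectory_sub : x @` `[a, b] `<=` D.
Proof. by move=> _ [t tab <-]; apply: hxD. Qed.

Variable P : 'cV[R]_n -> R -> R.
Hypothesis hA3 : assumption3 D P.

(** Continuity must be available before membership in [K] is known: the Lipschitz constant comes
    from the compact image of the trajectory in [D]. *)
Lemma P_continuous_along t k : a <= t <= b -> 0 < k ->
  exists2 d, 0 < d & forall s, a <= s <= b -> `|s - t| < d ->
    `|P (x s) s - P (x t) t| <= k /\
    enorm (grad P (x s) s - grad P (x t) t) <= k.
Proof.
move=> tab k0.
have [L L0 HL] := P_lipschitz_on_compact hA3 compact_trajectory trajectory_sub.
have e0 : 0 < k / (2 * L) by rewrite divr_gt0 ?mulr_gt0.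
have [d d0 dP] := hx tab e0.
exists (Num.min d (k / (2 * L))); first by rewrite lt_min d0.
move=> s sab; rewrite lt_min => /andP[sd se].
have [||||H1 H2] := HL s t (x s) (x t).
- by case/andP: sab => + _; apply: le_trans.
- by case/andP: tab => + _; apply: le_trans.
- by exists s.
- by exists t.
have H : L * (enorm (x s - x t) + `|s - t|) <= k.
  have -> : k = L * (k / (2 * L) + k / (2 * L)).
    by field; rewrite gt_eqF.
  by rewrite ler_pM2l //; apply: lerD; [exact: dP|exact: ltW].
by split; [exact: le_trans H1 H|exact: le_trans H2 H].
Qed.

Variables (t0 c rho mu V LPx LPt L2Px L2Pt : R) (K : R -> set 'cV[R]_n).
Hypotheses (ht0 : 0 <= t0) (t0a : t0 <= a) (ab : a <= b).
Hypotheses (hLPx : 0 <= LPx) (hLPt : 0 <= LPt).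
Hypotheses (hL2Px : 0 <= L2Px) (hL2Pt : 0 <= L2Pt).
Hypotheses (rho0 : 0 < rho) (mu0 : 0 < mu) (V0 : 0 <= V).
Hypothesis hLK : forall t, t0 <= t -> sublevel D P c t `<=` K t.
Hypothesis hgrad : forall t, t0 <= t ->
  grad_sublevel D P rho t `<=` sublevel D P c t.
Hypothesis hK : forall t s y z, 0 <= t -> 0 <= s -> K t y -> K s z ->
  `|P y t - P z s| <= LPx * enorm (y - z) + LPt * `|t - s| /\
  enorm (grad P y t - grad P z s) <= L2Px * enorm (y - z) + L2Pt * `|t - s|.
Variable v : R -> 'cV[R]_n.
Hypothesis hv : forall t, a <= t < b -> approx x t (v t) 0.
Hypothesis hV : forall t, a <= t < b -> K t (x t) -> enorm (v t) <= V.
Hypothesis smallP : (LPx * V + LPt) * (b - a) <= mu / 4.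
Hypothesis smallg : (L2Px * V + L2Pt) * (b - a) <= rho / 16.

(** The two certificates of membership at level [c], with fractions that loosen from 3/4 and 1 at
    the initial time to 7/8 and 1/2 along the interval. *)
Definition well_inside (e f t : R) : Prop :=
  enorm (grad P (x t) t) <= rho * e \/ P (x t) t <= c - mu * f.

Hypothesis start : well_inside (3 / 4) 1 a.

Let inside t := well_inside (7 / 8) (1 / 2) t.

(** Later estimates vary time and position separately, hence the two times. The shift from one to
    the other costs at most [mu / 4] in [P] or [rho / 16] in the gradient, which the fractions 1/2
    and 7/8 can afford. *)
Lemma inside_sublevel t s : a <= t <= b -> a <= s <= b -> inside t ->
  sublevel D P c s (x t).
Proof.
move=> tab sab ins.
have tt0 : t0 <= t by case/andP: tab => + _; apply: le_trans.
have ts0 : t0 <= s by case/andP: sab => + _; apply: le_trans.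
have st : `|s - t| <= b - a by rewrite ler_norml; lra.
have smP : LPt * (b - a) <= mu / 4.
  apply: le_trans smallP; apply: ler_wpM2r; first by rewrite subr_ge0.
  by rewrite lerDr mulr_ge0.
have smg : L2Pt * (b - a) <= rho / 16.
  apply: le_trans smallg; apply: ler_wpM2r; first by rewrite subr_ge0.
  by rewrite lerDr mulr_ge0.
apply: (@sublevel_persist _ _ _ _ hA3 t0 c rho K LPt L2Pt _ _ _ hLK hgrad _ t s) => //.
- move=> t1 s1 y t10 s10 K1 K2.
  by have := hK t10 s10 K1 K2; rewrite !subrr enorm0 !mulr0 !add0r.
- exact: hxD.
- have := ler_wpM2l hLPt st; have := ler_wpM2l hL2Pt st.
  case: ins => ins H1 H2; [right|left]; have r0 := rho0; have m0 := mu0; lra.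
Qed.

Lemma displacement_le t : a <= t <= b -> (forall s, a <= s < t -> inside s) ->
  enorm (x t - x a) <= V * (t - a).
Proof.
move=> tab Qt.
have [at_ tb] := andP tab.
apply: (@approx_mean_value _ _ x v 0 V a t); rewrite ?lexx ?at_ //.
- exact: ccont_sub hx.
- by move=> s /andP[s1 s2]; apply: hv; rewrite s1 (lt_le_trans s2).
- move=> s /andP[s1 s2]; rewrite addr0; apply: hV.
    by rewrite s1 (lt_le_trans s2).
  have sab : a <= s <= b by rewrite s1 ltW // (lt_le_trans s2).
  apply: hLK; first exact: le_trans s1.
  by apply: inside_sublevel => //; apply: Qt; rewrite s1.
Qed.

Lemma P_variation t : a <= t <= b -> inside a -> inside t ->
  enorm (x t - x a) <= V * (t - a) ->
  `|P (x t) t - P (x a) a| <= mu / 4 /\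
  enorm (grad P (x t) t - grad P (x a) a) <= rho / 16.
Proof.
move=> tab ina int dx; have aab : a <= a <= b by rewrite lexx.
have [at_ tb] := andP tab.
have Ka : K a (x a) by apply: hLK => //; apply: inside_sublevel.
have Kt : K t (x t).
  by apply: hLK; [exact: le_trans at_|apply: inside_sublevel].
have [H1 H2] := hK (le_trans a_ge0 at_) a_ge0 Kt Ka.
have ta : `|t - a| = t - a by rewrite ger0_norm ?subr_ge0.
rewrite ta in H1 H2.
have E1 : LPx * enorm (x t - x a) <= LPx * (V * (b - a)).
  by apply: ler_wpM2l => //; apply: le_trans dx _; rewrite ler_wpM2l // lerD2r.
have E2 : L2Px * enorm (x t - x a) <= L2Px * (V * (b - a)).
  by apply: ler_wpM2l => //; apply: le_trans dx _; rewrite ler_wpM2l // lerD2r.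
have E3 : LPt * (t - a) <= LPt * (b - a) by rewrite ler_wpM2l // lerD2r.
have E4 : L2Pt * (t - a) <= L2Pt * (b - a) by rewrite ler_wpM2l // lerD2r.
have sP := smallP; have sg := smallg; split; lra.
Qed.

Lemma confinement t : a <= t <= b -> inside t /\ enorm (x t - x a) <= V * (t - a).
Proof.
have aab : a <= a <= b by rewrite lexx.
have ina : inside a by case: start => ?; [left|right]; have r0 := rho0; have m0 := mu0; lra.
suff Q : forall t, a <= t <= b -> inside t.
  move=> tab; split; first exact: Q.
  apply: displacement_le => // s /andP[s1 s2]; apply: Q; rewrite s1.
  by case/andP: tab => _; apply/le_trans/ltW.
apply: real_induction => // {}t /andP[at_ tb] Qt.
- have tab : a <= t <= b by rewrite at_ ltW.
  have int : inside t by apply: Qt; rewrite at_ lexx.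
  have dx : enorm (x t - x a) <= V * (t - a).
    by apply: displacement_le => // s /andP[s1 /ltW s2]; apply: Qt; rewrite s1.
  have [H1 H2] := P_variation tab ina int dx.
  (* At [t] the gradient is at most 3/4 + 1/16 of [rho], or [P] is below [c] by 3/4 of [mu]; a
     continuity error of [k] still leaves 7/8 and 1/2. *)
  pose k := Num.min (rho / 16) (mu / 4).
  have k0 : 0 < k by rewrite lt_min !divr_gt0.
  have [d d0 dP] := P_continuous_along tab k0; exists d => // s /andP[ts sd] sb.
  have [||H3 H4] := dP s; first by rewrite (le_trans at_ (ltW ts)).
    by rewrite gtr0_norm ?subr_gt0 // ltrBlDl.
  have kr : k <= rho / 16 by rewrite ge_min lexx.
  have km : k <= mu / 4 by rewrite ge_min lexx orbT.
  have H5 := ler_norm (P (x t) t - P (x a) a).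
  have H6 := ler_norm (P (x s) s - P (x t) t).
  have H7 := enorm_leD (grad P (x s) s) (grad P (x t) t).
  have H8 := enorm_leD (grad P (x t) t) (grad P (x a) a).
  have G1 : enorm (grad P (x s) s) <= enorm (grad P (x a) a) + rho / 16 + rho / 16.
    by apply: le_trans H7 (lerD (le_trans H8 (lerD (lexx _) H2)) (le_trans H4 kr)).
  have G2 : P (x s) s <= P (x a) a + mu / 4 + mu / 4.
    move: (le_trans H5 H1) (le_trans H6 (le_trans H3 km)).
    by rewrite !lerBlDl => H9 /le_trans; apply; rewrite lerD2r.
  have r0 := rho0; have m0 := mu0.
  clear dP d0 H1 H2 H3 H4 H5 H6 H7 H8 kr km k0 dx int tab aab ina at_ tb ts sd sb Qt.
  by case: start => st; [left|right]; lra.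
- have tab : a <= t <= b by rewrite tb ltW.
  (* The disjunction is a closed condition: if both inequalities failed at [t], they would fail by
     half their gaps just before [t]. *)
  have [Q|gQ] := leP (enorm (grad P (x t) t)) (rho * (7 / 8)); first by left.
  right; rewrite leNgt; apply/negP => PQ.
  pose k := Num.min (enorm (grad P (x t) t) - rho * (7 / 8))
                    (P (x t) t - (c - mu * (1 / 2))) / 2.
  have k0 : 0 < k by rewrite divr_gt0 // lt_min !subr_gt0 gQ.
  have [d d0 dP] := P_continuous_along tab k0.
  pose s := Num.max a (t - d / 2).
  have sa : a <= s by rewrite le_max lexx.
  have st : s < t by rewrite gt_max at_ /= gtrBl divr_gt0.
  have sd : t - s < d.
    have : t - d / 2 <= s by rewrite le_max lexx orbT.
    move: d0; lra.
  have [||H3 H4] := dP s; first by rewrite sa (le_trans (ltW st)).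
    by rewrite distrC gtr0_norm ?subr_gt0.
  have kg : k <= (enorm (grad P (x t) t) - rho * (7 / 8)) / 2.
    by rewrite ler_pM2r ?invr_gt0 // ge_min lexx.
  have kP : k <= (P (x t) t - (c - mu * (1 / 2))) / 2.
    by rewrite ler_pM2r ?invr_gt0 // ge_min lexx orbT.
  rewrite distrC in H3.
  have H5 := ler_norm (P (x t) t - P (x s) s).
  have H7 := enorm_leD (grad P (x t) t) (grad P (x s) s).
  rewrite enormBC in H7.
  have Qs : inside s by apply: Qt; rewrite sa st.
  case: Qs => ?; [clear H3 H5 kP PQ|clear H4 H7 kg gQ]; lra.
Qed.

Lemma confinement_sublevel t s : a <= t <= b -> a <= s <= b ->
  sublevel D P c s (x t).
Proof. by move=> tab sab; apply: inside_sublevel => //; have [] := confinement tab. Qed.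

End Trajectory.

(** * Variation of the vector fields along a trajectory *)

Section Derivatives.
Variables (R : realType) (n : nat).
Implicit Types (g x : R -> 'cV[R]_n) (A : set R).

(** The quotient is multiplied out, so that [s = t] needs no exclusion and errors add up by the
    triangle inequality. *)
Definition wderiv A g t (l : 'cV[R]_n) := forall eta, 0 < eta ->
  exists2 d, 0 < d & forall s, A s -> `|s - t| < d ->
    enorm (g s - g t - (s - t) *: l) <= eta * `|s - t|.

Lemma quotients_withinP A g t l :
  quotients_within A g t --> l <-> wderiv A g t l.
Proof.
have dE s : s != t -> g s - g t - (s - t) *: l =
    (s - t) *: ((s - t)^-1 *: (g s - g t) - l).
  by move=> st; rewrite scalerBr scalerA divff ?scale1r ?subr_eq0.
split=> [/cvgrPdist_le H eta eta0|H].
  have n0 : 0 < n%:R + 1 :> R by rewrite ltr_wpDl.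
  (* The limit is in the sup norm; a factor [n] is the price of the Euclidean norm, and the added 1
     covers [n = 0]. *)
  have := H (eta / (n%:R + 1)) (divr_gt0 eta0 n0).
  rewrite near_withinE => /nbhs_ballP[d /= d0 dP].
  exists d => // s As std.
  have [->|st] := eqVneq s t.
    by rewrite !subrr scale0r subr0 enorm0 normr0 mulr0.
  have := dP s; rewrite /ball /= distrC => /(_ std st As).
  rewrite distrC => H1; rewrite (dE s st) enormZ [leLHS]mulrC; apply: ler_wpM2r => //.
  apply: le_trans (enorm_le_norm _) _.
  apply: (le_trans (ler_wpM2l _ H1)) => //.
  rewrite mulrCA; apply: ler_piMr; first exact: ltW.
  by rewrite ler_pdivrMr // mul1r lerDl.
apply/cvgrPdist_le => e e0; rewrite near_withinE.
have [d d0 dP] := H e e0; apply/nbhs_ballP; exists d => // s.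
rewrite /ball /= distrC => std st As.
apply: le_trans (norm_le_enorm _) _; rewrite enormBC.
have := dP s As std; rewrite (dE s st) enormZ mulrC ler_pM2r //.
by rewrite normr_gt0 subr_eq0.
Qed.

Lemma wderiv_sub A B g t l : B `<=` A -> wderiv A g t l -> wderiv B g t l.
Proof.
move=> BA H eta eta0; have [d d0 dP] := H eta eta0.
by exists d => // s /BA; apply: dP.
Qed.

Lemma wderiv_ext A g g' t l : (forall s, A s -> g s = g' s) -> g t = g' t ->
  wderiv A g t l -> wderiv A g' t l.
Proof.
move=> gg' gt H eta eta0; have [d d0 dP] := H eta eta0.
by exists d => // s As; rewrite -gg' // -gt; apply: dP.
Qed.

Lemma wderivU A B g t l : wderiv A g t l -> wderiv B g t l ->
  wderiv (A `|` B) g t l.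
Proof.
move=> HA HB eta eta0; have [d d0 dP] := HA eta eta0.
have [d' d'0 d'P] := HB eta eta0.
exists (Num.min d d'); first by rewrite lt_min d0.
move=> s; rewrite lt_min => -[/dP H|/d'P H] /andP[? ?]; exact: H.
Qed.

Lemma wderiv_approx a b g t l : a <= t < b -> wderiv `[a, b[ g t l ->
  approx g t l 0.
Proof.
move=> /andP[at_ tb] H eta eta0; have [d d0 dP] := H eta eta0.
exists (Num.min d (b - t)); first by rewrite lt_min d0 subr_gt0.
move=> h; rewrite lt_min => /andP[h0 /andP[hd hb]].
have := dP (t + h); rewrite (addrC t) addrK gtr0_norm // add0r => -> //.
by rewrite /= in_itv /=; apply/andP; split; lra.
Qed.

Lemma wderiv_ccont a b x (v : R -> 'cV[R]_n) :
  (forall t, a <= t <= b -> wderiv `[a, b] x t (v t)) -> ccont a b x.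
Proof.
move=> H t tab eta eta0.
have [d d0 dP] := H t tab 1 ltr01.
have w0 : 0 < enorm (v t) + 1 by rewrite ltr_wpDl ?enorm_ge0.
exists (Num.min d (eta / (enorm (v t) + 1))).
  by rewrite lt_min d0 divr_gt0.
move=> s sab; rewrite lt_min ltr_pdivlMr // => /andP[sd se].
have := dP s (ltac:(by rewrite /= in_itv /=)) sd.
have := enorm_leD (x s - x t) ((s - t) *: v t); rewrite enormZ.
move: se; rewrite mulrDr; lra.
Qed.

Lemma C1_time_wderiv g t : C1_time g -> 0 <= t ->
  wderiv `[0, +oo[ g t (dtime g t).
Proof. by move=> [H _] t0; apply/quotients_withinP; apply: H. Qed.

Lemma C1_time_lipschitz g (H a b : R) : C1_time g -> 0 <= a -> a <= b ->
  (forall t, a <= t <= b -> enorm (dtime g t) <= H) ->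
  enorm (g b - g a) <= H * (b - a).
Proof.
move=> C1 a0 ab gH.
have wd t : a <= t <= b -> wderiv `[a, b] g t (dtime g t).
  move=> /andP[at_ tb]; apply: wderiv_sub (C1_time_wderiv C1 (le_trans a0 at_)).
  by move=> s /=; rewrite !in_itv /= andbT => /andP[/(le_trans a0)].
apply: (@approx_mean_value _ _ g (dtime g) 0 H a b).
- exact: wderiv_ccont wd.
- move=> t /andP[at_ tb]; apply: (@wderiv_approx a b); first by rewrite at_.
  apply: wderiv_sub (wd t _); last by rewrite at_ ltW.
  by move=> s /=; rewrite !in_itv /= => /andP[-> /ltW].
- by move=> t /andP[at_ tb]; rewrite addr0 gH // at_ ltW.
- by rewrite ab lexx.
Qed.

Lemma differentiable_enorm (Phi : 'cV[R]_n -> 'cV[R]_n) y : differentiable Phi y ->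
  forall eta, 0 < eta -> exists2 d, 0 < d & forall z, enorm z < d ->
    enorm (Phi (y + z) - Phi y - 'd Phi y z) <= eta * enorm z.
Proof.
move=> dPhi eta eta0.
have n0 : 0 < n%:R + 1 :> R by rewrite ltr_wpDl.
have /eqaddoP/(_ _ (divr_gt0 eta0 n0)) := diff_locally dPhi.
move=> /nbhs_ballP[d /= d0 dP]; exists d => // z zd.
have zb : ball (0 : 'cV[R]_n) d z.
  by rewrite -ball_normE /ball_ /= sub0r normrN (le_lt_trans (norm_le_enorm z)).
have H : `|Phi (y + z) - Phi y - 'd Phi y z| <= eta / (n%:R + 1) * `|z|.
  by rewrite (addrC y) -addrA -opprD; exact: dP z zb.
apply: le_trans (enorm_le_norm _) _; apply: le_trans (ler_wpM2l _ H) _ => //.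
have -> : n%:R * (eta / (n%:R + 1) * `|z|) = eta * (n%:R / (n%:R + 1) * `|z|).
  by field; rewrite gt_eqF.
rewrite ler_pM2l //.
apply: le_trans _ (norm_le_enorm z); apply: ler_piMl => //.
by rewrite ler_pdivrMr // mul1r lerDl.
Qed.

Lemma linear_enorm (f : {linear 'cV[R]_n -> 'cV[R]_n}) :
  exists2 M, 0 < M & forall z, enorm (f z) <= M * enorm z.
Proof.
exists (\sum_(i < n) enorm (f (delta_mx i ord0)) + 1).
  by rewrite ltr_wpDl // sumr_ge0 // => i _; apply: enorm_ge0.
move=> z.
have {1}-> : z = \sum_i z i ord0 *: delta_mx i ord0.
  apply/colP => i; rewrite summxE (bigD1 i) //= !mxE !eqxx mulr1 big1 ?addr0 //.
  by move=> j ji; rewrite !mxE eq_sym (negbTE ji) mulr0.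
rewrite linear_sum; apply: le_trans (ler_enorm_sum _ _ _) _.
rewrite mulrDl mul1r mulr_suml; apply: ler_wpDr; first exact: enorm_ge0.
apply: ler_sum => i _; rewrite linearZ /= enormZ mulrC.
by apply: ler_wpM2l; [exact: enorm_ge0|exact: coord_le_enorm].
Qed.

End Derivatives.

Section AlongTrajectory.
Variables (R : realType) (n : nat) (a b H : R) (x v : R -> 'cV[R]_n).
Variable Phi : 'cV[R]_n -> R -> 'cV[R]_n.
Hypotheses (a_ge0 : 0 <= a) (hx : ccont a b x).
Hypothesis hv : forall t, a <= t < b -> approx x t (v t) 0.
Hypothesis diffPhi : forall t, a <= t <= b -> differentiable (Phi ^~ t) (x t).
Hypothesis C1Phi : forall t, a <= t <= b -> C1_time (Phi (x t)).
Hypothesis boundPhi : forall s t, a <= s <= b -> a <= t <= b ->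
  enorm (dtime (Phi (x t)) s) <= H.

Lemma time_increment s t r : a <= s <= b -> a <= t <= b -> a <= r <= b ->
  enorm (Phi (x r) s - Phi (x r) t) <= H * `|s - t|.
Proof.
wlog st : s t / t <= s => [W sab tab rab|].
  case: (leP s t) => [st|/ltW ts]; last exact: W.
  by rewrite enormBC distrC; apply: W.
move=> /andP[as_ sb] /andP[at_ tb] rab; rewrite ger0_norm ?subr_ge0 //.
apply: C1_time_lipschitz => //; [exact: C1Phi|exact: le_trans at_|].
by move=> q /andP[q1 q2]; apply: boundPhi => //; apply/andP; split; lra.
Qed.

(** The increment splits into a time increment at the fixed position [x (t + h)], which costs a
    slope of at most [H], and a position increment at the fixed time [t], where the differential
    applies. This is why [boundPhi] lets time and position refer to different instants. *)
Lemma approx_along t : a <= t < b ->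
  approx (fun t => Phi (x t) t) t ('D_(v t) (Phi ^~ t) (x t)) H.
Proof.
move=> /[dup] tab /andP[at_ tb] eta eta0.
have tab' : a <= t <= b by rewrite at_ ltW.
have dP := diffPhi tab'; rewrite deriveE //.
have [M M0 HM] := linear_enorm ('d (Phi ^~ t) (x t)).
pose w := enorm (v t) + 1.
have w0 : 0 < w by rewrite ltr_wpDl ?enorm_ge0.
have e1 : 0 < eta / (2 * w) by rewrite divr_gt0 ?mulr_gt0.
have e2 : 0 < eta / (2 * M) by rewrite divr_gt0 ?mulr_gt0.
have [d1 d10 d1P] := differentiable_enorm dP e1.
have [d2 d20 d2P] := hv tab ltr01.
have [d3 d30 d3P] := hv tab e2.
exists (Num.min (Num.min d2 d3) (Num.min (d1 / w) (b - t))).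
  by rewrite !lt_min d20 d30 divr_gt0 //= subr_gt0.
move=> h; rewrite !lt_min => /andP[h0 /andP[/andP[h2 h3] /andP[h1 hb]]].
have := d2P h; have := d3P h; rewrite h0 h2 h3 => /(_ isT) + /(_ isT).
rewrite !add0r mul1r.
set z := x (t + h) - x t => H3 H2.
have zw : enorm z <= w * h.
  have := enorm_leD z (h *: v t); rewrite enormZ gtr0_norm //.
  by move=> /le_trans; apply; rewrite mulrDl mul1r mulrC lerD2l.
have zd : enorm z < d1 by apply: le_lt_trans zw _; rewrite mulrC -ltr_pdivlMr.
have := d1P z zd; rewrite {1}/z (addrC (x t)) subrK => H1.
have thab : a <= t + h <= b by apply/andP; split; lra.
have H4 := time_increment thab tab' thab.
rewrite (addrC t) addrK gtr0_norm // (addrC h) in H4.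
have H5 := HM (z - h *: v t); rewrite linearB linearZ in H5.
have H6 : M * enorm (z - h *: v t) <= eta / 2 * h.
  apply: le_trans (ler_wpM2l (ltW M0) H3) _.
  by rewrite mulrA ler_pM2r // (_ : M * (eta / (2 * M)) = eta / 2) //; field; rewrite gt_eqF.
have H7 : eta / (2 * w) * enorm z <= eta / 2 * h.
  apply: le_trans (ler_wpM2l (ltW e1) zw) _.
  by rewrite mulrA ler_pM2r // (_ : eta / (2 * w) * w = eta / 2) //; field; rewrite gt_eqF.
set p1 := Phi _ (t + h) in H4 *; set p2 := Phi (x (t + h)) t in H4 H1 *.
set p3 := Phi (x t) t in H1 *; set q1 := 'd _ _ z in H1 H5 *.
set q2 := 'd _ _ (v t) in H5 *.
have -> : p1 - p3 - h *: q2 = (p1 - p2) + ((p2 - p3 - q1) + (q1 - h *: q2)).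
  by rewrite subrKA -[p2 - p3 - _]addrA subrKA addrA.
have := ler_enormD (p1 - p2) (p2 - p3 - q1 + (q1 - h *: q2)).
have := ler_enormD (p2 - p3 - q1) (q1 - h *: q2).
have H51 := le_trans H5 H6; have H71 := le_trans H1 H7.
clear -H4 H51 H71; rewrite mulrDl; lra.
Qed.

Lemma ccont_along : ccont a b (fun t => Phi (x t) t).
Proof.
move=> t tab eta eta0.
have [M M0 HM] := linear_enorm ('d (Phi ^~ t) (x t)).
have [d1 d10 d1P] := differentiable_enorm (diffPhi tab) ltr01.
have e0 : 0 < eta / (2 * (M + 1)) by rewrite divr_gt0 ?mulr_gt0 ?addr_gt0.
have [d2 d20 d2P] := hx tab (divr_gt0 d10 (ltr0Sn R 1)).
have [d3 d30 d3P] := hx tab e0.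
have H0 : 0 < `|H| + 1 by rewrite ltr_wpDl.
exists (Num.min (Num.min d2 d3) (eta / (2 * (`|H| + 1)))).
  by rewrite !lt_min d20 d30 divr_gt0 ?mulr_gt0.
move=> s sab; rewrite !lt_min => /andP[/andP[s2 s3] s4].
have zd : enorm (x s - x t) < d1.
  by apply: le_lt_trans (d2P s sab s2) _; rewrite gtr_pMr // invf_lt1 // ltr1n.
have := d1P _ zd; rewrite (addrC (x t)) subrK mul1r => H1.
have H2 := HM (x s - x t).
have H3 : (M + 1) * enorm (x s - x t) <= eta / 2.
  apply: le_trans (ler_wpM2l _ (d3P s sab s3)) _; first by rewrite ltW ?addr_gt0.
  rewrite (_ : (M + 1) * (eta / (2 * (M + 1))) = eta / 2) //.
  by field; rewrite gt_eqF // addr_gt0.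
have H4 : H * `|s - t| <= eta / 2.
  apply: (@le_trans _ _ ((`|H| + 1) * `|s - t|)).
    by rewrite ler_wpM2r // (le_trans (ler_norm _)) // lerDl.
  apply: le_trans (ler_wpM2l (ltW H0) (ltW s4)) _.
  by rewrite (_ : (`|H| + 1) * (eta / (2 * (`|H| + 1))) = eta / 2) //; field; rewrite gt_eqF.
have H5 := time_increment sab tab sab.
have := ler_dist_enorm (Phi (x s) s) (Phi (x s) t) (Phi (x t) t).
have := enorm_leD (Phi (x s) t - Phi (x t) t) ('d (Phi ^~ t) (x t) (x s - x t)).
rewrite mulrDl mul1r in H3.
by move=> H6 H7; clear -H1 H2 H3 H4 H5 H6 H7; lra.
Qed.

End AlongTrajectory.

Section LieDerivatives.

(** The basis expansion of a Lie derivative used below is an identity on [D], hence only near the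
    point considered. *)
Lemma near_eq_differentiable (R : numFieldType) (V W : normedModType R)
    (f g : V -> W) x :
  {near x, f =1 g} -> differentiable f x -> differentiable g x.
Proof.
move=> fg df; have gx : f x = g x := nbhs_singleton fg.
have dg : g \o shift x = cst (g x) + 'd f x +o_ 0 id.
  apply/eqaddoP => e e0; have /eqaddoP/(_ _ e0) := diff_locally df.
  have : \forall h \near nbhs (0 : V), f (h + x) = g (h + x).
    move: fg => /nbhs_ballP[d d0 dP]; apply/nbhs_ballP; exists d => // h.
    rewrite -ball_normE /ball_ /= sub0r => hd; apply: dP.
    by rewrite -ball_normE /ball_ /= opprD addrCA subrr addr0.
  apply: filterS2 => h fgh.
  rewrite -[_ \o _]/(fun h => f (h + x)) !fctE /= fgh gx.
  by [].
by apply/diff_locallyP; rewrite (diff_unique (diff_continuous df) dg);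
  split => //; apply: diff_continuous.
Qed.

Variables (R : realType) (n : nat).

Lemma derive_sum_dir (Phi : 'cV[R]_n -> 'cV[R]_n) x (I : Type) (r : seq I)
    (c : I -> R) (w : I -> 'cV[R]_n) : differentiable Phi x ->
  'D_(\sum_(k <- r) c k *: w k) Phi x = \sum_(k <- r) c k *: 'D_(w k) Phi x.
Proof.
move=> dP; rewrite deriveE // linear_sum; apply: eq_bigr => k _.
by rewrite linearZ deriveE.
Qed.

(** [Ck_on] speaks of derivatives in fixed directions, while the direction of a Lie derivative moves
    with the point; expanding [g] in the canonical basis reduces the latter to the former. *)
Lemma differentiable_lie (D : set 'cV[R]_n) (f g : 'cV[R]_n -> R -> 'cV[R]_n) t x :
  open D -> D x -> Ck_on D 2 (f ^~ t) -> Ck_on D 2 (g ^~ t) ->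
  differentiable ((lie g f) ^~ t) x.
Proof.
move=> oD Dx [df ddf] [dg _].
pose h := \sum_(i < n) (fun y => g y t i ord0 *: 'D_(delta_mx i ord0) (f ^~ t) y).
apply: (@near_eq_differentiable _ _ _ h).
  have : \near x, D x by apply: open_nbhs_nbhs.
  apply: filterS => y Dy; rewrite /lie /h fct_sumE.
  rewrite -(derive_sum_dir _ (fun i => g y t i ord0)); last exact: df.
  congr derive; apply/colP => i; rewrite summxE (bigD1 i) //= !mxE !eqxx mulr1.
  by rewrite big1 ?addr0 // => j ji; rewrite !mxE eq_sym (negbTE ji) mulr0.
apply: differentiable_sum => i.
have d1 : differentiable (fun y => g y t i ord0 : R) x.
  apply: (@differentiable_comp _ _ _ _ (g ^~ t) (fun N : 'cV[R]_n => N i ord0 : R)).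
    exact: dg.
  exact: differentiable_coord.
have d2 : differentiable (fun y => 'D_(delta_mx i ord0) (f ^~ t) y) x.
  by have [dd _] := ddf (delta_mx i ord0); apply: dd.
have -> : (fun y => g y t i ord0 *: 'D_(delta_mx i ord0) (f ^~ t) y) =
    \sum_(j < n) (fun y => (g y t i ord0 * 'D_(delta_mx i ord0) (f ^~ t) y j ord0)
                     *: (delta_mx j ord0 : 'cV[R]_n)).
  apply/funext => y; rewrite fct_sumE; apply/colP => j; rewrite summxE.
  rewrite (bigD1 j) //= !mxE !eqxx mulr1 big1 ?addr0 // => k kj.
  by rewrite !mxE eq_sym (negbTE kj) mulr0.
apply: differentiable_sum => j; apply: differentiableZl; apply: differentiableM => //.
apply: (@differentiable_comp _ _ _ _ (fun y => 'D_(delta_mx i ord0) (f ^~ t) y)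
  (fun N : 'cV[R]_n => N j ord0 : R)) => //.
exact: differentiable_coord.
Qed.

End LieDerivatives.

Section ScalarPrimitives.
Variables (R : realType) (n : nat).

Lemma is_derive_increment (w : R -> R) (t l : R) : is_derive t 1 w l ->
  forall eta, 0 < eta -> exists2 d, 0 < d & forall s, `|s - t| < d ->
    `|w s - w t - (s - t) * l| <= eta * `|s - t|.
Proof.
move=> [dw <-] eta eta0; have /eqaddoP/(_ _ eta0) := derivable_nbhs dw.
move=> /nbhs_ballP[d d0 dP]; exists d => // s std.
have := dP (s - t); rewrite -ball_normE /ball_ /= sub0r normrN => /(_ std).
rewrite -[X in `|X| <= _]/(w ((s - t) *: 1 + t) - (w t + (s - t) *: 'D_1 w t)).
by rewrite -[(s - t) *: 1]/((s - t) * 1) mulr1 subrK opprD addrA.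
Qed.

Lemma approx_scale (w : R -> R) (c : 'cV[R]_n) (t l : R) : is_derive t 1 w l ->
  approx (fun t => w t *: c) t (l *: c) 0.
Proof.
move=> dw eta eta0.
have c0 : 0 < enorm c + 1 by rewrite ltr_wpDl ?enorm_ge0.
have [d d0 dP] := is_derive_increment dw (divr_gt0 eta0 c0).
exists d => // h /andP[h0 hd]; have := dP (t + h).
rewrite (addrC t) addrK gtr0_norm // => /(_ hd) H.
rewrite scalerA -!scalerBl enormZ add0r.
apply: le_trans (ler_wpM2r (enorm_ge0 c) H) _.
rewrite mulrAC ler_pM2r // mulrAC ler_pdivrMr // ler_pM2l //.
by rewrite lerDl.
Qed.

Lemma ccont_scale (w dw : R -> R) (c : 'cV[R]_n) (a b : R) :
  (forall t, a <= t <= b -> is_derive t 1 w (dw t)) ->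
  ccont a b (fun t => w t *: c).
Proof.
move=> Hw; apply: (@wderiv_ccont _ _ a b _ (fun t => dw t *: c)) => t tab eta eta0.
have c0 : 0 < enorm c + 1 by rewrite ltr_wpDl ?enorm_ge0.
have [d d0 dP] := is_derive_increment (Hw t tab) (divr_gt0 eta0 c0).
exists d => // s _ std; rewrite scalerA -!scalerBl enormZ.
apply: le_trans (ler_wpM2r (enorm_ge0 c) (dP s std)) _.
rewrite mulrAC ler_wpM2r // mulrAC ler_pdivrMr // ler_pM2l //.
by rewrite lerDl.
Qed.

End ScalarPrimitives.

Ltac nonneg := repeat first [done | apply: mulr_ge0 | apply: addr_ge0].

(** * Second-order expansion of a trajectory *)

Section Expansion.
Variables (R : realType) (n m : nat) (a b : R) (x : R -> 'cV[R]_n).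
Variable f : 'I_m -> 'cV[R]_n -> R -> 'cV[R]_n.
Variables (u o V : 'I_m -> R -> R) (Z : 'I_m -> 'I_m -> R -> R) (alpha : 'I_m -> R).
Variables (U A B L2f Lft Hfx Hft : R).
Hypotheses (a_ge0 : 0 <= a) (ab : a <= b) (hx : ccont a b x).
Hypothesis hv : forall t, a <= t < b ->
  approx x t (\sum_k u k t *: f k (x t) t) 0.
Hypothesis uE : forall k t, u k t = alpha k + o k t.
Hypothesis dV : forall (k : 'I_m) (t : R), is_derive t 1 (V k) (o k t).
Hypothesis dZ : forall (k l : 'I_m) (t : R), is_derive t 1 (Z k l) (o k t * V l t).
Hypotheses (V_a : forall k, V k a = 0) (Z_a : forall k l, Z k l a = 0).
Hypotheses (U0 : 0 <= U) (A0 : 0 <= A) (B0 : 0 <= B) (L2f0 : 0 <= L2f)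
  (Lft0 : 0 <= Lft) (Hfx0 : 0 <= Hfx) (Hft0 : 0 <= Hft).
Hypothesis u_le : forall k t, a <= t <= b -> `|u k t| <= U.
Hypothesis alpha_le : forall k, `|alpha k| <= A.
Hypothesis V_le : forall k t, a <= t <= b -> `|V k t| <= B.
Hypothesis diff_f : forall k t, a <= t <= b -> differentiable (f k ^~ t) (x t).
Hypothesis diff_lie : forall k l t, a <= t <= b ->
  differentiable (lie (f l) (f k) ^~ t) (x t).
Hypothesis C1_f : forall k t, a <= t <= b -> C1_time (f k (x t)).
Hypothesis C1_lie : forall k l t, a <= t <= b -> C1_time (lie (f l) (f k) (x t)).
Hypothesis f_bounds : forall j k l s t, a <= s <= b -> a <= t <= b ->
  [/\ enorm (dtime (f k (x t)) s) <= Lft,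
      enorm (lie (f j) (f k) (x t) s) <= L2f,
      enorm (lie (f l) (lie (f j) (f k)) (x t) s) <= Hfx &
      enorm (dtime (lie (f j) (f k) (x t)) s) <= Hft].

Let M : R := m%:R.
Let F0 k := f k (x a) a.
Let L0 k l := lie (f l) (f k) (x a) a.

Lemma enorm_lincomb (c : 'I_m -> R) (w : 'I_m -> 'cV[R]_n) p q :
  0 <= p -> (forall k, `|c k| <= p) -> (forall k, enorm (w k) <= q) ->
  enorm (\sum_k c k *: w k) <= M * (p * q).
Proof.
move=> p0 cp wq; apply: le_trans (ler_enorm_sum _ _ _) _.
apply: (@le_trans _ _ (\sum_(k < m) p * q)); last first.
  by rewrite sumr_const card_ord mulr_natl.
by apply: ler_sum => k _; rewrite enormZ ler_pM ?enorm_ge0.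
Qed.

(** In the application [U] is of order [1 / e], [B] of order [e] and [b - a] equals [e ^+ 2]; then
    [CW] is of order [e], [CG] of order [e ^+ 2], and the final remainder of order [e ^+ 3]. *)
Let CW := (M * (U * Hfx) + Hft) * (b - a).

Lemma lie_variation k l t : a <= t <= b ->
  enorm (lie (f l) (f k) (x t) t - L0 k l) <= CW.
Proof.
move=> tab; have cw := ccont_along a_ge0 hx (diff_lie k l) (C1_lie k l)
  (fun s t sab tab => (let: And4 _ _ _ H := f_bounds l k l sab tab in H)).
have M0 : 0 <= M by apply: ler0n.
have := @approx_mean_value _ _ _ (fun t => \sum_i u i t *: lie (f i) (lie (f l) (f k)) (x t) t)
  Hft (M * (U * Hfx) + Hft) a b cw _ _ t tab.
move=> /(_ _ _)/le_trans; apply; last first.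
  rewrite /CW; apply: ler_wpM2l.
    by nonneg.
  by rewrite lerD2r; case/andP: tab.
- move=> s /[dup] sab /andP[as_ /ltW sb].
  have sab' : a <= s <= b by rewrite as_.
  rewrite lerD2r; apply: enorm_lincomb => // i; first exact: u_le.
  by have [] := f_bounds l k i sab' sab'.
- move=> s /[dup] sab /andP[as_ /ltW sb].
  have sab' : a <= s <= b by rewrite as_.
  have := approx_along a_ge0 hv (diff_lie k l) (C1_lie k l)
    (fun s t sab tab => (let: And4 _ _ _ H := f_bounds l k l sab tab in H)) sab.
  by rewrite derive_sum_dir //; apply: diff_lie.
Qed.

Let CG := (M * (U * CW) + M * (A * L2f) + Lft) * (b - a).

Let M0 : 0 <= M. Proof. exact: ler0n. Qed.
Let ba0 : 0 <= b - a. Proof. by rewrite subr_ge0. Qed.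
Let CW0 : 0 <= CW.
Proof. by rewrite /CW; nonneg. Qed.
Let CG0 : 0 <= CG.
Proof. by rewrite /CG; nonneg. Qed.

Lemma L0_le k l : enorm (L0 k l) <= L2f.
Proof. by have [] := f_bounds l k l (t := a) (s := a); rewrite ?lexx. Qed.

(** Only the oscillating part [V], of order [e], is subtracted; the drift [alpha] moves the field by
    order [e ^+ 2] and is absorbed into [CG]. *)
Lemma field_variation k t : a <= t <= b ->
  enorm (f k (x t) t - F0 k - \sum_l V l t *: L0 k l) <= CG.
Proof.
move=> tab.
have bnd s r (sab : a <= s <= b) (rab : a <= r <= b) :
  enorm (dtime (f k (x r)) s) <= Lft by have [] := f_bounds k k k sab rab.
have cf := ccont_along a_ge0 hx (diff_f k) (C1_f k) bnd.
pose phi s := f k (x s) s + (-1) *: (\sum_l V l s *: L0 k l).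
pose dphi s := (\sum_l u l s *: lie (f l) (f k) (x s) s) +
               (-1) *: (\sum_l o l s *: L0 k l).
have cphi : ccont a b phi.
  apply: ccontD => //; apply/ccontZ/ccont_sum => l.
  by apply: (@ccont_scale _ _ _ (o l)) => s _.
have aphi s : a <= s < b -> approx phi s (dphi s) Lft.
  move=> /[dup] sab /andP[as_ /ltW sb].
  have sab' : a <= s <= b by rewrite as_.
  rewrite -[Lft]addr0; apply: approxD.
    have := approx_along a_ge0 hv (diff_f k) (C1_f k) bnd sab.
    by rewrite derive_sum_dir //; apply: diff_f.
  have := approxZ (-1) (approx_sum (index_enum 'I_m)
    (fun l => approx_scale (L0 k l) (dV l s))).
  by rewrite mulr0.
have bphi s : a <= s < b ->
    enorm (dphi s) + Lft <= M * (U * CW) + M * (A * L2f) + Lft.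
  move=> /andP[as_ /ltW sb]; have sab : a <= s <= b by rewrite as_.
  rewrite lerD2r.
  (* Since [u = alpha + o], the oscillation at the initial point cancels, leaving the variation of
     the Lie derivatives and the drift. *)
  have -> : dphi s = \sum_l u l s *: (lie (f l) (f k) (x s) s - L0 k l) +
                     \sum_l alpha l *: L0 k l.
    rewrite /dphi scaleN1r -sumrN -!big_split; apply: eq_bigr => l _ /=.
    by rewrite scalerBr -addrA; congr (_ + _); rewrite uE scalerDl opprD addrAC addNr add0r.
  apply: le_trans (ler_enormD _ _) _; apply: lerD; apply: enorm_lincomb => // l.
  - exact: u_le.
  - exact: lie_variation.
  - exact: L0_le.
have := approx_mean_value cphi aphi bphi tab.
have -> : phi t - phi a = f k (x t) t - F0 k - \sum_l V l t *: L0 k l.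
  rewrite /phi [X in _ - (_ + _ *: X)]big1 ?scaler0 ?addr0 ?scaleN1r 1?addrAC //.
  by move=> l _; rewrite V_a scale0r.
move=> /le_trans; apply; rewrite /CG; apply: ler_wpM2l.
  by nonneg.
by rewrite lerD2r; case/andP: tab.
Qed.

(* Second-order Chen-Fliess expansion: [V k] and [Z k l] are the iterated
   integrals of [o k] and of [o k * V l]; the iterated integrals involving the
   slow part [alpha] are negligible and go into the remainder. *)
Lemma trajectory_expansion :
  enorm (x b - x a - (\sum_k (alpha k * (b - a) + V k b) *: F0 k +
                      \sum_k \sum_l Z k l b *: L0 k l))
  <= (M * (U * CG) + M * (A * (M * (B * L2f)))) * (b - a).
Proof.
pose S s := \sum_k (alpha k * (s - a) + V k s) *: F0 k +
            \sum_k \sum_l Z k l s *: L0 k l.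
pose dS s := \sum_k u k s *: F0 k + \sum_k \sum_l (o k s * V l s) *: L0 k l.
pose phi s := x s + (-1) *: S s.
pose dphi s := (\sum_k u k s *: f k (x s) s) + (-1) *: dS s.
have dU (k : 'I_m) (s : R) :
    is_derive s 1 (fun s => alpha k * (s - a) + V k s) (u k s).
  have D1 : is_derive s 1 (alpha k *: (@idfun R - cst a)) (alpha k *: (1 - 0)).
    exact: is_deriveZ.
  have E : alpha k *: (1 - 0) + o k s = u k s.
    by rewrite uE subr0 -[_ *: _]/(_ * _) mulr1.
  exact: (is_derive_eq (is_deriveD D1 (dV k s)) E).
have cphi : ccont a b phi.
  apply: ccontD => //; apply/ccontZ/ccontD; apply: ccont_sum => k.
    by apply: (@ccont_scale _ _ _ (u k)) => s _.
  apply: ccont_sum => l.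
  by apply: (@ccont_scale _ _ _ (fun s => o k s * V l s)) => s _.
have aphi s : a <= s < b -> approx phi s (dphi s) 0.
  move=> sab; have := approxD (hv sab) (approxZ (-1)
    (approxD (approx_sum (index_enum 'I_m) (fun k => approx_scale (F0 k) (dU k s)))
     (approx_sum (index_enum 'I_m) (fun k => approx_sum (index_enum 'I_m)
        (fun l => approx_scale (L0 k l) (dZ k l s)))))).
  by rewrite !(addr0, mulr0).
have bphi s : a <= s < b ->
    enorm (dphi s) + 0 <= M * (U * CG) + M * (A * (M * (B * L2f))).
  move=> /andP[as_ /ltW sb]; have sab : a <= s <= b by rewrite as_.
  rewrite addr0.
  (* Here [o * V] is [u * V - alpha * V]: the first part completes the difference bounded by
     [field_variation], the second is small because [V] is. *)
  have -> : dphi s =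
      \sum_k u k s *: (f k (x s) s - F0 k - \sum_l V l s *: L0 k l) +
      \sum_k alpha k *: (\sum_l V l s *: L0 k l).
    rewrite /dphi /dS scaleN1r opprD -!sumrN addrA -!big_split.
    apply: eq_bigr => k _ /=; rewrite !scalerBr -[RHS]addrA; congr (_ + _).
    have -> : \sum_l (o k s * V l s) *: L0 k l = o k s *: \sum_l V l s *: L0 k l.
      by rewrite scaler_sumr; apply: eq_bigr => l _; rewrite scalerA.
    have -> : o k s = u k s - alpha k by rewrite uE addrC addKr.
    by rewrite scalerBl opprB addrC.
  apply: le_trans (ler_enormD _ _) _; apply: lerD; apply: enorm_lincomb => // k.
  - exact: u_le.
  - exact: field_variation.
  - by apply: enorm_lincomb => // l; [exact: V_le|exact: L0_le].
have := approx_mean_value cphi aphi bphi (ltac:(by rewrite ab lexx) : a <= b <= b).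
have -> // : phi b - phi a = x b - x a - S b.
rewrite /phi; have -> : S a = 0.
  rewrite /S !big1 ?addr0 //.
    by move=> k _; rewrite big1 // => l _; rewrite Z_a scale0r.
  by move=> k _; rewrite subrr mulr0 V_a addr0 scale0r.
by rewrite scaler0 addr0 scaleN1r addrAC.
Qed.

End Expansion.

(** * Oscillating controls *)

Section TrigonometricPrimitives.
Variable R : realType.

Lemma cosDint (x : R) (z : int) : cos (x + z%:~R * (2 * pi)) = cos x.
Proof.
have H k y : cos (y + k%:R * (2 * pi)) = cos y :> R.
  by rewrite mulr_natl (mulr_natl _ 2) (periodicn (@cosD2pi R)).
case: z => k; first exact: H.
rewrite -[LHS](H k.+1) NegzE rmorphN /= mulNr; congr cos; rewrite -pmulrn.
by rewrite subrK.
Qed.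

Lemma sinDint (x : R) (z : int) : sin (x + z%:~R * (2 * pi)) = sin x.
Proof.
have H k y : sin (y + k%:R * (2 * pi)) = sin y :> R.
  by rewrite mulr_natl (mulr_natl _ 2) (periodicn (@sinD2pi R)).
case: z => k; first exact: H.
rewrite -[LHS](H k.+1) NegzE rmorphN /= mulNr; congr sin; rewrite -pmulrn.
by rewrite subrK.
Qed.

Section Primitive.
Variables a b : R.

(** [I] is the integral of [g] from [a] to [b], encoded by an antiderivative because the expansion
    consumes iterated integrals in that form. *)
Definition primitive (g : R -> R) (I : R) := exists G : R -> R,
  [/\ forall t : R, is_derive t 1 G (g t), G a = 0 & G b = I].

Lemma primitive_ext g h I J : g =1 h -> I = J -> primitive g I -> primitive h J.
Proof. by move=> /funext -> ->. Qed.

Lemma primitiveD g h I J : primitive g I -> primitive h J ->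
  primitive (fun t => g t + h t) (I + J).
Proof.
move=> [G [dG Ga Gb]] [H [dH Ha Hb]]; exists (G + H).
by split=> [t||]; rewrite ?fctE ?Ga ?Ha ?Gb ?Hb ?addr0 //; exact: is_deriveD.
Qed.

Lemma primitiveZ c g I : primitive g I -> primitive (fun t => c * g t) (c * I).
Proof.
move=> [G [dG Ga Gb]]; exists (c *: G).
split=> [t||]; first exact: is_deriveZ.
  by rewrite fctE Ga scaler0.
by rewrite fctE Gb.
Qed.

Lemma primitive0 : primitive (fun=> 0) 0.
Proof. by exists (cst 0); split=> // t; apply: is_derive_cst. Qed.

Lemma primitive_sum (I : Type) (r : seq I) (g : I -> R -> R) (J : I -> R) :
  (forall i, primitive (g i) (J i)) ->
  primitive (fun t => \sum_(i <- r) g i t) (\sum_(i <- r) J i).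
Proof.
move=> H; elim: r => [|i r IH].
  by apply: primitive_ext primitive0 => [t|]; rewrite big_nil.
by apply: primitive_ext (primitiveD (H i) IH) => [t|]; rewrite big_cons.
Qed.

Lemma primitive1 : primitive (fun=> 1) (b - a).
Proof.
exists (@idfun R - cst a); split=> [t||]; rewrite ?fctE ?subrr //.
have : is_derive t 1 (@idfun R - cst a) (1 - 0) by apply: is_deriveB.
by rewrite subr0.
Qed.

End Primitive.

Variables (a eps : R) (eps0 : 0 < eps).
Let b := a + eps.

Definition freq (z : int) : R := 2 * pi * z%:~R / eps.

Lemma freqD z z' : freq (z + z') = freq z + freq z'.
Proof. by rewrite /freq rmorphD /= mulrDr mulrDl. Qed.

Lemma freqN z : freq (- z) = - freq z.
Proof. by rewrite /freq rmorphN /= mulrN mulNr. Qed.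

Lemma freq0 z : z != 0 -> freq z != 0.
Proof.
move=> z0; rewrite /freq !mulf_neq0 ?invr_eq0 ?intr_eq0 // gt_eqF ?pi_gt0 //.
Qed.

Lemma freq_period z : freq z * b = freq z * a + z%:~R * (2 * pi).
Proof.
rewrite /b mulrDr; congr (_ + _); rewrite /freq divfK ?gt_eqF //.
by rewrite mulrC.
Qed.

Lemma is_derive_scaled (F f : R -> R) (w t : R) : is_derive (w * t) 1 F (f (w * t)) ->
  is_derive t 1 (fun t => F (w * t)) (w * f (w * t)).
Proof.
move=> dF; have dw : is_derive t 1 (w *: @idfun R) (w *: 1) by apply: is_deriveZ.
have := @is_derive1_comp _ F (w *: @idfun R) t (f (w * t)) (w *: 1) dF dw.
by rewrite -[w *: 1]/(w * 1) mulr1 mulrC.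
Qed.

(** The antiderivative takes the same value at both ends of the period, whence the integral 0. *)
Lemma primitive_scaled (F f : R -> R) w : w != 0 ->
  (forall t : R, is_derive t 1 F (f t)) -> F (w * b) = F (w * a) ->
  primitive a b (fun t => f (w * t)) 0.
Proof.
move=> w0 dF per; exists (w^-1 *: ((fun t => F (w * t)) - cst (F (w * a)))).
split=> [t||]; rewrite ?fctE ?per ?subrr ?scaler0 //.
have D := is_deriveZ w^-1 (is_deriveB (is_derive_scaled (dF (w * t)))
  (is_derive_cst (F (w * a)) t 1)).
by apply: (is_derive_eq D); rewrite subr0 -[_ *: _]/(_ * _) mulrA mulVf ?mul1r.
Qed.

(** Frequency 0 is the only mode with a nonzero mean; products of modes are reduced to this case by
    the product-to-sum formulas. *)
Lemma primitive_cos z : primitive a b (fun t => cos (freq z * t)) ((z == 0)%:R * eps).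
Proof.
have [->|z0] := eqVneq z 0.
  apply: primitive_ext (primitive1 a b) => [t|].
    by rewrite /freq mulr0 mul0r mul0r cos0.
  by rewrite mul1r /b addrC addKr.
rewrite mul0r; apply: (primitive_scaled (freq0 z0) (@is_derive_sin R)).
by rewrite freq_period sinDint.
Qed.

Lemma primitive_sin z : primitive a b (fun t => sin (freq z * t)) 0.
Proof.
have [->|z0] := eqVneq z 0.
  apply: primitive_ext (primitive0 a b) => [t|] //.
  by rewrite /freq mulr0 mul0r mul0r sin0.
have dc (t : R) : is_derive t 1 (- cos) (sin t).
  by have := is_deriveN (is_derive_cos t); rewrite opprK.
apply: (primitive_scaled (freq0 z0) dc).
by rewrite !fctE freq_period cosDint.
Qed.

Lemma primitive_cos_cos z z' : 0 < z -> 0 < z' ->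
  primitive a b (fun t => cos (freq z * t) * cos (freq z' * t))
    ((z == z')%:R * (eps / 2)).
Proof.
move=> z0 z'0.
apply: primitive_ext (primitiveZ 2^-1 (primitiveD (primitive_cos (z - z'))
  (primitive_cos (z + z')))) => [t|].
  by rewrite !(freqD, freqN) mulrBl mulrDl !(cosD, cosN, sinN); field.
(* Both frequencies are positive, so their sum cannot vanish and only the difference can
   resonate. *)
by rewrite subr_eq0 [z + z' == 0]gt_eqF ?addr_gt0 // mul0r addr0; field.
Qed.

Lemma primitive_sin_sin z z' : 0 < z -> 0 < z' ->
  primitive a b (fun t => sin (freq z * t) * sin (freq z' * t))
    ((z == z')%:R * (eps / 2)).
Proof.
move=> z0 z'0.
apply: primitive_ext (primitiveZ 2^-1 (primitiveD (primitive_cos (z - z'))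
  (primitiveZ (-1) (primitive_cos (z + z'))))) => [t|].
  by rewrite !(freqD, freqN) mulrBl mulrDl !(cosD, cosN, sinN); field.
by rewrite subr_eq0 [z + z' == 0]gt_eqF ?addr_gt0 // mul0r mulr0 addr0; field.
Qed.

Lemma primitive_sin_cos z z' :
  primitive a b (fun t => sin (freq z * t) * cos (freq z' * t)) 0.
Proof.
apply: primitive_ext (primitiveZ 2^-1 (primitiveD (primitive_sin (z + z'))
  (primitive_sin (z - z')))) => [t|].
  by rewrite !(freqD, freqN) mulrBl mulrDl !(sinD, cosN, sinN); field.
by rewrite addr0 mulr0.
Qed.

(* Only the modes of equal frequency contribute over a period, whatever the
   phase at [a]. *)
Lemma primitive_mode_product z z' A B C D s c : 0 < z -> 0 < z' ->
  primitive a b (fun t => (A * cos (freq z * t) + B * sin (freq z * t)) *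
    (C * (sin (freq z' * t) - s) - D * (cos (freq z' * t) - c)))
    ((z == z')%:R * (eps / 2) * (B * C - A * D)).
Proof.
move=> z0 z'0; have cz : (z == 0) = false by rewrite gt_eqF.
have pc : primitive a b (fun t => cos (freq z * t)) 0.
  by have := primitive_cos z; rewrite cz mul0r.
apply: primitive_ext (primitiveD (primitiveD
  (primitiveD (primitiveZ (A * C) (primitive_sin_cos z' z))
              (primitiveZ (B * C) (primitive_sin_sin z0 z'0)))
  (primitiveD (primitiveZ (- (A * D)) (primitive_cos_cos z0 z'0))
              (primitiveZ (- (B * D)) (primitive_sin_cos z z'))))
  (primitiveD (primitiveZ (A * (D * c - C * s)) pc)
              (primitiveZ (B * (D * c - C * s)) (primitive_sin z)))) => [t|];
  ring.
Qed.

End TrigonometricPrimitives.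

(** * Iterated integrals of the controls over one period *)

Section ControlModes.
Variables (R : realType) (n m : nat) (S1 : {set 'I_m}) (S2 : {set 'I_m * 'I_m}).
Variables (hn : (#|S1| + #|S2|)%N = n) (kappa : 'I_m * 'I_m -> nat).
Hypothesis hkappa_pos : forall p, p \in S2 -> (0 < kappa p)%N.
Hypothesis hkappa_inj : {in S2 &, injective kappa}.

Definition drift (av : 'cV[R]_n) (k : 'I_m) : R :=
  \sum_(i < #|S1|) av (cast_ord hn (lshift #|S2| i)) ord0 * (k == enum_val i)%:R.

Definition second (av : 'cV[R]_n) (q : 'I_#|S2|) : R :=
  av (cast_ord hn (rshift #|S1| q)) ord0.

(** The amplitude of [phi] is doubled because its cosine and its sine are bounded separately. *)
Definition osc_gain : R := \sum_(q < #|S2|) 4 * Num.sqrt (pi * (kappa (enum_val q))%:R).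

Lemma osc_gain_ge0 : 0 <= osc_gain.
Proof. by apply: sumr_ge0 => q _; rewrite mulr_ge0 // sqrtr_ge0. Qed.

(** The coefficient of [lie (f l) (f k)] in the sum of the brackets weighted by [second av]; up to
    the factor [eps], it is the signed area swept by the modes of the controls [l] and [k] in one
    period. *)
Definition area (av : 'cV[R]_n) (k l : 'I_m) : R :=
  \sum_(q < #|S2|) second av q *
    ((k == (enum_val q).2)%:R * (l == (enum_val q).1)%:R -
     (k == (enum_val q).1)%:R * (l == (enum_val q).2)%:R).

Lemma drift_le (av : 'cV[R]_n) A k : (forall i, `|av i ord0| <= A) ->
  `|drift av k| <= n%:R * A.
Proof.
move=> avA; apply: le_trans (ler_norm_sum _ _ _) _.
(* For [n = 0] nothing fixes the sign of [A]; both sides are then 0. *)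
have A0 : (0 < n)%N -> 0 <= A.
  by case: (n) av avA => // n' av avA _; apply: le_trans (avA ord0).
apply: (@le_trans _ _ (\sum_(i < #|S1|) A)).
  apply: ler_sum => i _; rewrite normrM; apply: le_trans (avA (cast_ord hn (lshift #|S2| i))).
  by rewrite ler_piMr // normr_nat; case: eqP.
rewrite sumr_const card_ord -[leLHS]mulr_natl.
have [S10|S10] := posnP n; last by rewrite ler_wpM2r ?A0 // ler_nat -hn leq_addr.
have -> : #|S1| = 0%N by move: hn; rewrite S10 => /eqP; rewrite addn_eq0 => /andP[/eqP].
by rewrite S10 !mul0r.
Qed.

(** Over a period the first integrals vanish and the second iterated ones produce [area], which is
    how oscillations generate the brackets. The normalisation of [phi] makes the factor exactly
    [eps]. *)
Lemma control_modes (eps a A : R) (av : 'cV[R]_n) : 0 < eps ->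
  (forall i, `|av i ord0| <= A) ->
  exists (o V : 'I_m -> R -> R) (Z : 'I_m -> 'I_m -> R -> R),
  [/\ forall k t, control hn kappa eps k av t = drift av k + o k t,
      (forall (k : 'I_m) (t : R), is_derive t 1 (V k) (o k t)) /\
      (forall (k l : 'I_m) (t : R), is_derive t 1 (Z k l) (o k t * V l t)),
      (forall k, V k a = 0) /\ (forall k l, Z k l a = 0),
      forall k t, `|o k t| <= osc_gain * Num.sqrt A / Num.sqrt eps
    & (forall k, V k (a + eps) = 0) /\
      (forall k l, Z k l (a + eps) = eps * area av k l)].
Proof.
move=> eps0 avA.
pose z (q : 'I_#|S2|) : int := kappa (enum_val q).
have z0 q : 0 < z q by rewrite /z; have := hkappa_pos (enum_valP q).
(* [g] is the common amplitude of mode [q]; [p] and [r] are its cosine and sine coefficients in the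
   control [k]. *)
pose g q := (Num.sqrt eps)^-1 * (Num.sqrt `|second av q| *
  (2 * Num.sqrt (pi * (kappa (enum_val q))%:R))).
pose p k q := g q * ((k == (enum_val q).1)%:R * Num.sg (second av q)).
pose r k q := g q * (k == (enum_val q).2)%:R.
pose w q := freq eps (z q).
have w0 q : w q != 0 by apply: freq0 => //; rewrite gt_eqF.
pose o (k : 'I_m) t := \sum_q (p k q * cos (w q * t) + r k q * sin (w q * t)).
pose V k t := \sum_q (p k q / w q * (sin (w q * t) - sin (w q * a)) -
                      r k q / w q * (cos (w q * t) - cos (w q * a))).
have PZ k l : primitive a (a + eps) (fun t => o k t * V l t) (eps * area av k l).
  apply: primitive_ext (primitive_sum (index_enum _) (fun q =>
    primitive_sum (index_enum _) (fun q' => primitive_mode_product a eps0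
      (p k q) (r k q) (p l q' / w q') (r l q' / w q')
      (sin (w q' * a)) (cos (w q' * a)) (z0 q) (z0 q')))) => [t|].
    rewrite /o /V mulr_suml; apply: eq_bigr => q _; rewrite mulr_sumr.
    by apply: eq_bigr => q' _.
  rewrite /area mulr_sumr; apply: eq_bigr => q _.
  rewrite (bigD1 q) //= eqxx big1 ?addr0 => [|q' q'q]; last first.
    (* Distinct pairs have distinct [kappa], so only the diagonal terms survive. *)
    rewrite (_ : (z q == z q') = false) ?mul0r //; apply/negbTE.
    rewrite /z; apply: contra q'q => /eqP[] /(hkappa_inj (enum_valP _) (enum_valP _)).
    by move=> /enum_val_inj ->.
  rewrite /p /r mul1r.
  (* The squared amplitude 4 pi kappa |a| / eps, times the integral eps / 2 of a squared mode,
     divided by the frequency 2 pi kappa / eps. *)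
  have gw : g q * g q * (eps / 2 / w q) = `|second av q| * eps.
    rewrite /g /w /freq -[(z q)%:~R]/((kappa (enum_val q))%:R).
    have k0 : 0 < (kappa (enum_val q))%:R :> R by rewrite ltr0n hkappa_pos ?enum_valP.
    move: (pi : R) (pi_gt0 R) (kappa _)%:R k0 => P P0 K K0.
    have pk0 : 0 < P * K by rewrite mulr_gt0.
    have E1 := sqr_sqrtr (ltW eps0).
    have E2 := sqr_sqrtr (normr_ge0 (second av q)).
    have E3 := sqr_sqrtr (ltW pk0).
    have E4 : Num.sqrt eps != 0 by rewrite gt_eqF // sqrtr_gt0.
    transitivity ((Num.sqrt eps ^+ 2)^-1 * (Num.sqrt `|second av q| ^+ 2 *
      (4 * Num.sqrt (P * K) ^+ 2)) * (eps / 2 / (2 * (P * K) / eps))).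
      by field; rewrite E4 !gt_eqF.
    by rewrite E1 E2 E3; field; rewrite !gt_eqF.
  rewrite [second av q in RHS]numEsg mulrCA [Num.sg _ * `|_|]mulrC.
  have <- : g q * g q * (eps / 2 / w q) / eps = `|second av q|.
    by rewrite gw mulfK // gt_eqF.
  by field; rewrite w0 gt_eqF.
have [Z ZP] := choice (fun kl : 'I_m * 'I_m => PZ kl.1 kl.2).
exists o, V, (fun k l => Z (k, l)); split.
- move=> k t; rewrite /control /drift; congr (_ + _).
  rewrite /o mulr_sumr; apply: eq_bigr => q _.
  rewrite /phi /p /r /w /freq -/(second av q).
  have -> : 2 * pi * (z q)%:~R / eps * t = 2 * pi * (kappa (enum_val q))%:R * t / eps.
    by rewrite mulrAC.
  rewrite /g; ring.
- split=> [k t|k l t]; last by have [] := ZP (k, l).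
  have -> : V k = \sum_q (fun t => p k q / w q * (sin (w q * t) - sin (w q * a)) -
                      r k q / w q * (cos (w q * t) - cos (w q * a))).
    by apply/funext => s; rewrite fct_sumE.
  have -> : o k t = \sum_q (p k q * cos (w q * t) + r k q * sin (w q * t)) by [].
  apply: is_derive_sum => q.
  have D1 := is_deriveZ (p k q / w q) (is_deriveB
    (is_derive_scaled (is_derive_sin (w q * t))) (is_derive_cst (sin (w q * a)) t 1)).
  have D2 := is_deriveZ (r k q / w q) (is_deriveB
    (is_derive_scaled (f := fun x => - sin x) (is_derive_cos (w q * t)))
    (is_derive_cst (cos (w q * a)) t 1)).
  apply: (is_derive_eq (is_deriveB D1 D2)).
  by rewrite !subr0 /GRing.scale /=; field.
- split=> [k|k l]; last by have [] := ZP (k, l).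
  by rewrite /V big1 // => q _; rewrite !subrr !mulr0 subrr.
- move=> k t; apply: le_trans (ler_norm_sum _ _ _) _.
  rewrite /osc_gain !mulr_suml; apply: ler_sum => q _.
  have g0 : 0 <= g q by rewrite !mulr_ge0 ?invr_ge0 ?sqrtr_ge0.
  have gA : 2 * g q <= 4 * Num.sqrt (pi * (kappa (enum_val q))%:R) * Num.sqrt A / Num.sqrt eps.
    have := ler_wsqrtr (avA (cast_ord hn (rshift #|S1| q))).
    rewrite -/(second av q) => sA.
    rewrite /g mulrC mulrA mulrAC -(mulrC (Num.sqrt eps)^-1) -!mulrA.
    apply: ler_wpM2l; first by rewrite invr_ge0 sqrtr_ge0.
    rewrite mulrCA; set K := Num.sqrt (pi * _).
    have K0 : 0 <= K by apply: sqrtr_ge0.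
    move: sA; set x := Num.sqrt _; set y := Num.sqrt A => xy.
    have := ler_wpM2r K0 xy; lra.
  apply: le_trans gA; rewrite mulrDl mul1r; apply: le_trans (ler_normD _ _) _.
  rewrite /p /r; move: (g q) g0 => gq g0; rewrite !normrM (ger0_norm g0); apply: lerD.
    rewrite -mulrA ler_piMr //.
    rewrite mulr_ile1 ?mulr_ge0 ?cos_max // mulr_ile1 ?normr_nat //.
      by case: eqP.
    by rewrite normr_sg; case: eqP.
  rewrite -mulrA ler_piMr // mulr_ile1 ?sin_max // normr_nat.
  by case: eqP.
- split=> [k|k l]; last by have [] := ZP (k, l).
  rewrite /V big1 // => q _.
  by rewrite /w freq_period // sinDint cosDint !subrr !mulr0 subrr.
Qed.

End ControlModes.

(** * The frame matrix and the mean motion *)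

Section Frame.
Variables (R : realType) (n m : nat) (f : 'I_m -> 'cV[R]_n -> R -> 'cV[R]_n).
Variables (S1 : {set 'I_m}) (S2 : {set 'I_m * 'I_m}) (hn : (#|S1| + #|S2|)%N = n).

Lemma col_frame_lshift x t i :
  col (cast_ord hn (lshift #|S2| i)) (frame_mx f hn x t) = f (enum_val i) x t.
Proof.
apply/colP => r; rewrite !mxE cast_ordK /frame_col.
by rewrite (unsplitK (inl i : 'I_#|S1| + 'I_#|S2|)).
Qed.

Lemma col_frame_rshift x t (q : 'I_#|S2|) :
  col (cast_ord hn (rshift #|S1| q)) (frame_mx f hn x t) =
  bracket (f (enum_val q).1) (f (enum_val q).2) x t.
Proof.
apply/colP => r; rewrite [LHS]mxE [LHS]mxE cast_ordK /frame_col.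
by rewrite (unsplitK (inr q : 'I_#|S1| + 'I_#|S2|)).
Qed.

Lemma frame_unit x t :
  <<[seq f i x t | i <- enum S1] ++
    [seq bracket (f p.1) (f p.2) x t | p <- enum S2]>>%VS = fullv ->
  frame_mx f hn x t \in unitmx.
Proof.
set F := frame_mx f hn x t => spanF.
have imF : (fullv <= limg (linfun (mulmx F : 'cV[R]_n -> 'cV[R]_n)))%VS.
  rewrite -[X in (X <= _)%VS]spanF; apply/span_subvP => u.
  have incol j : col j F \in limg (linfun (mulmx F : 'cV[R]_n -> 'cV[R]_n)).
    by rewrite colE -(lfunE (mulmx F) (delta_mx j 0)) memv_img ?memvf.
  rewrite mem_cat => /orP[] /mapP[i]; rewrite mem_enum => iS ->.
    by rewrite -(enum_rankK_in iS iS) -col_frame_lshift; apply: incol.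
  by rewrite -(enum_rankK_in iS iS) -col_frame_rshift; apply: incol.
(* The columns span, so every basis vector has a preimage; these preimages are the columns of a
   right inverse. *)
have ex j : exists c : 'cV[R]_n, delta_mx j ord0 = F *m c.
  have /memv_imgP[c _ ->] := subvP imF (delta_mx j ord0) (memvf _).
  by exists c; rewrite lfunE.
have [c cP] := choice ex.
suff : F *m \matrix_(i, j) c j i ord0 = 1%:M by case/mulmx1_unit.
apply/matrixP => i j; rewrite !mxE.
have /colP/(_ i) := cP j; rewrite !mxE eqxx andbT => ->.
by apply: eq_bigr => k _; rewrite !mxE.
Qed.

(** With [control_modes], the mean motion over a period is [eps] times the frame applied to [av]:
    the drift supplies the columns of [S1], the areas those of [S2]. *)
Lemma frame_mulmx x t (av : 'cV[R]_n) :
  \sum_k drift hn av k *: f k x t +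
  \sum_k \sum_l area hn av k l *: lie (f l) (f k) x t = frame_mx f hn x t *m av.
Proof.
have -> : frame_mx f hn x t *m av =
    \sum_j av j ord0 *: col j (frame_mx f hn x t).
  apply/colP => r; rewrite mxE summxE; apply: eq_bigr => j _.
  by rewrite [RHS]mxE [col _ _ _ _]mxE mulrC.
rewrite (reindex (cast_ord hn)) /=; last first.
  by exists (cast_ord (esym hn)) => j _; rewrite ?cast_ordK ?cast_ordKV.
rewrite big_split_ord /=; congr (_ + _).
  rewrite /drift; under eq_bigr do rewrite scaler_suml.
  rewrite exchange_big; apply: eq_bigr => i _ /=.
  rewrite (bigD1 (enum_val i)) //= eqxx mulr1 big1 ?addr0 ?col_frame_lshift //.
  by move=> k /negbTE ->; rewrite mulr0 scale0r.
rewrite /area; under eq_bigr do under eq_bigr do rewrite scaler_suml.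
under eq_bigr do rewrite exchange_big.
rewrite exchange_big; apply: eq_bigr => q _ /=; rewrite col_frame_rshift.
under eq_bigr do under eq_bigr do rewrite -scalerA.
under eq_bigr do rewrite -scaler_sumr.
rewrite -scaler_sumr -/(second hn av q); congr (_ *: _).
under eq_bigr do under eq_bigr do rewrite scalerBl.
under eq_bigr do rewrite sumrB.
rewrite sumrB /bracket; congr (_ - _).
  rewrite (bigD1 (enum_val q).2) //= [X in _ + X]big1 ?addr0; last first.
    by move=> k /negbTE ->; rewrite big1 // => l _; rewrite mul0r scale0r.
  rewrite (bigD1 (enum_val q).1) //= !eqxx mulr1 scale1r big1 ?addr0 //.
  by move=> k /negbTE ->; rewrite mulr0 scale0r.
rewrite (bigD1 (enum_val q).1) //= [X in _ + X]big1 ?addr0; last first.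
  by move=> k /negbTE ->; rewrite big1 // => l _; rewrite mul0r scale0r.
rewrite (bigD1 (enum_val q).2) //= !eqxx mulr1 scale1r big1 ?addr0 //.
by move=> k /negbTE ->; rewrite mulr0 scale0r.
Qed.

End Frame.

(** * First-order Taylor estimate along a segment *)

Section Segment.
Variables (R : realType) (n : nat) (Q : 'cV[R]_n -> R).

Let gradQ y : 'cV[R]_n := \col_i 'D_(unitvec R i) Q y.

Lemma derive_dot y w : differentiable Q y -> 'D_w Q y = dot (gradQ y) w.
Proof.
move=> dQ; rewrite deriveE //.
have {1}-> : w = \sum_i w i ord0 *: unitvec R i.
  apply/colP => i; rewrite summxE (bigD1 i) //= !mxE !eqxx mulr1 big1 ?addr0 //.
  by move=> j ji; rewrite !mxE eq_sym (negbTE ji) mulr0.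
rewrite linear_sum /dot; apply: eq_bigr => i _.
by rewrite linearZ /= mxE deriveE // mulrC.
Qed.

Lemma convex_set_segment (L : set 'cV[R]_n) y z (s : R) : convex_set L ->
  L y -> L z -> 0 <= s <= 1 -> L (y + s *: (z - y)).
Proof.
move=> cL Ly Lz /andP[s0 s1].
have p0 : 0 <= s <= 1 by rewrite s0.
have := cL z y (Itv01 s0 s1); rewrite !inE => /(_ Lz Ly).
rewrite /conv /= /unstable.onem scalerBl scale1r.
by rewrite addrCA -scalerBr.
Qed.

Lemma is_derive_segment y w (s : R) : differentiable Q (y + s *: w) ->
  is_derive s 1 (fun s : R => Q (y + s *: w)) ('D_w Q (y + s *: w)).
Proof.
move=> dQ; have E : (fun h : R => h^-1 *:
      (((fun s : R => Q (y + s *: w)) \o shift s) (h *: 1) -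
       Q (y + s *: w))) =
    (fun h : R => h^-1 *: ((Q \o shift (y + s *: w)) (h *: w) - Q (y + s *: w))).
  apply/funext => h /=; congr (_ *: (Q _ - _)).
  by rewrite -[h *: 1]/(h * 1) mulr1 scalerDl addrCA.
split; last by rewrite /derive E.
by rewrite /derivable E; apply: diff_derivable.
Qed.

(** The mean value theorem gives the gradient at an intermediate point; replacing it by the one at
    [y] costs [G], by Cauchy-Schwarz. *)
Lemma segment_increment y z G :
  (forall s : R, 0 <= s <= 1 -> differentiable Q (y + s *: (z - y))) ->
  (forall s : R, 0 <= s <= 1 -> enorm (gradQ (y + s *: (z - y)) - gradQ y) <= G) ->
  Q z - Q y <= dot (gradQ y) (z - y) + G * enorm (z - y).
Proof.
move=> dQ gG; pose phi (s : R) := Q (y + s *: (z - y)).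
have dphi (s : R) : 0 <= s <= 1 -> is_derive s 1 phi ('D_(z - y) Q (y + s *: (z - y))).
  by move=> s01; apply/is_derive_segment/dQ.
have cphi : {within `[0, 1], continuous phi}.
  apply: derivable_within_continuous => s; rewrite in_itv /= => s01.
  by have [] := dphi s s01.
have dphi' (s : R) : s \in `]0, 1[%R -> is_derive s 1 phi ('D_(z - y) Q (y + s *: (z - y))).
  by rewrite in_itv /= => /andP[/ltW s0 /ltW s1]; apply: dphi; rewrite s0.
have [s] := MVT (ltr01 : 0 < 1 :> R) dphi' cphi.
rewrite in_itv /= => /andP[/ltW s0 /ltW s1].
have s01 : 0 <= s <= 1 by rewrite s0.
rewrite /phi scale1r scale0r addr0 subr0 mulr1 [y + (z - y)]addrC subrK => ->.
rewrite derive_dot; last exact: dQ.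
rewrite -[gradQ (y + _)](subrK (gradQ y)) dotDl addrC lerD2l.
apply: le_trans (dot_le _ _) _; apply: ler_wpM2r; first exact: enorm_ge0.
exact: gG.
Qed.

End Segment.

(** * Existence of solutions *)

Section WithinDerivative.
Variables (R : realType) (n : nat).
Implicit Types (g : R -> 'cV[R]_n) (A : set R).

Lemma wderivD A g g' t l l' : wderiv A g t l -> wderiv A g' t l' ->
  wderiv A (fun t => g t + g' t) t (l + l').
Proof.
move=> p1 p2 eta eta0.
have [d1 d10 p1d] := p1 (eta / 2) (ltac:(lra)).
have [d2 d20 p2d] := p2 (eta / 2) (ltac:(lra)).
exists (Num.min d1 d2); first by rewrite lt_min d10.
move=> s As; rewrite lt_min => /andP[s1 s2].
have := p1d s As s1; have := p2d s As s2.
have := ler_enormD (g s - g t - (s - t) *: l) (g' s - g' t - (s - t) *: l').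
have -> : g s - g t - (s - t) *: l + (g' s - g' t - (s - t) *: l') =
  g s + g' s - (g t + g' t) - (s - t) *: (l + l').
  by rewrite scalerDr [in LHS]addrACA (addrACA (g s)) -!opprD.
by lra.
Qed.

Lemma wderiv_cst A (c : 'cV[R]_n) t : wderiv A (fun=> c) t 0.
Proof.
by move=> eta eta0; exists 1 => // s _ _;
  rewrite subrr scaler0 subr0 enorm0 mulr_ge0 // ltW.
Qed.

Lemma wderiv_sum A (I : Type) (r : seq I) (g : I -> R -> 'cV[R]_n)
    (l : I -> 'cV[R]_n) t :
  (forall i, wderiv A (g i) t (l i)) ->
  wderiv A (fun t => \sum_(i <- r) g i t) t (\sum_(i <- r) l i).
Proof.
move=> p; elim: r => [|i r IH].
  have -> : (fun t => \sum_(i <- [::]) g i t) = fun=> 0.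
    by apply/funext => s; rewrite big_nil.
  by rewrite big_nil; apply: wderiv_cst.
have -> : (fun t => \sum_(j <- i :: r) g j t) =
          fun t => g i t + \sum_(j <- r) g j t.
  by apply/funext => s; rewrite big_cons.
by rewrite big_cons; apply: wderivD.
Qed.

Lemma wderiv_scale A (w : R -> R) (c : 'cV[R]_n) (t l : R) :
  is_derive t 1 w l -> wderiv A (fun t => w t *: c) t (l *: c).
Proof.
move=> Hw eta eta0.
have c0 : 0 < enorm c + 1 by rewrite ltr_wpDl ?enorm_ge0.
have [d d0 dP] := is_derive_increment Hw (divr_gt0 eta0 c0).
exists d => // s _ std; rewrite scalerA -!scalerBl enormZ.
apply: le_trans (ler_wpM2r (enorm_ge0 c) (dP s std)) _.
rewrite mulrAC ler_wpM2r // mulrAC ler_pdivrMr // ler_pM2l //.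
by rewrite lerDl.
Qed.

Lemma wderiv_local A B g t l d : 0 < d ->
  (forall s, B s -> `|s - t| < d -> A s) -> wderiv A g t l -> wderiv B g t l.
Proof.
move=> d0 BA H eta eta0; have [d' d'0 dP] := H eta eta0.
exists (Num.min d d'); first by rewrite lt_min d0.
by move=> s Bs; rewrite lt_min => /andP[sd sd']; apply: dP => //; apply: BA.
Qed.

Lemma wderiv_right a b g t l : a <= t < b -> wderiv `[a, b] g t l -> approx g t l 0.
Proof.
move=> tab H; apply: (@wderiv_approx _ _ a b _ _ _ tab); apply: wderiv_sub H.
by move=> s /=; rewrite !in_itv /= => /andP[-> /ltW].
Qed.

Lemma continuous_antiderivative (g : R -> R) (a b : R) : a <= b -> continuous g ->
  exists G : R -> R, forall t, a <= t <= b -> is_derive t 1 G (g t).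
Proof.
move=> ab cg.
(* Integration starts at [a - 1], so that [a] is interior and the derivative there is two-sided. *)
pose G x := (\int[lebesgue_measure]_(t in `[a - 1, x]) g t)%R.
exists G => t /andP[at_ tb].
have tb1 : t < b + 1 by rewrite ltr_pwDr.
have at1 : a - 1 < t by rewrite ltrBlDr ltr_pwDr.
have ig : lebesgue_measure.-integrable `[a - 1, b + 1] (EFin \o g).
  apply: continuous_compact_integrable; first exact: segment_compact.
  exact: continuous_subspaceT.
have [dG GE] := continuous_FTC1_closed tb1 ig at1 (cg t).
by split; [exact: dG|rewrite -derive1E].
Qed.

Lemma vector_antiderivative g (a b : R) (y : 'cV[R]_n) : a <= b -> ccont a b g ->
  exists Z : R -> 'cV[R]_n, Z a = y /\
    forall t, a <= t <= b -> wderiv `[a, b] Z t (g t).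
Proof.
move=> ab cg.
(* Composition with the projection onto [a, b] extends [g] continuously to the whole line. *)
pose clamp t := Num.max a (Num.min t b).
have clampE t : a <= t <= b -> clamp t = t.
  by move=> /andP[at_ tb]; rewrite /clamp min_l // max_r.
have clamp_in t : a <= clamp t <= b by rewrite /clamp le_max lexx ge_max ab ge_min lexx orbT.
have clampL s t : `|clamp s - clamp t| <= `|s - t|.
  wlog st : s t / t <= s => [W|].
    case: (leP t s) => [|/ltW] H; first exact: W.
    by rewrite distrC (distrC s); apply: W.
  have : clamp t <= clamp s.
    by rewrite /clamp; apply: le_max2 => //; apply: le_min2.
  move=> H; rewrite !ger0_norm ?subr_ge0 //.
  have ct : Num.min t b <= clamp t by rewrite /clamp le_max lexx orbT.
  have /andP[ca _] := clamp_in t.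
  rewrite lerBlDr {1}/clamp ge_max; apply/andP; split; first by rewrite ler_wpDl ?subr_ge0.
  have [tb|/ltW bt] := leP t b; last first.
    rewrite ge_min; apply/orP; right; rewrite (min_r bt) in ct.
    by rewrite ler_wpDl ?subr_ge0.
  rewrite (min_l tb) in ct; rewrite ge_min; apply/orP; left.
  by rewrite -lerBlDl opprB addrCA subrr addr0.
have cgi i : continuous (fun t => g (clamp t) i ord0 : R).
  move=> t; apply/cvgrPdist_le => eta eta0.
  have [d d0 dP] := cg _ (clamp_in t) eta eta0.
  apply/nbhs_ballP; exists d => //= s; rewrite /ball /= distrC => std.
  have := dP _ (clamp_in s) (le_lt_trans (clampL s t) std).
  apply: le_trans; rewrite distrC.
  by have := coord_le_enorm (g (clamp s) - g (clamp t)) i; rewrite !mxE.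
have [G GP] := choice (fun i => continuous_antiderivative ab (cgi i)).
exists (fun t => y + \sum_i (G i t - G i a) *: delta_mx i ord0); split.
  by rewrite big1 ?addr0 // => i _; rewrite subrr scale0r.
move=> t tab; rewrite -[g t]add0r; apply: wderivD; first exact: wderiv_cst.
have -> : g t = \sum_i g t i ord0 *: delta_mx i ord0.
  apply/colP => i; rewrite summxE (bigD1 i) //= !mxE !eqxx mulr1 big1 ?addr0 //.
  by move=> j ji; rewrite !mxE eq_sym (negbTE ji) mulr0.
apply: wderiv_sum => i; apply: wderiv_scale.
have := is_deriveB (GP i t tab) (is_derive_cst (G i a) t 1).
by rewrite subr0 clampE.
Qed.

End WithinDerivative.

(** * Picard iteration *)

Section Picard.

(** The intervals of radius [2 * C / 2 ^+ k] around [u k] are nested; the supremum of their left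
    ends lies in all of them, which gives an explicit error at every rank. *)
Lemma geometric_limit (R : realType) (u : nat -> R) (C : R) :
  (forall k, `|u k.+1 - u k| <= C / 2 ^+ k) ->
  exists l, forall k, `|l - u k| <= 2 * C / 2 ^+ k.
Proof.
move=> H.
pose a k := u k - 2 * C / 2 ^+ k; pose b k := u k + 2 * C / 2 ^+ k.
have half k : 2 * C / 2 ^+ k.+1 = C / 2 ^+ k.
  by rewrite exprS; field; rewrite expf_neq0.
have two k : 2 * C / 2 ^+ k = C / 2 ^+ k + C / 2 ^+ k by rewrite -mulrA mulr2n mulrDl !mul1r.
have C0 k : 0 <= C / 2 ^+ k by apply: le_trans (H k).
have amono k j : a k <= a (k + j)%N.
  elim: j => [|j IH]; first by rewrite addn0.
  apply: le_trans IH _; rewrite addnS /a half two.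
  by have := H (k + j)%N; rewrite ler_norml => /andP[]; lra.
have bmono k j : b (k + j)%N <= b k.
  elim: j => [|j IH]; first by rewrite addn0.
  apply: le_trans _ IH; rewrite addnS /b half two.
  by have := H (k + j)%N; rewrite ler_norml => /andP[]; lra.
have ab k j : a k <= b j.
  apply: le_trans (amono k j) _; rewrite addnC; apply: le_trans _ (bmono j k).
  by rewrite /a /b two; have := C0 (j + k)%N; lra.
have supa : has_sup (range a).
  by split; [exists (a 0%N), 0%N|exists (b 0%N) => _ [k _ <-]].
exists (sup (range a)) => k.
have : a k <= sup (range a) by apply: ub_le_sup; [case: supa|exists k].
have : sup (range a) <= b k by apply: sup_le_ub; [case: supa|move=> _ [j _ <-]].
by rewrite ler_norml /a /b => ? ?; apply/andP; split; lra.
Qed.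

Lemma vector_geometric_limit (R : realType) (n : nat) (u : nat -> 'cV[R]_n) (C : R) :
  (forall k, enorm (u k.+1 - u k) <= C / 2 ^+ k) ->
  exists l, forall k, enorm (l - u k) <= n%:R * (2 * C) / 2 ^+ k.
Proof.
move=> H.
have C0 : 0 <= C by have := le_trans (enorm_ge0 _) (H 0%N); rewrite expr0 divr1.
have Hi i k : `|u k.+1 i ord0 - u k i ord0| <= C / 2 ^+ k.
  apply: le_trans (H k).
  by have := coord_le_enorm (u k.+1 - u k) i; rewrite !mxE.
have [l lP] := choice (fun i => geometric_limit (Hi i)).
exists (\col_i l i) => k; rewrite -mulrA; apply: enorm_le_coord => [|i].
  by rewrite divr_ge0 ?mulr_ge0 ?exprn_ge0.
by rewrite !mxE; apply: lP.
Qed.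

Lemma geometric_small (R : realType) (C eta : R) : 0 < eta ->
  exists k, C / 2 ^+ k <= eta.
Proof.
move=> eta0; exists (Num.bound (C / eta)).
rewrite ler_pdivrMr ?exprn_gt0 // mulrC -ler_pdivrMr //.
have [C0|C0] := leP 0 (C / eta).
  apply: le_trans (ltW (archi_boundP C0)) _.
  by rewrite -natrX ler_nat ltnW // ltn_expl.
by apply: le_trans (ltW C0) _; rewrite exprn_ge0.
Qed.

Variables (R : realType) (n : nat) (F : 'cV[R]_n -> R -> 'cV[R]_n) (y0 : 'cV[R]_n).
Variables (s e r M L : R).
Hypotheses (se : s <= e) (M0 : 0 <= M) (L0 : 0 <= L) (r0 : 0 <= r).
Hypothesis F_le : forall y t, enorm (y - y0) <= r -> s <= t <= e -> enorm (F y t) <= M.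
Hypothesis F_lip : forall y z t, enorm (y - y0) <= r -> enorm (z - y0) <= r ->
  s <= t <= e -> enorm (F y t - F z t) <= L * enorm (y - z).
Hypothesis F_cont : forall y, enorm (y - y0) <= r -> ccont s e (F y).
Hypotheses (short_M : M * (e - s) <= r) (short_L : L * (e - s) <= 1 / 2).

Let good (phi : R -> 'cV[R]_n) :=
  ccont s e phi /\ forall t, s <= t <= e -> enorm (phi t - y0) <= r.

Let ccont_F phi : good phi -> ccont s e (fun t => F (phi t) t).
Proof.
move=> [cphi bphi] t tse eta eta0.
have [d d0 dP] := F_cont (bphi t tse) tse (divr_gt0 eta0 (ltr0Sn R 1)).
have e1 : 0 < eta / (2 * (L + 1)) by rewrite divr_gt0 ?mulr_gt0 ?ltr_wpDl.
have [d' d'0 dP'] := cphi t tse _ e1.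
exists (Num.min d d'); first by rewrite lt_min d0.
move=> q qse; rewrite lt_min => /andP[/(dP q qse) H1 /(dP' q qse) H2].
apply: le_trans (ler_dist_enorm _ (F (phi t) q) _) _.
have H3 := F_lip (bphi q qse) (bphi t tse) qse.
have H4 : L * enorm (phi q - phi t) <= eta / 2.
  apply: le_trans (ler_wpM2l L0 H2) _.
  have -> : L * (eta / (2 * (L + 1))) = eta / 2 * (L / (L + 1)).
    by field; rewrite gt_eqF // ltr_wpDl.
  rewrite ler_piMr //; first by rewrite divr_ge0 // ltW.
  by rewrite ler_pdivrMr ?mul1r ?lerDl // ltr_wpDl.
by rewrite [leRHS](splitr eta); apply: lerD => //; apply: le_trans H4.
Qed.

Lemma picard : exists x : R -> 'cV[R]_n, x s = y0 /\
  forall t, s <= t <= e ->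
    enorm (x t - y0) <= r /\ wderiv `[s, e] x t (F (x t) t).
Proof.
(* The integral operator is constrained on [good] functions only, so that choice yields one total
   operator [T]. *)
have step (phi : R -> 'cV[R]_n) : exists Z : R -> 'cV[R]_n, good phi -> Z s = y0 /\
    forall t, s <= t <= e -> wderiv `[s, e] Z t (F (phi t) t).
  have [gphi|ngphi] := pselect (good phi); last by exists phi.
  have [Z HZ] := vector_antiderivative y0 se (ccont_F gphi).
  by exists Z.
have [T TP] := choice step.
have Tapprox phi t : good phi -> s <= t < e -> approx (T phi) t (F (phi t) t) 0.
  move=> gphi /[dup] tse /andP[st /ltW te]; have [_ H] := TP phi gphi.
  by apply: (wderiv_right tse); apply: H; rewrite st.
have Tgood phi : good phi -> good (T phi).
  move=> gphi; have [Ts TD] := TP phi gphi.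
  have cT : ccont s e (T phi) by apply: wderiv_ccont TD.
  split=> // t tse.
  have := @approx_mean_value _ _ (T phi) (fun t => F (phi t) t) 0 M s e cT
    (fun t => Tapprox phi t gphi) _ t tse.
  rewrite Ts; move=> /(_ _)/le_trans; apply.
    move=> q /andP[sq /ltW qe]; have qse : s <= q <= e by rewrite sq.
    by rewrite addr0; apply: F_le => //; apply gphi.2.
  apply: le_trans short_M; apply: ler_wpM2l => //.
  by rewrite lerD2r; case/andP: tse.
have contract phi psi d : good phi -> good psi -> 0 <= d ->
    (forall t, s <= t <= e -> enorm (phi t - psi t) <= d) ->
    forall t, s <= t <= e -> enorm (T phi t - T psi t) <= d / 2.
  move=> gphi gpsi d0 H t tse.
  have [Ts TD] := TP phi gphi; have [Us UD] := TP psi gpsi.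
  pose w t := T phi t + (-1) *: T psi t.
  have cw : ccont s e w.
    by apply: ccontD; [|apply: ccontZ]; [apply: wderiv_ccont TD|apply: wderiv_ccont UD].
  have aw q : s <= q < e -> approx w q (F (phi q) q + (-1) *: F (psi q) q) 0.
    move=> qse; have := approxD (Tapprox _ _ gphi qse) (approxZ (-1) (Tapprox _ _ gpsi qse)).
    by rewrite mulr0 addr0.
  have := @approx_mean_value _ _ w _ 0 (L * d) s e cw aw _ t tse.
  rewrite /w Ts Us !scaleN1r subrr subr0; move=> /(_ _)/le_trans; apply.
    move=> q /andP[sq /ltW qe]; have qse : s <= q <= e by rewrite sq.
    rewrite addr0 scaleN1r; apply: le_trans (F_lip (gphi.2 q qse) (gpsi.2 q qse) qse) _.
    by apply: ler_wpM2l => //; apply: H.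
  rewrite mulrAC mulrC; apply: ler_wpM2l => //; rewrite -div1r.
  apply: le_trans short_L; apply: ler_wpM2l => //.
  by rewrite lerD2r; case/andP: tse.
pose y := fix y k := if k is k'.+1 then T (y k') else (fun=> y0).
have ygood k : good (y k).
  elim: k => [|k IH]; last exact: Tgood.
  by split=> [|t _ /=]; [exact: ccont_cst|rewrite subrr enorm0].
have ydist k t : s <= t <= e -> enorm (y k.+1 t - y k t) <= 2 * r / 2 ^+ k.
  elim: k t => [|k IH] t tse.
    rewrite expr0 divr1 mulr_natl mulr2n; apply: le_trans (ler_dist_enorm _ y0 _) _.
    by rewrite (enormBC y0); apply: lerD; [exact: (ygood 1%N).2|exact: (ygood 0%N).2].
  have -> : 2 * r / 2 ^+ k.+1 = 2 * r / 2 ^+ k / 2.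
    by rewrite exprS; field; rewrite expf_neq0.
  apply: (contract _ _ _ (ygood k.+1) (ygood k)) => //.
  by rewrite divr_ge0 ?mulr_ge0 ?exprn_ge0.
pose C := n%:R * (2 * (2 * r)).
have C0 : 0 <= C by rewrite !mulr_ge0.
have lim t : exists l, s <= t <= e -> forall k, enorm (l - y k t) <= C / 2 ^+ k.
  have [tse|tse] := boolP (s <= t <= e); last by exists 0.
  by have [l lP] := vector_geometric_limit (fun k => ydist k t tse); exists l.
have [x xP] := choice lim.
have gx : good x.
  split=> [t tse eta eta0|t tse].
    have eta3 : 0 < eta / 3 by rewrite divr_gt0.
    have [k kP] := geometric_small C eta3.
    have [d d0 dP] := (ygood k).1 t tse _ eta3; exists d => // q qse qd.
    have H1 := le_trans (xP q qse k) kP; have H2 := le_trans (xP t tse k) kP.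
    have H3 := dP q qse qd; rewrite enormBC in H2.
    have H4 := ler_dist_enorm (x q) (y k q) (x t).
    have H5 := ler_dist_enorm (y k q) (y k t) (x t).
    by lra.
  apply/ler_addgt0Pr => eta eta0; have [k kP] := geometric_small C eta0.
  apply: le_trans (ler_dist_enorm _ (y k t) _) _; rewrite [leRHS]addrC.
  by apply: lerD; [exact: le_trans (xP t tse k) kP|exact: (ygood k).2].
(* For every [k], both [T x] and [x] are within [C / 2 ^+ k.+1] of the iterate of rank [k.+1]. *)
have fixed t : s <= t <= e -> T x t = x t.
  move=> tse; apply/eqP; rewrite -subr_eq0; apply/eqP/enorm_eq0/eqP.
  rewrite eq_le enorm_ge0 andbT; apply/ler_addgt0Pr => eta eta0; rewrite add0r.
  have [k kP] := geometric_small C eta0.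
  apply: le_trans (ler_dist_enorm _ (y k.+1 t) _) _.
  have H1 : enorm (T x t - y k.+1 t) <= C / 2 ^+ k / 2.
    apply: (contract _ _ _ gx (ygood k)) => //; first by rewrite divr_ge0 ?exprn_ge0.
    by move=> q qse; apply: xP.
  have H2 : enorm (y k.+1 t - x t) <= C / 2 ^+ k / 2.
    rewrite enormBC; apply: le_trans (xP t tse k.+1) _.
    by rewrite exprSr invfM mulrA.
  by apply: le_trans (lerD H1 H2) _; rewrite -splitr.
exists (T x); have [Ts TD] := TP x gx; split=> // t tse.
by split; [exact: (Tgood x gx).2|rewrite fixed //; apply: TD].
Qed.

End Picard.

(** * Compact neighbourhoods of compact sets *)

Section CompactThickening.
Variables (R : realType) (n : nat).

(** Cubes rather than Euclidean balls: the thickening is the sum of [C] and a product of segments,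
    hence compact with [C]. *)
Definition thickening (C : set 'cV[R]_n) (r : R) : set 'cV[R]_n :=
  [set y | exists2 c, C c & forall i, `|y i ord0 - c i ord0| <= r].

Lemma compact_box (r : R) : compact [set v : 'cV[R]_n | forall i, `|v i ord0| <= r].
Proof.
have cr : compact [set v : 'rV[R]_n | forall i, `[- r, r]%classic (v ord0 i)].
  by apply: (@rV_compact _ _ (fun=> `[- r, r]%classic)) => i; apply: segment_compact.
have -> : [set v : 'cV[R]_n | forall i, `|v i ord0| <= r] =
    trmx @` [set v : 'rV[R]_n | forall i, `[- r, r]%classic (v ord0 i)].
  apply/seteqP; split => [v vr|_ [w wr <-] i].
    exists v^T; last by rewrite trmxK.
    by move=> i /=; rewrite mxE in_itv /= -ler_norml.
  by have := wr i; rewrite /= in_itv /= -ler_norml mxE.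
apply: (continuous_compact _ cr); apply: continuous_subspaceT => w.
move=> A /nbhs_ballP[e e0 eA]; apply/nbhs_ballP; exists e => // z [_ wz].
by apply: eA; split=> // i j; rewrite !mxE; apply: wz.
Qed.

Lemma compact_thickening C r : compact C -> compact (thickening C r).
Proof.
move=> cC; have -> : thickening C r = (fun p : 'cV[R]_n * 'cV[R]_n => p.1 + p.2) @`
    (C `*` [set v : 'cV[R]_n | forall i, `|v i ord0| <= r]).
  apply/seteqP; split => [y [c Cc yc]|_ [[c w] [Cc wr] <-]].
    exists (c, y - c); last by rewrite /= addrC subrK.
    by split=> //= i; have := yc i; rewrite !mxE.
  by exists c => // i; rewrite !mxE addrAC subrr add0r; apply: wr.
have cX := compact_setX cC (@compact_box r).
apply: (@continuous_compact _ _ (fun p : 'cV[R]_n * 'cV[R]_n => p.1 + p.2) _ _ cX).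
by apply: continuous_subspaceT; apply: add_continuous.
Qed.

(** The admissible radius varies with the point of [C]; compactness turns the local choices into one
    radius. *)
Lemma thickening_sub (C D : set 'cV[R]_n) : compact C -> open D -> C `<=` D ->
  exists2 r, 0 < r & thickening C r `<=` D.
Proof.
move=> cC oD CD.
pose Q (r : R) (x : 'cV[R]_n) := forall y : 'cV[R]_n,
  (forall i, `|y i ord0 - x i ord0| <= r) -> D y.
have : \forall r \near 0^'+, C `<=` Q r.
  move/compact_near_coveringP: cC; apply => x /CD Dx.
  have /nbhs_ballP[d /= d0 dD] := open_nbhs_nbhs (conj oD Dx).
  exists (ball x (d / 2), [set r | 0 < r < d / 2]) => /=.
    split; first by apply/nbhs_ballP; exists (d / 2) => //=; rewrite divr_gt0.
    near=> r; apply/andP; split; near: r; first exact: nbhs_right_gt.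
    by apply: nbhs_right_lt; rewrite divr_gt0.
  move=> [z r] /= [[_ xz] /andP[r0 rd]] y yz; apply: dD; split=> // i j.
  rewrite (ord1 j) /ball /=; have := xz i ord0; rewrite /ball /= => xzi.
  have yzi := yz i; rewrite distrC in yzi.
  apply: le_lt_trans (ler_distD (z i ord0) _ _) _.
  by rewrite [ltRHS](splitr d); apply: ltr_leD => //; apply: le_trans yzi (ltW _).
move=> H; have : \forall r \near 0^'+, 0 < r /\ C `<=` Q r.
  by near=> r; split; near: r; [exact: nbhs_right_gt|exact: H].
move=> /filter_ex[r [r0 rQ]]; exists r => // y [c Cc yc].
exact: rQ Cc y yc.
Unshelve. all: by end_near.
Qed.

End CompactThickening.

(** * Local existence, gluing and continuation for given controls *)

Section LocalExistence.
Variables (R : realType) (n m : nat) (D : set 'cV[R]_n).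
Variable f : 'I_m -> 'cV[R]_n -> R -> 'cV[R]_n.
Hypotheses (hD : open D) (hA1 : assumption1 D f).
Variables (a b U : R) (u : 'I_m -> R -> R).
Hypotheses (a_ge0 : 0 <= a) (U0 : 0 <= U).
Hypothesis u_le : forall k t, `|u k t| <= U.
Hypothesis u_cont : forall k, continuous (u k).

Let F y t := \sum_(k < m) u k t *: f k y t.

Definition solves (s e : R) (x : R -> 'cV[R]_n) := forall t, s <= t <= e ->
  D (x t) /\ wderiv `[s, e] x t (F (x t) t).

Lemma field_ccont k y s e : 0 <= s -> D y -> ccont s e (f k y).
Proof.
move=> s0 Dy; have [_ A2 _ _] := hA1.
apply: (@wderiv_ccont _ _ s e _ (fun t => dtime (f k y) t)) => t /andP[st te].
apply: wderiv_sub (C1_time_wderiv (A2 k y Dy) (le_trans s0 st)) => r /=.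
by rewrite !in_itv /= andbT => /andP[/(le_trans s0)].
Qed.

Lemma ccont_product (w : R -> R) (g : R -> 'cV[R]_n) s e : continuous w ->
  ccont s e g -> (forall t, `|w t| <= U) -> ccont s e (fun t => w t *: g t).
Proof.
move=> cw cg wU t tse eta eta0.
have e1 : 0 < eta / (2 * (U + 1)) by rewrite divr_gt0 ?mulr_gt0 ?ltr_wpDl.
have [d d0 dP] := cg t tse _ e1.
have e2 : 0 < eta / (2 * (enorm (g t) + 1)).
  by rewrite divr_gt0 ?mulr_gt0 // ltr_wpDl ?enorm_ge0.
have /cvgrPdist_le/(_ _ e2)/nbhs_ballP[d' /= d'0 dP'] := cw t.
exists (Num.min d d'); first by rewrite lt_min d0.
move=> r rse; rewrite lt_min => /andP[/(dP r rse) H1 rd'].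
have H2 : `|w t - w r| <= eta / (2 * (enorm (g t) + 1)).
  by apply: dP'; rewrite /ball /= distrC.
have -> : w r *: g r - w t *: g t = w r *: (g r - g t) + (w r - w t) *: g t.
  by rewrite scalerBr scalerBl subrKA.
apply: le_trans (ler_enormD _ _) _; rewrite !enormZ distrC [leRHS](splitr eta).
have n0 := enorm_ge0 (g t); apply: lerD.
  apply: (@le_trans _ _ ((U + 1) * (eta / (2 * (U + 1))))).
    apply: ler_pM => //; first exact: enorm_ge0.
    by apply: le_trans (wU r) _; rewrite lerDl.
  have -> // : (U + 1) * (eta / (2 * (U + 1))) = eta / 2.
  by field; rewrite gt_eqF // ltr_wpDl.
apply: (@le_trans _ _ (eta / (2 * (enorm (g t) + 1)) * (enorm (g t) + 1))).
  by apply: ler_pM => //; rewrite lerDl.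
have -> // : eta / (2 * (enorm (g t) + 1)) * (enorm (g t) + 1) = eta / 2.
by field; rewrite gt_eqF // ltr_wpDl.
Qed.

(** The length [h] depends on the compact set and neither on the starting time nor on the starting
    point, which is what allows continuation up to and beyond a limit time. *)
Lemma local_existence (C : set 'cV[R]_n) : compact C -> C `<=` D ->
  exists2 h, 0 < h & forall s e y, a <= s -> s <= e -> e <= s + h -> C y ->
    exists x : R -> 'cV[R]_n, x s = y /\ solves s e x.
Proof.
move=> cC CD; have [r r0 rD] := thickening_sub cC hD CD.
have [_ _ _ /(_ _ (compact_family_cst (@compact_thickening _ _ C r cC) rD))] := hA1.
move=> [Mf [Lfx [L2f [Lft [Hfx [Hft [[Mf0 Lfx0 _] [_ H]]]]]]]].
pose M := m%:R * (U * Mf); pose L := m%:R * (U * Lfx).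
have M0 : 0 <= M by rewrite !mulr_ge0 // ltW.
have L0 : 0 <= L by rewrite !mulr_ge0 // ltW.
(* The first bound keeps the iterates in the thickening, the second makes the integral operator
   contract by 1/2. *)
pose h := Num.min (r / (M + 1)) (1 / (2 * (L + 1))).
have h0 : 0 < h by rewrite lt_min !divr_gt0 ?mulr_gt0 ?ltr_wpDl.
exists h => // s e y as_ se eh Cy.
have esh : e - s <= h by rewrite lerBlDl.
have es0 : 0 <= e - s by rewrite subr_ge0.
have inT z : enorm (z - y) <= r -> thickening C r z.
  move=> zy; exists y => // i; apply: le_trans zy.
  by have := coord_le_enorm (z - y) i; rewrite !mxE.
have Fle z t : enorm (z - y) <= r -> s <= t <= e -> enorm (F z t) <= M.
  move=> /inT zT /andP[st _]; apply: enorm_lincomb => // k.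
  by have [] := H t (le_trans (le_trans a_ge0 as_) st) z z zT zT k k k.
have Flip z w t : enorm (z - y) <= r -> enorm (w - y) <= r -> s <= t <= e ->
    enorm (F z t - F w t) <= L * enorm (z - w).
  move=> /inT zT /inT wT /andP[st _].
  have -> : F z t - F w t = \sum_(k < m) u k t *: (f k z t - f k w t).
    by rewrite /F -sumrB; apply: eq_bigr => k _; rewrite scalerBr.
  rewrite /L -mulrA -mulrA; apply: enorm_lincomb => // k.
  by have [_ [[]]] := H t (le_trans (le_trans a_ge0 as_) st) z w zT wT k k k.
have Fc z : enorm (z - y) <= r -> ccont s e (F z).
  move=> /inT zT; apply: ccont_sum => k; apply: ccont_product => //.
  by apply: field_ccont; [exact: le_trans as_|exact: rD].
have shM : M * (e - s) <= r.
  apply: (@le_trans _ _ ((M + 1) * (r / (M + 1)))).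
    apply: ler_pM => //; first by rewrite lerDl.
    by apply: le_trans esh _; rewrite ge_min lexx.
  by rewrite mulrC divfK // gt_eqF // ltr_wpDl.
have shL : L * (e - s) <= 1 / 2.
  apply: (@le_trans _ _ ((L + 1) * (1 / (2 * (L + 1))))).
    apply: ler_pM => //; first by rewrite lerDl.
    by apply: le_trans esh _; rewrite ge_min lexx orbT.
  have -> // : (L + 1) * (1 / (2 * (L + 1))) = 1 / 2.
  by field; rewrite gt_eqF // ltr_wpDl.
have [x [xs xP]] := picard se M0 L0 (ltW r0) Fle Flip Fc shM shL.
exists x; split=> // t tse; have [H1 H2] := xP t tse.
by split=> //; apply/rD/inT.
Qed.

Lemma solves_concat s e q x z : s <= e -> e <= q -> solves s e x -> solves e q z ->
  x e = z e -> solves s q (fun t => if t <= e then x t else z t).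
Proof.
move=> se eq sx sz xz t /andP[st tq].
have agree r : e <= r -> (if r <= e then x r else z r) = z r.
  by rewrite le_eqVlt => /orP[/eqP <-|er]; [rewrite lexx|rewrite leNgt er].
have [te|te] := leP t e; last first.
  have tab : e <= t <= q by rewrite ltW.
  have [Dz wz] := sz t tab; split=> //.
  apply: (@wderiv_local _ _ `[e, q] _ _ _ _ (t - e)); first by rewrite subr_gt0.
    move=> r /=; rewrite !in_itv /= => /andP[_ ->]; rewrite andbT ltr_norml => /andP[+ _].
    by rewrite opprB ltrBDr subrK => /ltW.
  apply: wderiv_ext wz => [r|]; last by rewrite agree // ltW.
  by rewrite /= in_itv /= => /andP[er _]; rewrite agree.
have tab : s <= t <= e by rewrite st.
have [Dx wx] := sx t tab; split=> //.
have wx' : wderiv `[s, e] (fun t => if t <= e then x t else z t) t (F (x t) t).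
  apply: wderiv_ext wx => [r|]; last by rewrite te.
  by rewrite /= in_itv /= => /andP[_ ->].
move: te; rewrite le_eqVlt => /orP[/eqP tE|te]; last first.
  apply: (wderiv_local (d := e - t) _ _ wx'); first by rewrite subr_gt0.
  move=> r /=; rewrite !in_itv /= => /andP[-> _] /=; rewrite ltr_norml => /andP[_].
  by rewrite ltrBlDr subrK => /ltW.
(* At the junction both one-sided derivatives equal the field at the common value, so they merge
   into one. *)
have eab : e <= e <= q by rewrite lexx.
have [_ wz] := sz e eab.
have wz' : wderiv `[e, q] (fun t => if t <= e then x t else z t) t (F (x t) t).
  rewrite tE xz; apply: wderiv_ext wz => [r|]; last by rewrite lexx.
  by rewrite /= in_itv /= => /andP[er _]; rewrite agree.
apply: wderiv_sub (wderivU wx' wz') => r /=; rewrite !in_itv /= => /andP[sr rq].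
by case: (leP r e) => re; [left|right]; rewrite /= ?in_itv /= ?sr ?re ?rq ?(ltW re).
Qed.

Lemma solves_ccont s e x : solves s e x -> ccont s e x.
Proof. by move=> sx; apply: (wderiv_ccont (v := fun t => F (x t) t)) => t /sx[]. Qed.

Lemma solves_approx s e x t : solves s e x -> s <= t < e ->
  approx x t (F (x t) t) 0.
Proof.
move=> sx /[dup] tse /andP[st /ltW te]; apply: (wderiv_right tse).
by have [] := sx t (ltac:(by rewrite st)).
Qed.

(* Continuation: a solution cannot leave [D] before time [b], since just before
   any time [t] it lies in a fixed compact subset [L t] of [D]. *)
Lemma continuation (y : 'cV[R]_n) (L : R -> set 'cV[R]_n) : a <= b -> D y ->
  (forall t, a < t <= b -> compact (L t) /\ L t `<=` D) ->
  (forall s t x, a <= s -> s < t -> t <= b -> x a = y -> solves a s x -> L t (x s)) ->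
  exists x : R -> 'cV[R]_n, x a = y /\ solves a b x.
Proof.
move=> ab Dy hL inL.
pose Q s := exists x : R -> 'cV[R]_n, x a = y /\ solves a s x.
have extend s q C h : a <= s -> s <= q -> q <= s + h -> Q s ->
    (forall s e y, a <= s -> s <= e -> e <= s + h -> C y ->
      exists x : R -> 'cV[R]_n, x s = y /\ solves s e x) ->
    (forall x, x a = y -> solves a s x -> C (x s)) -> Q q.
  move=> as_ sq qh [x [xa sx]] hC inC.
  have [z [zs sz]] := hC s q (x s) as_ sq qh (inC x xa sx).
  exists (fun t => if t <= s then x t else z t); split; first by rewrite as_.
  exact: solves_concat as_ sq sx sz (esym zs).
suff H : forall t, a <= t <= b -> Q t by apply: H; rewrite ab lexx.
apply: real_induction.
- exists (fun=> y); split=> // t /andP[at_ ta]; split=> // eta eta0.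
  exists 1 => // s; rewrite /= in_itv /= => /andP[as_ sa] _.
  have -> : s = t by apply/eqP; rewrite eq_le (le_trans sa at_) (le_trans ta as_).
  by rewrite !subrr scale0r subr0 enorm0 normr0 mulr0.
- move=> t /andP[at_ tb] Qt.
  have [x [xa sx]] := Qt t (ltac:(by rewrite at_ lexx)).
  have tt : a <= t <= t by rewrite at_ lexx.
  have [Dxt _] := sx t tt.
  have [h h0 hC] := local_existence (@compact_set1 _ (x t))
    (ltac:(by move=> _ ->) : [set x t] `<=` D).
  exists h => // s /andP[ts sh] sb.
  have [z [zs sz]] := hC t s (x t) at_ (ltW ts) (ltW sh) erefl.
  exists (fun r => if r <= t then x r else z r); split; first by rewrite at_.
  exact: solves_concat at_ (ltW ts) sx sz (esym zs).
- move=> t /[dup] tab /andP[at_ tb] Qt.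
  have [cL LD] := hL t tab.
  have [h h0 hC] := local_existence cL LD.
  pose s := Num.max a (t - h / 2).
  have as_ : a <= s by rewrite le_max lexx.
  have st : s < t by rewrite gt_max at_ gtrBl divr_gt0.
  have th : t <= s + h.
    rewrite -lerBlDr; apply: (@le_trans _ _ (t - h / 2)); last by rewrite le_max lexx orbT.
    by rewrite lerD2l lerN2; lra.
  apply: (extend s t (L t) h) => //; first exact: ltW.
    by apply: Qt; rewrite as_.
  by move=> x xa sx; apply: (inL s t x).
Qed.

End LocalExistence.

(** * One period *)

Section Setting.
Variables (R : realType) (n m : nat) (D : set 'cV[R]_n).
Variables (f : 'I_m -> 'cV[R]_n -> R -> 'cV[R]_n) (P : 'cV[R]_n -> R -> R).
Variables (S1 : {set 'I_m}) (S2 : {set 'I_m * 'I_m}) (hn : (#|S1| + #|S2|)%N = n).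
Variables (kappa : 'I_m * 'I_m -> nat).
Hypotheses (hD : open D) (hA1 : assumption1 D f) (hA2 : assumption2 D f hn)
  (hA3 : assumption3 D P).
Hypothesis hkappa_pos : forall p, p \in S2 -> (0 < kappa p)%N.
Hypothesis hkappa_inj : {in S2 &, injective kappa}.
Variables (K : R -> set 'cV[R]_n).
Variables (Mf L2f Lft Hfx Hft MF LPx L2Px L2Pt LPt : R).
Hypotheses (Mf0 : 0 <= Mf) (L2f0 : 0 <= L2f) (Lft0 : 0 <= Lft) (Hfx0 : 0 <= Hfx)
  (Hft0 : 0 <= Hft) (MF0 : 0 <= MF) (LPx0 : 0 <= LPx) (L2Px0 : 0 <= L2Px)
  (L2Pt0 : 0 <= L2Pt) (LPt0 : 0 <= LPt).
Hypothesis hKf : forall t y, 0 <= t -> K t y -> forall j k l,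
  enorm (f k y t) <= Mf /\
  [/\ enorm (dtime (f k y) t) <= Lft,
      enorm (lie (f j) (f k) y t) <= L2f,
      enorm (lie (f l) (lie (f j) (f k)) y t) <= Hfx &
      enorm (dtime (lie (f j) (f k) y) t) <= Hft].
Hypothesis hKF : forall t y, 0 <= t -> K t y -> opnorm (invmx (frame_mx f hn y t)) <= MF.
Hypothesis hKg : forall t y, 0 <= t -> K t y -> enorm (grad P y t) <= LPx.
Hypothesis hKP : forall t s y z, 0 <= t -> 0 <= s -> K t y -> K s z ->
  `|P y t - P z s| <= LPx * enorm (y - z) + LPt * `|t - s| /\
  enorm (grad P y t - grad P z s) <= L2Px * enorm (y - z) + L2Pt * `|t - s|.

Variables (gamma : R) (gamma0 : 0 <= gamma).

(* With [eps = e ^+ 2]: bounds on the coefficients, on [e] times the controls,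
   and on the remainder of the expansion divided by [e ^+ 3]. *)
Definition coef_bound : R := gamma * (MF * LPx).
Definition osc_bound : R := osc_gain R S2 kappa * Num.sqrt coef_bound.
Definition ctrl_bound : R := n%:R * coef_bound + osc_bound.
Definition speed_bound : R := m%:R * (ctrl_bound * Mf).
Definition remainder_bound : R :=
  m%:R * (ctrl_bound * (m%:R * (ctrl_bound * (m%:R * (ctrl_bound * Hfx) + Hft)) +
    m%:R * (n%:R * coef_bound * L2f) + Lft)) +
  m%:R * (n%:R * coef_bound * (m%:R * (osc_bound * L2f))).
(** A rate per unit of time over a whole period, where the oscillations cancel: it is bounded in
    [e], unlike the instantaneous speed [speed_bound / e]. The 1 in [gradient_rate] makes that rate
    invertible. *)
Definition displacement_bound : R := gamma * LPx + remainder_bound.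
Definition gradient_rate : R := L2Px * displacement_bound + L2Pt + 1.

Let cb0 : 0 <= coef_bound. Proof. by rewrite /coef_bound; nonneg. Qed.
Let ob0 : 0 <= osc_bound.
Proof. by rewrite /osc_bound mulr_ge0 ?osc_gain_ge0 ?sqrtr_ge0. Qed.
Let ub0 : 0 <= ctrl_bound. Proof. by rewrite /ctrl_bound; nonneg. Qed.
Let sb0 : 0 <= speed_bound. Proof. by rewrite /speed_bound; nonneg. Qed.
Let rb0 : 0 <= remainder_bound. Proof. by rewrite /remainder_bound; nonneg. Qed.
Let db0 : 0 <= displacement_bound. Proof. by rewrite /displacement_bound; nonneg. Qed.

Lemma speed_bound_ge0 : 0 <= speed_bound. Proof. exact: sb0. Qed.

Lemma remainder_bound_ge0 : 0 <= remainder_bound. Proof. exact: rb0. Qed.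

Lemma gradient_rate_gt0 : 0 < gradient_rate.
Proof. by rewrite /gradient_rate ltr_wpDl //; nonneg. Qed.

Variables (t0 c rho mu e : R).
Hypotheses (ht0 : 0 <= t0) (rho0 : 0 < rho) (mu0 : 0 < mu) (e0 : 0 < e) (e1 : e <= 1).
Hypothesis hLK : forall t, t0 <= t -> sublevel D P c t `<=` K t.
Hypothesis hgrad : forall t, t0 <= t ->
  grad_sublevel D P rho t `<=` sublevel D P c t.
Hypothesis hconv : forall t, t0 <= t -> convex_set (sublevel D P c t).
Hypothesis smallP : e * (LPx * speed_bound + LPt) <= mu / 4.
Hypothesis smallg : e * (L2Px * speed_bound + L2Pt) <= rho / 16.
Hypothesis smallr : e * (LPx * remainder_bound + L2Px * displacement_bound ^+ 2) <= 1.

Section OneStep.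
Variables (a b : R) (x : R -> 'cV[R]_n).
Hypotheses (t0a : t0 <= a) (ab : a <= b) (be : b <= a + e ^+ 2).
Hypothesis hx : ccont a b x.
Hypothesis hxD : forall t, a <= t <= b -> D (x t).

Let av := feedback f hn P gamma (x a) a.
Let u k t := control hn kappa (e ^+ 2) k av t.
Let v t := \sum_(k < m) u k t *: f k (x t) t.
Hypothesis hv : forall t, a <= t < b -> approx x t (v t) 0.
Hypothesis start : well_inside x P c rho mu (3 / 4) 1 a.

Let a_ge0 : 0 <= a. Proof. exact: le_trans t0a. Qed.

Lemma start_in_family : K a (x a).
Proof.
have Da : D (x a) by apply: hxD; rewrite lexx.
have r0 := rho0; have m0 := mu0.
case: start => H; first by apply/hLK/hgrad => //; split=> //; lra.
by apply: hLK => //; split=> //; lra.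
Qed.

Lemma feedback_le i : `|av i ord0| <= coef_bound.
Proof.
apply: le_trans (coord_le_enorm _ _) _; rewrite /av /feedback enormN enormZ.
rewrite ger0_norm // /coef_bound; apply: ler_wpM2l => //.
apply: le_trans (enorm_mulmx _ _) _.
apply: (@le_trans _ _ (MF * enorm (grad P (x a) a))).
  by apply: ler_wpM2r; [exact: enorm_ge0|exact: hKF start_in_family].
by apply: ler_wpM2l => //; apply: hKg start_in_family.
Qed.

Let sqrt_e : Num.sqrt (e ^+ 2) = e.
Proof. by rewrite sqrtr_sqr gtr0_norm. Qed.

Lemma ctrl_le k t : `|u k t| <= ctrl_bound / e.
Proof.
have [ o [V [Z [uE _ _ oA _]]]] :=
  control_modes hn hkappa_pos hkappa_inj a (exprn_gt0 2 e0) feedback_le.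
rewrite /u uE; apply: le_trans (ler_normD _ _) _.
have := oA k t; rewrite sqrt_e -/osc_bound => H2.
have H1 := drift_le hn k feedback_le.
rewrite /ctrl_bound mulrDl; apply: lerD H2.
apply: le_trans H1 _; rewrite ler_peMr ?mulr_ge0 //.
by rewrite invf_ge1.
Qed.

Lemma velocity_le t : a <= t < b -> K t (x t) -> enorm (v t) <= speed_bound / e.
Proof.
move=> /andP[at_ _] Kt.
have -> : speed_bound / e = m%:R * (ctrl_bound / e * Mf).
  by rewrite /speed_bound; field; rewrite gt_eqF.
apply: enorm_lincomb => [|k|k].
- by rewrite divr_ge0 // ltW.
- exact: ctrl_le.
- by have [] := hKf (le_trans a_ge0 at_) Kt k k k.
Qed.

(** A speed of order [1 / e] over a length [e ^+ 2] leaves one factor [e]. *)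
Let small_aux p q s : 0 <= p -> 0 <= q -> 0 <= s ->
  (p * (s / e) + q) * (b - a) <= e * (p * s + q).
Proof.
move=> p0 q0 s0.
apply: (@le_trans _ _ ((p * (s / e) + q) * e ^+ 2)).
  apply: ler_wpM2l; last by rewrite lerBlDl.
  by rewrite addr_ge0 // mulr_ge0 // divr_ge0 // ltW.
have -> : (p * (s / e) + q) * e ^+ 2 = e * (p * s + q * e).
  by field; rewrite gt_eqF.
by rewrite ler_pM2l // lerD2l ler_piMr.
Qed.

Let smP : (LPx * (speed_bound / e) + LPt) * (b - a) <= mu / 4.
Proof. exact: le_trans (small_aux _ _ _) smallP. Qed.
Let smg : (L2Px * (speed_bound / e) + L2Pt) * (b - a) <= rho / 16.
Proof. exact: le_trans (small_aux _ _ _) smallg. Qed.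
Let V0 : 0 <= speed_bound / e. Proof. by rewrite divr_ge0 // ltW. Qed.

Lemma step_confined t s : a <= t <= b -> a <= s <= b -> sublevel D P c s (x t).
Proof.
exact: (confinement_sublevel a_ge0 hx hxD hA3 ht0 t0a ab LPx0 LPt0 L2Px0 L2Pt0
  rho0 mu0 V0 hLK hgrad hKP hv velocity_le smP smg start).
Qed.

Lemma step_family t s : a <= t <= b -> a <= s <= b -> K s (x t).
Proof.
move=> tab sab; apply: hLK; last exact: step_confined.
by case/andP: sab => + _; apply: le_trans.
Qed.

(** Here [s] may lie beyond [b]: in the continuation argument the solution is known up to [b] only,
    while the compact set is the sublevel set at the later time to be reached. *)
Lemma step_persist t s : a <= t <= b -> t0 <= s -> `|s - t| <= e ^+ 2 ->
  sublevel D P c s (x t).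
Proof.
move=> tab t0s st.
have [ins _] := confinement a_ge0 hx hxD hA3 ht0 t0a ab LPx0 LPt0 L2Px0 L2Pt0
  rho0 mu0 V0 hLK hgrad hKP hv velocity_le smP smg start tab.
have e2e : e ^+ 2 <= e by rewrite expr2 ler_piMl // ltW.
have H1 : LPt * `|s - t| <= mu / 4.
  apply: le_trans smallP; rewrite mulrC; apply: ler_pM => //; first exact: le_trans e2e.
  by rewrite lerDr mulr_ge0.
have H2 : L2Pt * `|s - t| <= rho / 16.
  apply: le_trans smallg; rewrite mulrC; apply: ler_pM => //; first exact: le_trans e2e.
  by rewrite lerDr mulr_ge0.
apply: (@sublevel_persist _ _ _ _ hA3 t0 c rho K LPt L2Pt _ _ _ hLK hgrad _ t s) => //.
- move=> t1 s1 y t10 s10 K1 K2.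
  by have := hKP t10 s10 K1 K2; rewrite !subrr enorm0 !mulr0 !add0r.
- by case/andP: tab => + _; apply: le_trans.
- exact: hxD.
have r0 := rho0; have m0 := mu0.
case: ins => ins; [right|left]; lra.
Qed.

Lemma step_variation t : a <= t <= b ->
  `|P (x t) t - P (x a) a| <= mu / 4 /\
  enorm (grad P (x t) t - grad P (x a) a) <= rho / 16.
Proof.
have conf := confinement a_ge0 hx hxD hA3 ht0 t0a ab LPx0 LPt0 L2Px0 L2Pt0
  rho0 mu0 V0 hLK hgrad hKP hv velocity_le smP smg start.
move=> tab; have aab : a <= a <= b by rewrite lexx.
exact: (P_variation a_ge0 hxD hA3 ht0 t0a ab LPx0 LPt0 L2Px0 L2Pt0 rho0 mu0 V0 hLK
  hgrad hKP smP smg tab (conf a aab).1 (conf t tab).1 (conf t tab).2).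
Qed.

Lemma step_lipschitz s t : a <= s -> s <= t -> t <= b ->
  enorm (x t - x s) <= speed_bound / e * (t - s).
Proof.
move=> as_ st tb; have sb := le_trans st tb.
apply: (@approx_mean_value _ _ x v 0 _ s b).
- exact: ccont_sub as_ (lexx _) hx.
- by move=> q /andP[sq qb]; apply: hv; rewrite (le_trans as_).
- move=> q /andP[sq qb]; have qab : a <= q <= b by rewrite (le_trans as_) // ltW.
  rewrite addr0; apply: velocity_le; last exact: step_family.
  by rewrite (le_trans as_).
- by rewrite st.
Qed.

(** So far the interval could be an initial part of a period, as partial solutions require;
    averaging needs the full period. *)
Hypothesis bE : b = a + e ^+ 2.

Let baE : b - a = e ^+ 2. Proof. by rewrite bE addrC addKr. Qed.
Let aab : a <= a <= b. Proof. by rewrite lexx. Qed.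
Let bab : a <= b <= b. Proof. by rewrite ab lexx. Qed.

(** The oscillations have zero mean, the areas add the brackets, and the frame times its inverse
    leaves [- gamma] times the gradient; the rest is the expansion remainder. *)
Lemma step_displacement :
  enorm (x b - x a + (e ^+ 2 * gamma) *: grad P (x a) a) <= remainder_bound * e ^+ 3.
Proof.
have [ o [V [Z [uE [dV dZ] [Va Za] oA [Vb Zb]]]]] :=
  control_modes hn hkappa_pos hkappa_inj a (exprn_gt0 2 e0) feedback_le.
(* [V] starts at 0 with slope at most [osc_bound / e], hence is of order [e] over the period. *)
have VB k t : a <= t <= b -> `|V k t| <= osc_bound * e.
  move=> /andP[]; rewrite le_eqVlt => /orP[/eqP<-|at_] tb.
    by rewrite Va normr0 mulr_ge0 // ltW.
  have cV : {within `[a, t], continuous (V k)}.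
    by apply: derivable_within_continuous => s _; have [] := dV k s.
  have [s _] := MVT at_ (fun s _ => dV k s) cV.
  rewrite Va subr0 => ->; rewrite normrM.
  have oe : `|o k s| <= osc_bound / e by have := oA k s; rewrite sqrt_e.
  have te : `|t - a| <= e ^+ 2.
    by rewrite -baE ger0_norm ?lerD2r // subr_ge0 ltW.
  have := ler_pM (normr_ge0 _) (normr_ge0 _) oe te.
  by have -> : osc_bound / e * e ^+ 2 = osc_bound * e by field; rewrite gt_eqF.
have Dx t : a <= t <= b -> D (x t) := @hxD t.
have [A1 A2 A3 _] := hA1.
have ge0 t : a <= t <= b -> 0 <= t by case/andP => + _; apply: le_trans.
have difff k t : a <= t <= b -> differentiable (f k ^~ t) (x t).
  by move=> tab; have [dd _] := A1 k t (ge0 t tab); apply/dd/Dx.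
have difflie k l t : a <= t <= b -> differentiable (lie (f l) (f k) ^~ t) (x t).
  move=> tab; apply: (differentiable_lie hD (Dx t tab)); exact: A1 (ge0 t tab).
have C1f k t : a <= t <= b -> C1_time (f k (x t)) by move=> tab; apply/A2/Dx.
have C1lie k l t : a <= t <= b -> C1_time (lie (f l) (f k) (x t)).
  by move=> tab; apply/A3/Dx.
have bnds j k l s t : a <= s <= b -> a <= t <= b ->
  [/\ enorm (dtime (f k (x t)) s) <= Lft,
      enorm (lie (f j) (f k) (x t) s) <= L2f,
      enorm (lie (f l) (lie (f j) (f k)) (x t) s) <= Hfx &
      enorm (dtime (lie (f j) (f k) (x t)) s) <= Hft].
  by move=> sab tab; have [] := hKf (ge0 s sab) (step_family tab sab) j k l.
have U0 : 0 <= ctrl_bound / e by rewrite divr_ge0 // ltW.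
have nA0 : 0 <= n%:R * coef_bound by rewrite mulr_ge0.
have B0 : 0 <= osc_bound * e by rewrite mulr_ge0 // ltW.
have := trajectory_expansion a_ge0 ab hx hv uE dV dZ Va Za U0 nA0 B0 L2f0 Lft0 Hfx0
  Hft0 (fun k t _ => ctrl_le k t) (fun k => drift_le hn k feedback_le) VB
  difff difflie C1f C1lie bnds.
have -> : \sum_k (drift hn av k * (b - a) + V k b) *: f k (x a) a +
    \sum_k \sum_l Z k l b *: lie (f l) (f k) (x a) a =
    - ((e ^+ 2 * gamma) *: grad P (x a) a).
  transitivity (e ^+ 2 *: (frame_mx f hn (x a) a *m av)).
    rewrite -frame_mulmx scalerDr !scaler_sumr; congr (_ + _); apply: eq_bigr => k _.
      by rewrite baE bE Vb addr0 scalerA mulrC.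
    by rewrite scaler_sumr; apply: eq_bigr => l _; rewrite bE Zb scalerA.
  have Fu : frame_mx f hn (x a) a \in unitmx.
    by apply: frame_unit; case: hA2 => sp _; apply: sp => //; apply: Dx.
  by rewrite /av /feedback mulmxN -scalemxAr mulKVmx // scalerN scalerA.
rewrite opprK => /le_trans; apply; rewrite baE.
(* The powers of [e] are put back into [remainder_bound]; the only loss in the comparison is
   [Hft * e <= Hft]. *)
rewrite [leRHS](_ : _ = (m%:R * (ctrl_bound / e * ((m%:R * (ctrl_bound / e *
    (e * (m%:R * (ctrl_bound * Hfx) + Hft))) +
    m%:R * (n%:R * coef_bound * L2f) + Lft) * e ^+ 2)) +
  m%:R * (n%:R * coef_bound * (m%:R * (osc_bound * e * L2f)))) * e ^+ 2); last first.
  by rewrite /remainder_bound; field; rewrite gt_eqF.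
have e20 : 0 <= e ^+ 2 by apply: sqr_ge0.
apply: ler_wpM2r => //; rewrite lerD2r; apply: ler_wpM2l => //; apply: ler_wpM2l => //.
apply: ler_wpM2r => //; rewrite lerD2r lerD2r; apply: ler_wpM2l => //.
apply: ler_wpM2l => //.
have -> : (m%:R * (ctrl_bound / e * Hfx) + Hft) * e ^+ 2 =
    e * (m%:R * (ctrl_bound * Hfx) + Hft * e) by field; rewrite gt_eqF.
by rewrite ler_pM2l // lerD2l ler_piMr.
Qed.

Let g := enorm (grad P (x a) a).

Lemma step_length : enorm (x b - x a) <= displacement_bound * e ^+ 2.
Proof.
have := ler_enormB (x b - x a + (e ^+ 2 * gamma) *: grad P (x a) a)
  ((e ^+ 2 * gamma) *: grad P (x a) a).
rewrite addrK enormZ ger0_norm; last by rewrite mulr_ge0 ?sqr_ge0.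
move=> /le_trans; apply; rewrite /displacement_bound mulrDl addrC; apply: lerD.
  rewrite -[leLHS]mulrA [leLHS]mulrC; apply: ler_wpM2r; first exact: sqr_ge0.
  by apply: ler_wpM2l => //; apply: hKg start_in_family.
apply: le_trans step_displacement _; apply: ler_wpM2l => //.
by rewrite exprS ler_piMl ?sqr_ge0.
Qed.

Lemma step_gradient : enorm (grad P (x b) b) <= g + e ^+ 2 * gradient_rate.
Proof.
have [_ H] := hKP (le_trans a_ge0 ab) a_ge0 (step_family bab bab) (step_family aab aab).
have := enorm_leD (grad P (x b) b) (grad P (x a) a).
rewrite -/g => /le_trans; apply; rewrite lerD2l; apply: le_trans H _.
rewrite baE (ger0_norm (sqr_ge0 e)) /gradient_rate.
apply: (@le_trans _ _ (L2Px * (displacement_bound * e ^+ 2) + L2Pt * e ^+ 2)).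
  by rewrite lerD2r ler_wpM2l // step_length.
by rewrite mulrA -mulrDl [leRHS]mulrC; apply: ler_wpM2r; rewrite ?sqr_ge0 ?lerDl.
Qed.

(* Convexity of the sublevel set keeps the segment from [x a] to [x b] in the
   family, so that a Taylor estimate along it applies; along the trajectory
   itself the second-order term would be of the same size as the descent. *)
Lemma step_descent :
  P (x b) b <= P (x a) a - e ^+ 2 * (gamma * g ^+ 2 - LPt - 1).
Proof.
have b_ge0 := le_trans a_ge0 ab.
have [H1 _] := hKP b_ge0 a_ge0 (step_family bab bab) (step_family bab aab).
rewrite subrr enorm0 mulr0 add0r baE (ger0_norm (sqr_ge0 e)) in H1.
have seg s : 0 <= s <= 1 -> sublevel D P c a (x a + s *: (x b - x a)).
  by move=> s01; apply: convex_set_segment s01; [exact: hconv|exact: step_confined..].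
have dP s : 0 <= s <= 1 -> differentiable (P ^~ a) (x a + s *: (x b - x a)).
  by move=> /seg[Dy _]; have [/(_ a a_ge0)[dP _] _] := hA3; apply: dP.
have gG (s : R) : 0 <= s <= 1 ->
    enorm (grad P (x a + s *: (x b - x a)) a - grad P (x a) a) <=
    L2Px * enorm (x b - x a).
  move=> /[dup] s01 /seg Ls.
  have [_] := hKP a_ge0 a_ge0 (hLK t0a Ls) (step_family aab aab).
  have -> : x a + s *: (x b - x a) - x a = s *: (x b - x a) by rewrite addrC addKr.
  rewrite subrr normr0 mulr0 addr0 => /le_trans; apply.
  apply: ler_wpM2l => //; rewrite enormZ ger0_norm; last by case/andP: s01.
  by rewrite ler_piMl ?enorm_ge0 //; case/andP: s01.
have H2 := segment_increment dP gG.
rewrite -[\col_i _]/(grad P (x a) a) in H2.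
have H3 : dot (grad P (x a) a) (x b - x a) <=
    LPx * (remainder_bound * e ^+ 3) - e ^+ 2 * gamma * g ^+ 2.
  rewrite -[x b - x a](addrK ((e ^+ 2 * gamma) *: grad P (x a) a)) dotDr dotNr dotZr.
  rewrite dotvv lerD2r; apply: le_trans (dot_le _ _) _; apply: ler_pM.
  - exact: enorm_ge0.
  - exact: enorm_ge0.
  - exact: hKg start_in_family.
  - exact: step_displacement.
have H4 : L2Px * enorm (x b - x a) * enorm (x b - x a) <=
    e ^+ 3 * (L2Px * displacement_bound ^+ 2).
  have sl := step_length; have el := enorm_ge0 (x b - x a).
  have d2 := ler_pM el el sl sl.
  rewrite -mulrA; apply: (le_trans (ler_wpM2l L2Px0 d2)).
  have -> : L2Px * (displacement_bound * e ^+ 2 * (displacement_bound * e ^+ 2)) =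
     e * (e ^+ 3 * (L2Px * displacement_bound ^+ 2)) by ring.
  by rewrite ler_piMl // mulr_ge0 ?exprn_ge0 ?mulr_ge0 ?sqr_ge0 // ltW.
have H5 : e ^+ 2 * (e * (LPx * remainder_bound + L2Px * displacement_bound ^+ 2)) <=
    e ^+ 2 by rewrite ler_piMr ?sqr_ge0.
have H6 := le_trans (ler_norm _) H1.
clear H1 seg dP gG.
have E3 : e ^+ 3 = e ^+ 2 * e by rewrite exprSr.
rewrite E3 in H3 H4; lra.
Qed.

End OneStep.

(** * Nodes and the invariant they carry *)

Variables (x0 : 'cV[R]_n) (lambda mP : R).
Hypotheses (hx0 : D x0) (cE : c = P x0 t0 + lambda).
Hypothesis hmP : forall t y, 0 <= t -> K t y -> mP <= P y t.
Hypothesis hcomp : forall t, t0 <= t -> compact (sublevel D P c t).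
(** [LPt] pays for the variation of [P] in time, one unit for the remainder, and one unit is the net
    rate of descent. *)
Hypothesis gamma_large : LPt + 2 <= gamma * (rho / 2) ^+ 2.
(** The first bound gives the margin at the initial state; in the second, [rho / 8] is the gap
    between 5/8 and 3/4 of [rho], converted by the gradient rate into a gap for [P]. *)
Hypotheses (mu_lambda : mu <= lambda) (mu_rate : mu <= rho / 8 / gradient_rate).
Hypothesis small_rate : e ^+ 2 * gradient_rate <= rho / 8.

Definition node (j : nat) : R := t0 + e ^+ 2 * j%:R.

Lemma node0 : node 0 = t0. Proof. by rewrite /node mulr0 addr0. Qed.

Lemma nodeS j : node j.+1 = node j + e ^+ 2.
Proof. by rewrite /node -natr1 mulrDr mulr1 addrA. Qed.

Lemma node_ge j : t0 <= node j.
Proof. by rewrite lerDl mulr_ge0 ?sqr_ge0. Qed.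

Lemma node_leS j : node j <= node j.+1.
Proof. by rewrite nodeS lerDl sqr_ge0. Qed.

Lemma node_le i j : (i <= j)%N -> node i <= node j.
Proof. by move=> ij; rewrite lerD2l ler_wpM2l ?sqr_ge0 // ler_nat. Qed.

Definition node_index (t : R) : nat := Num.truncn ((t - t0) / e ^+ 2).

Let e2_gt0 : 0 < e ^+ 2. Proof. exact: exprn_gt0. Qed.

Lemma node_indexP t : t0 <= t -> node (node_index t) <= t < node (node_index t).+1.
Proof.
move=> t0t; have q0 : 0 <= (t - t0) / e ^+ 2 by rewrite divr_ge0 ?subr_ge0 ?sqr_ge0.
have /andP[H1 H2] := truncn_itv q0.
rewrite -/(node_index t) ler_pdivlMr // in H1.
rewrite -/(node_index t) ltr_pdivrMr // in H2.
by rewrite /node -lerBrDl -ltrBlDl mulrC H1 mulrC H2.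
Qed.

Lemma node_index_itv j t : node j <= t < node j.+1 -> node_index t = j.
Proof.
move=> /andP[H1 H2].
have /andP[H3 H4] := node_indexP (le_trans (node_ge j) H1).
have lt_node i k : node i < node k -> (i < k)%N.
  by move=> ik; rewrite ltnNge; apply/negP => /node_le; rewrite leNgt ik.
apply/eqP; rewrite eqn_leq; apply/andP; split; rewrite -ltnS; apply: lt_node.
  exact: le_lt_trans H2.
exact: le_lt_trans H4.
Qed.

Definition feed (a : R) (y : 'cV[R]_n) (k : 'I_m) (t : R) : R :=
  control hn kappa (e ^+ 2) k (feedback f hn P gamma y a) t.

Definition step_solution (a b : R) (x : R -> 'cV[R]_n) : Prop :=
  [/\ ccont a b x, forall t, a <= t <= b -> D (x t) &
      forall t, a <= t < b ->
        approx x t (\sum_(k < m) feed a (x a) k t *: f k (x t) t) 0].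

Local Notation G := gradient_rate.
Let G0 : 0 < G := gradient_rate_gt0.

(* Either the gradient is small, or [P] is below its initial value, or the
   combination of [P] and its gradient norm, which cannot increase while the
   gradient is large, is below the value it may have when the gradient stops
   being small. *)
Definition node_inv (p g : R) : Prop :=
  [\/ g <= rho / 2, p <= c - lambda | p + g / G <= c + rho * (5 / 8) / G].

Lemma node_inv_inside (x : R -> 'cV[R]_n) a :
  node_inv (P (x a) a) (enorm (grad P (x a) a)) ->
  well_inside x P c rho mu (3 / 4) 1 a.
Proof.
have r0 := rho0; have ml := mu_lambda; have mr := mu_rate.
rewrite /well_inside; case=> H; [left|right|]; [lra|lra|].
have [gr|gr] := leP (enorm (grad P (x a) a)) (rho * (3 / 4)); first by left.
right; have : rho * (3 / 4) / G <= enorm (grad P (x a) a) / G.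
  by rewrite ler_pM2r ?invr_gt0 // ltW.
move: H mr; rewrite -!(mulrA _ _ G^-1) !(mulrC _ G^-1); move: (G^-1) => G'.
lra.
Qed.

Section NodeStep.
Variables (j : nat) (x : R -> 'cV[R]_n).
Let a := node j.
Let b := node j.+1.
Hypothesis sx : step_solution a b x.
Hypothesis inv : node_inv (P (x a) a) (enorm (grad P (x a) a)).

Let bE : b = a + e ^+ 2. Proof. exact: nodeS. Qed.
Let ab : a <= b. Proof. exact: node_leS. Qed.
Let be : b <= a + e ^+ 2. Proof. by rewrite bE. Qed.
Let start := node_inv_inside inv.
Let cx : ccont a b x. Proof. by case: sx. Qed.
Let Dx : forall t, a <= t <= b -> D (x t). Proof. by case: sx. Qed.
Let vx : forall t, a <= t < b ->
  approx x t (\sum_(k < m) feed a (x a) k t *: f k (x t) t) 0.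
Proof. by case: sx. Qed.

Lemma node_sublevel t : a <= t <= b -> sublevel D P c t (x t).
Proof. by move=> tab; apply: (step_confined (node_ge j) ab be cx Dx vx start). Qed.

Lemma node_variation t : a <= t <= b ->
  P (x t) t <= P (x a) a + mu / 4 /\
  `|enorm (grad P (x t) t) - enorm (grad P (x a) a)| <= rho / 16.
Proof.
move=> tab; have [H1 H2] := step_variation (node_ge j) ab be cx Dx vx start tab.
split; first by rewrite -lerBlDl; apply: le_trans (ler_norm _) H1.
exact: le_trans (ler_dist_dist _ _) H2.
Qed.

Lemma node_gradient : enorm (grad P (x b) b) <= enorm (grad P (x a) a) + e ^+ 2 * G.
Proof. exact: (step_gradient (node_ge j) ab be cx Dx vx start bE). Qed.

Lemma node_descent : rho / 2 < enorm (grad P (x a) a) ->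
  P (x b) b <= P (x a) a - e ^+ 2.
Proof.
move=> g2; have := step_descent (node_ge j) ab be cx Dx vx start bE.
move=> /le_trans; apply; rewrite lerD2l lerN2 ler_peMr ?sqr_ge0 //.
have : gamma * (rho / 2) ^+ 2 <= gamma * enorm (grad P (x a) a) ^+ 2.
  apply: ler_wpM2l => //; rewrite lerXn2r ?nnegrE ?enorm_ge0 ?ltW //.
  by rewrite divr_gt0.
have gl := gamma_large; lra.
Qed.

(** In one period [P] loses at least [e ^+ 2] and the gradient norm gains at most [e ^+ 2 * G]: the
    weight [1 / G] balances the two. *)
Lemma node_descent_rate : rho / 2 < enorm (grad P (x a) a) ->
  P (x b) b + enorm (grad P (x b) b) / G <= P (x a) a + enorm (grad P (x a) a) / G.
Proof.
move=> /node_descent H1; have H2 := node_gradient.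
have : enorm (grad P (x b) b) / G <= enorm (grad P (x a) a) / G + e ^+ 2.
  rewrite -[X in _ <= _ + X](mulfK (x := G)) ?gt_eqF // -mulrDl.
  by rewrite ler_pM2r ?invr_gt0.
lra.
Qed.

Lemma node_small : enorm (grad P (x a) a) <= rho / 2 ->
  enorm (grad P (x b) b) <= rho * (5 / 8).
Proof.
move=> g2; apply: le_trans node_gradient _; apply: le_trans (lerD g2 small_rate) _.
by have -> : rho * (5 / 8) = rho / 2 + rho / 8 by field.
Qed.

Lemma node_inv_step : node_inv (P (x b) b) (enorm (grad P (x b) b)).
Proof.
have [g2|g2] := leP (enorm (grad P (x a) a)) (rho / 2).
  (* Below [rho / 2] no descent is guaranteed, but confinement gives [P <= c] at the next node and
     the gradient there is at most 5/8 of [rho]; the third clause is calibrated for this. *)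
  apply: Or33; apply: lerD; last by rewrite ler_pM2r ?invr_gt0 // node_small.
  by have [] := node_sublevel (t := b) (ltac:(by rewrite ab lexx)).
case: inv => [/(lt_le_trans g2)|H|H]; first (rewrite ltxx => /notF []).
  apply: Or32; apply: le_trans (node_descent g2) _.
  by rewrite lerBlDr (le_trans H) // lerDl sqr_ge0.
by apply: Or33; apply: le_trans (node_descent_rate g2) H.
Qed.

Lemma node_lipschitz s t : a <= s -> s <= t -> t <= b ->
  enorm (x t - x s) <= speed_bound / e * (t - s).
Proof. exact: (step_lipschitz (node_ge j) ab be cx Dx vx start). Qed.

End NodeStep.

(** * Invariance and the final bound on [P] *)

Section Trapping.
Variable x : R -> 'cV[R]_n.
Hypotheses (x_t0 : x t0 = x0).
Hypothesis sx : forall j, step_solution (node j) (node j.+1) x.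

Let p j := P (x (node j)) (node j).
Let g j := enorm (grad P (x (node j)) (node j)).

Lemma node_inv_all j : node_inv (p j) (g j).
Proof.
elim: j => [|j IH]; last exact: node_inv_step.
by apply: Or32; rewrite /p node0 x_t0 cE addrK.
Qed.

Lemma trapped t : t0 <= t -> sublevel D P c t (x t).
Proof.
move=> /node_indexP /andP[H1 /ltW H2].
by apply: (node_sublevel (sx (node_index t)) (node_inv_all _)); rewrite H1.
Qed.

(** Otherwise [P] would lose [e ^+ 2] at every node, against the lower bound [mP]. *)
Lemma small_node_exists : exists i, g i <= rho / 2.
Proof.
apply: contrapT => /forallNP H.
have big i : rho / 2 < g i by rewrite ltNge; apply/negP.
have dec i : p i <= p 0%N - i%:R * e ^+ 2.
  elim: i => [|i IH]; first by rewrite mul0r subr0.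
  apply: le_trans (node_descent (sx i) (node_inv_all i) (big i)) _.
  by move: IH; rewrite /p -natr1 mulrDl mul1r => IH; lra.
have low i : mP <= p i.
  by apply: hmP; [exact: le_trans (node_ge i)|apply/hLK/trapped; apply: node_ge].
pose N := Num.bound ((p 0%N - mP) / e ^+ 2).
have := archi_boundP (x := (p 0%N - mP) / e ^+ 2).
rewrite divr_ge0 ?subr_ge0 ?sqr_ge0 // -/N => /(_ isT).
rewrite ltr_pdivrMr // => HN.
have := le_trans (low N) (dec N); lra.
Qed.

(** An explicit point at which the double supremum is already large enough; extended reals then
    enter only in the conclusion. *)
Definition below_witness (s w : R) : Prop := exists xi tau,
  [/\ s <= tau, grad_sublevel D P rho tau xi & w <= P xi tau].

Lemma trapping_time : exists2 T, 0 <= T &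
  forall t, t0 + T <= t -> below_witness (t0 + T) (P (x t) t).
Proof.
have [i0 gi0] := small_node_exists.
exists (e ^+ 2 * i0%:R) => [|t ti]; first by rewrite mulr_ge0 ?sqr_ge0.
rewrite -/(node i0) in ti *.
have r0 := rho0.
(* The successor of a small-gradient node has gradient at most 5/8 of [rho] and is its own witness;
   while the gradient stays large, the nonincreasing combination keeps that witness valid. *)
have inv i : (i0 <= i)%N -> g i <= rho / 2 \/
    below_witness (node i0) (p i + g i / G - rho * (5 / 8) / G).
  elim: i => [|i IH].
    by rewrite leqn0 => /eqP i00; left; move: gi0; rewrite i00.
  rewrite leq_eqVlt => /orP[/eqP <-|]; first by left.
  rewrite ltnS => i0i; right.
  have [gi|gi] := leP (g i) (rho / 2).
    exists (x (node i.+1)), (node i.+1); have H := node_small (sx i) (node_inv_all i) gi.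
    split; first by apply: node_le; apply: leqW.
      split; last by lra.
      by have [_ Dx _] := sx i; apply: Dx; rewrite node_leS lexx.
    rewrite -addrA -mulrBl gerDl mulr_le0_ge0 ?invr_ge0 ?(ltW G0) //.
    by rewrite subr_le0.
  case: (IH i0i) => [|[xi [tau [H1 H2 H3]]]]; first by rewrite leNgt gi.
  exists xi, tau; split; [exact: H1|exact: H2|apply: le_trans H3; rewrite lerD2r].
  exact: (node_descent_rate (sx i) (node_inv_all i) gi).
have t0t : t0 <= t := le_trans (node_ge i0) ti.
have [Dxt _] := trapped t0t.
have [gt|gt] := leP (enorm (grad P (x t) t)) rho.
  by exists (x t), t; split.
have /andP[it ti1] := node_indexP t0t.
set i := node_index t in it ti1.
have i0i : (i0 <= i)%N.
  rewrite leqNgt; apply/negP => /node_le H.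
  by have := le_lt_trans ti (lt_le_trans ti1 H); rewrite ltxx.
have [H1] := node_variation (sx i) (node_inv_all i) (t := t)
  (ltac:(by rewrite it ltW)).
rewrite -/(p i) -/(g i) in H1 *; move=> H2.
(* A gradient above [rho] at [t] forces 15/16 of [rho] at the preceding node; the excess over 5/8,
   divided by [G], covers the rise [mu / 4] of [P] since that node. *)
have gi : rho * (15 / 16) <= g i.
  by move: H2; rewrite ler_norml => /andP[_]; lra.
case: (inv i i0i) => [|[xi [tau [H3 H4 H5]]]]; first by lra.
exists xi, tau; split; [exact: H3|exact: H4|].
apply: le_trans H1 _; apply: le_trans _ H5; rewrite -addrA lerD2l -mulrBl.
have mr := mu_rate.
have : rho * (5 / 16) / G <= (g i - rho * (5 / 8)) / G.
  by rewrite ler_pM2r ?invr_gt0 //; lra.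
have : 0 < mu := mu0; have : rho * (5 / 16) / G = rho / 8 / G * (5 / 2).
  by field; rewrite gt_eqF.
by move=> -> m0; lra.
Qed.

End Trapping.

(** * Construction of the sampled solution and its regularity *)

Lemma continuous_feed a y k : continuous (feed a y k).
Proof.
pose av := feedback f hn P gamma y a.
pose w (q : 'I_#|S2|) : R := 2 * pi * (kappa (enum_val q))%:R / e ^+ 2.
pose trig (q : 'I_#|S2|) : R -> R := Num.sqrt `|second hn av q| *:
  ((2 * Num.sqrt (pi * (kappa (enum_val q))%:R)) *:
   (((k == (enum_val q).1)%:R * Num.sg (second hn av q)) *: (cos \o (w q *: idfun)) +
    ((k == (enum_val q).2)%:R : R) *: (sin \o (w q *: idfun)))).
have -> : feed a y k = cst (drift hn av k) + (Num.sqrt (e ^+ 2))^-1 *: \sum_q trig q.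
  apply/funext => t; rewrite /feed /control -/av !fctE; congr (_ + _ * _).
  rewrite fct_sumE; apply: eq_bigr => q _; congr (_ * _).
  rewrite /phi /= !fctE -/(second hn av q).
  by rewrite -[w q *: t]/(w q * t) (_ : w q * t =
    2 * pi * (kappa (enum_val q))%:R * t / e ^+ 2) // /w mulrAC.
have cZ (r : R) (h : R -> R) t : {for t, continuous h} -> {for t, continuous (r *: h)}.
  by move=> ch; apply: (cvgZl_tmp (k := r) ch).
have cw q : continuous (w q *: @idfun R) by move=> t; apply: cZ; apply: cvg_id.
have ctrig q : continuous (trig q).
  move=> t; apply/cZ/cZ.
  apply: continuousD; apply/cZ; apply: continuous_comp; first exact: cw.
  - exact: continuous_cos.
  - exact: cw.
  - exact: continuous_sin.
move=> t; apply: continuousD; first exact: cst_continuous.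
apply: cZ; move: t.
apply: (big_ind (fun h : R -> R => continuous h)) => [t|g h cg ch t|q _].
- exact: cst_continuous.
- by apply: continuousD; [exact: cg|exact: ch].
- exact: ctrig.
Qed.

Lemma solves_step_solution a b (x : R -> 'cV[R]_n) :
  solves D f (feed a (x a)) a b x -> step_solution a b x.
Proof.
move=> sx; split; first exact: solves_ccont sx.
  by move=> t /sx[].
by move=> t tab; apply: (solves_approx sx).
Qed.

Lemma step_exists j y : D y ->
  node_inv (P y (node j)) (enorm (grad P y (node j))) ->
  exists z : R -> 'cV[R]_n, z (node j) = y /\
    solves D f (feed (node j) y) (node j) (node j.+1) z.
Proof.
move=> Dy inv.
have U0 : 0 <= ctrl_bound / e by rewrite divr_ge0 // ltW.
have ule k t : `|feed (node j) y k t| <= ctrl_bound / e.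
  (* The bound on the controls depends on the sampled state alone, so it is read off the constant
     trajectory on a degenerate interval. *)
  exact: (@ctrl_le (node j) (node j) (fun=> y) (node_ge j) (lexx _)
    (fun _ _ => Dy) (node_inv_inside (x := fun=> y) inv)).
apply: (continuation hD hA1 (le_trans ht0 (node_ge j)) U0 ule (@continuous_feed _ _)
  (L := sublevel D P c) (node_leS j) Dy).
  move=> t /andP[/ltW jt _]; split; first exact: hcomp (le_trans (node_ge j) jt).
  by move=> z [].
move=> s t x js st tb xj sx.
have sx' : step_solution (node j) s x by apply: solves_step_solution; rewrite xj.
have [cx Dx vx] := sx'.
have sj : s <= node j + e ^+ 2 by rewrite -nodeS (le_trans _ tb) // ltW.
have inv' : node_inv (P (x (node j)) (node j)) (enorm (grad P (x (node j)) (node j))).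
  by rewrite xj.
apply: (step_persist (node_ge j) js sj cx Dx vx (node_inv_inside inv')).
- by rewrite js lexx.
- exact: le_trans (le_trans (node_ge j) js) (ltW st).
- rewrite ger0_norm; last by rewrite subr_ge0 ltW.
  by rewrite lerBlDl; apply: le_trans tb _; rewrite nodeS lerD2r.
Qed.

Lemma solution_exists : exists x : R -> 'cV[R]_n, x t0 = x0 /\
  forall j, solves D f (feed (node j) (x (node j))) (node j) (node j.+1) x.
Proof.
pose ok (jy : nat * 'cV[R]_n) := D jy.2 /\
  node_inv (P jy.2 (node jy.1)) (enorm (grad P jy.2 (node jy.1))).
have ex (jy : nat * 'cV[R]_n) : exists z : R -> 'cV[R]_n, ok jy ->
    z (node jy.1) = jy.2 /\
    solves D f (feed (node jy.1) jy.2) (node jy.1) (node jy.1.+1) z.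
  have [[Dy inv]|nok] := pselect (ok jy); last by exists (fun=> 0).
  by have [z zP] := step_exists Dy inv; exists z.
have [Z ZP] := choice ex.
pose y := fix y j := if j is j'.+1 then Z (j', y j') (node j'.+1) else x0.
have yS j : y j.+1 = Z (j, y j) (node j.+1) by [].
have yok j : ok (j, y j).
  elim: j => [|j IH].
    by split=> //; apply: Or32; rewrite /= node0 cE addrK.
  have [Zj sZ] := ZP _ IH; rewrite /= in Zj sZ.
  have sZ' : step_solution (node j) (node j.+1) (Z (j, y j)).
    by apply: solves_step_solution; rewrite Zj.
  have inv : node_inv (P (Z (j, y j) (node j)) (node j))
      (enorm (grad P (Z (j, y j) (node j)) (node j))) by rewrite Zj; case: IH.
  split; last exact: node_inv_step sZ' inv.
  by have [_ DZ _] := sZ'; apply: DZ; rewrite node_leS lexx.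
pose x t := Z (node_index t, y (node_index t)) t.
(* At the right end [node_index] already selects the next piece, which starts where this one ends;
   hence equality on the closed interval. *)
have xE j t : node j <= t <= node j.+1 -> x t = Z (j, y j) t.
  move=> /andP[jt]; rewrite le_eqVlt => /orP[/eqP ->|tj]; last first.
    by rewrite /x (@node_index_itv j) // jt.
  rewrite /x (@node_index_itv j.+1) ?lexx ?nodeS ?ltrDl //.
  by rewrite -nodeS (ZP _ (yok j.+1)).1 yS.
have xj j : x (node j) = y j.
  by rewrite (@xE j) ?lexx ?node_leS // (ZP _ (yok j)).1.
exists x; split; first by rewrite -{1}node0 xj.
move=> j t tj; have [_ sZ] := ZP _ (yok j); rewrite /= in sZ.
have [DZ wZ] := sZ t tj; rewrite xj (xE j t tj); split; first exact: DZ.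
by apply: (wderiv_ext _ _ wZ) => [s|]; rewrite ?(xE j t tj) //= in_itv /= => /xE.
Qed.

Section Solutions.
Variable x : R -> 'cV[R]_n.
Hypotheses (x_t0 : x t0 = x0).
Hypothesis sx : forall j, step_solution (node j) (node j.+1) x.

(** The constant is the same on every period, so it passes to the whole half-line, and absolute
    continuity follows. *)
Lemma global_lipschitz s t : t0 <= s -> s <= t ->
  enorm (x t - x s) <= speed_bound / e * (t - s).
Proof.
move=> t0s st.
have H j : forall t, s <= t -> t <= node j ->
    enorm (x t - x s) <= speed_bound / e * (t - s).
  elim: j => [|j IH] {st}t st tj.
    have -> : t = s.
      by apply/eqP; rewrite eq_le st (le_trans tj) // node0.
    by rewrite !subrr enorm0 mulr0.
  have [tj'|/ltW jt] := leP t (node j); first exact: IH.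
  have [sj|/ltW js] := leP s (node j); last first.
    exact: (node_lipschitz (sx j) (node_inv_all x_t0 sx j)).
  apply: le_trans (ler_dist_enorm _ (x (node j)) _) _.
  have -> : speed_bound / e * (t - s) =
    speed_bound / e * (t - node j) + speed_bound / e * (node j - s).
    by rewrite -mulrDr subrKA.
  apply: lerD; last exact: IH.
  exact: (node_lipschitz (sx j) (node_inv_all x_t0 sx j)).
have /andP[_ /ltW tj] := node_indexP (le_trans t0s st).
exact: (H _ t st tj).
Qed.

Lemma global_abs_continuous b : t0 <= b -> abs_continuous t0 b x.
Proof.
move=> t0b eta eta0; pose S := speed_bound / e.
have S0 : 0 <= S by rewrite divr_ge0 // ltW.
exists (eta / (S + 1)); first by rewrite divr_gt0 // ltr_wpDl.
move=> N l r lr _; rewrite ltr_pdivlMr ?ltr_wpDl // => H.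
apply: le_lt_trans H; rewrite mulr_suml; apply: ler_sum => i _.
have [H1 H2 _] := lr i; apply: le_trans (global_lipschitz H1 H2) _.
rewrite -/S mulrC; apply: ler_wpM2l; first by rewrite subr_ge0.
by rewrite lerDl.
Qed.

End Solutions.

Lemma pi_solution_exists :
  exists x : R -> 'cV[R]_n, pi_solution D f hn kappa P gamma (e ^+ 2) t0 x0 x.
Proof.
have [x [xt0 sx]] := solution_exists; exists x.
have sx' j : step_solution (node j) (node j.+1) x by apply: solves_step_solution.
split.
- by move=> b; apply: global_abs_continuous.
- by move=> t /(trapped xt0 sx')[].
- exact: xt0.
move=> j t /andP[jt tj].
have [|_ wx] := sx j t; first by rewrite -/(node j) jt ltW.
apply/quotients_withinP; apply: wderiv_sub wx => s /=.
by rewrite !in_itv /= => /andP[-> /ltW].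
Qed.

Lemma pi_solution_step x : pi_solution D f hn kappa P gamma (e ^+ 2) t0 x0 x ->
  forall j, step_solution (node j) (node j.+1) x.
Proof.
move=> [ac Dx xt0 eq] j; split.
- move=> t tj eta eta0.
  have [d d0 dP] := ac (node j.+1) (node_ge _) eta eta0.
  exists d => // s sj std.
  have key p q : node j <= p -> p <= q -> q <= node j.+1 -> q - p < d ->
      enorm (x q - x p) <= eta.
    move=> jp pq qj qp.
    (* A single interval extracts continuity from absolute continuity. *)
    have := dP 1%N (fun=> p) (fun=> q); rewrite !big_ord_recl !big_ord0 !addr0.
    move=> H; apply/ltW/H => // [_|].
      by split=> //; apply: le_trans jp; apply: node_ge.
    by move=> i i' _ _ _; rewrite (ord1 i) (ord1 i').
  case/andP: tj => jt tj; case/andP: sj => js sj.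
  have [ts|/ltW st] := leP t s.
    by apply: key => //; rewrite ger0_norm ?subr_ge0 // in std.
  by rewrite enormBC; apply: key => //; rewrite distrC ger0_norm ?subr_ge0 // in std.
- by move=> t /andP[jt _]; apply: Dx; apply: le_trans jt; apply: node_ge.
- move=> t tj; have := eq j t tj => /quotients_withinP.
  exact: wderiv_approx tj.
Qed.

Lemma pi_solution_conclusion x :
  pi_solution D f hn kappa P gamma (e ^+ 2) t0 x0 x ->
  (forall t : R, t0 <= t -> sublevel D P (P x0 t0 + lambda) t (x t)) /\
  exists2 T : R, 0 <= T &
    forall t : R, t0 + T <= t ->
      ((P (x t) t)%:E <=
       ereal_sup [set ereal_sup [set (P xi tau)%:E
                                | xi in grad_sublevel D P rho tau]
                 | tau in [set tau : R | (t0 + T <= tau)%R]])%E.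
Proof.
move=> pix; have sx := pi_solution_step pix.
have xt0 : x t0 = x0 by case: pix.
split; first by rewrite -cE => t; apply: trapped.
have [T T0 HT] := trapping_time xt0 sx; exists T => // t tT.
have [xi [tau [H1 H2 H3]]] := HT t tT.
apply: (@le_trans _ _ (P xi tau)%:E); first by rewrite lee_fin.
apply: (@le_trans _ _ (ereal_sup [set (P xi tau)%:E | xi in grad_sublevel D P rho tau])).
  by apply: ereal_sup_ubound; exists xi.
by apply: ereal_sup_ubound; exists tau.
Qed.

End Setting.

(** * Choice of the constants and conclusion *)

Lemma small_factor (R : realType) (C k e : R) : 0 <= C -> 0 <= e ->
  e <= k / (C + 1) -> e * C <= k.
Proof.
move=> C0 e0; rewrite ler_pdivlMr ?ltr_wpDl // => /(le_trans _); apply.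
by apply: ler_wpM2l => //; rewrite lerDl.
Qed.

Theorem lemma1 (R : realType) (n m : nat) (D : set 'cV[R]_n)
    (f : 'I_m -> 'cV[R]_n -> R -> 'cV[R]_n) (P : 'cV[R]_n -> R -> R)
    (S1 : {set 'I_m}) (S2 : {set 'I_m * 'I_m}) (hn : (#|S1| + #|S2|)%N = n)
    (kappa : 'I_m * 'I_m -> nat)
    (hD : is_domain D)
    (hA1 : assumption1 D f)
    (hA2 : assumption2 D f hn)
    (hA3 : assumption3 D P)
    (hA4 : assumption4 D P)
    (hkappa_pos : forall p, p \in S2 -> (0 < kappa p)%N)
    (hkappa_inj : {in S2 &, injective kappa})
    (x0 : 'cV[R]_n) (hx0 : D x0)
    (lambda rho : R) (hlambda : 0 < lambda) (hrho : 0 < rho)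
    (hlevel : level_condition D P x0 lambda rho) :
  exists2 gamma_bar : R, 0 < gamma_bar &
  exists2 eps_bar : R -> R,
    forall gamma : R, gamma_bar <= gamma -> 0 < eps_bar gamma &
  forall gamma eps t0 : R, gamma_bar <= gamma -> 0 < eps <= eps_bar gamma ->
    0 <= t0 ->
    (exists x : R -> 'cV[R]_n,
       pi_solution D f hn kappa P gamma eps t0 x0 x) /\
    forall x : R -> 'cV[R]_n,
      pi_solution D f hn kappa P gamma eps t0 x0 x ->
      (forall t : R, t0 <= t -> sublevel D P (P x0 t0 + lambda) t (x t)) /\
      exists2 T : R, 0 <= T &
        forall t : R, t0 + T <= t ->
          ((P (x t) t)%:E <=
           ereal_sup [set ereal_sup [set (P xi tau)%:E
                                    | xi in grad_sublevel D P rho tau]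
                     | tau in [set tau : R | (t0 + T <= tau)%R]])%E.
Proof.
have oD : open D by case: hD.
have cK := compact_level_family hA3 hx0 hlevel.
set K := level_family D P x0 lambda in cK.
have [_ _ _ /(_ K cK)] := hA1.
move=> [Mf [Lfx [L2f [Lft [Hfx [Hft [[Mf_gt0 _ L2f_gt0] [[Lft0 Hfx0 Hft0] HK1]]]]]]]].
have [MF MF_gt0 hKF] := hA2.2 K cK.
have [_ /(_ K cK)] := hA3.
move=> [mP [LPx [L2Px [L2Pt [LPt [HPx [LPx_gt0 [[L2Px0 L2Pt0 LPt0 _] HK3]]]]]]]].
have Mf0 := ltW Mf_gt0; have L2f0 := ltW L2f_gt0; have MF0 := ltW MF_gt0.
have LPx0 := ltW LPx_gt0.
have hKf t y : 0 <= t -> K t y -> forall j k l,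
    enorm (f k y t) <= Mf /\
    [/\ enorm (dtime (f k y) t) <= Lft, enorm (lie (f j) (f k) y t) <= L2f,
        enorm (lie (f l) (lie (f j) (f k)) y t) <= Hfx &
        enorm (dtime (lie (f j) (f k) y) t) <= Hft].
  move=> t0 Ky j k l.
  by have [H1 [[_ H2 H3] [H4 H5]]] := HK1 t t0 y y Ky Ky j k l.
have hKg t y : 0 <= t -> K t y -> enorm (grad P y t) <= LPx.
  by move=> t0 Ky; have [_ [[]]] := HK3 t t t0 t0 y y Ky Ky.
have hKP t s y z : 0 <= t -> 0 <= s -> K t y -> K s z ->
    `|P y t - P z s| <= LPx * enorm (y - z) + LPt * `|t - s| /\
    enorm (grad P y t - grad P z s) <= L2Px * enorm (y - z) + L2Pt * `|t - s|.
  by move=> t0 s0 Ky Kz; have [_ [[_ H1] [H2 _]]] := HK3 t s t0 s0 y z Ky Kz.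
have hmP t y : 0 <= t -> K t y -> mP <= P y t.
  by move=> t0 Ky; have [] := HK3 t t t0 t0 y y Ky Ky.
pose G gamma := gradient_rate n S2 kappa L2f Lft Hfx Hft MF LPx L2Px L2Pt gamma.
pose V gamma := speed_bound n S2 kappa Mf MF LPx gamma.
pose C1 gamma := LPx * V gamma + LPt.
pose C2 gamma := L2Px * V gamma + L2Pt.
pose C3 gamma := LPx * remainder_bound n S2 kappa L2f Lft Hfx Hft MF LPx gamma +
  L2Px * displacement_bound n S2 kappa L2f Lft Hfx Hft MF LPx gamma ^+ 2.
pose mu gamma := Num.min lambda (rho / 8 / G gamma).
(* In order, the entries provide [e <= 1], [smallP], [smallg], [smallr] and [small_rate]; the
   denominators [C1 + 1], [C2 + 1] and [C3 + 1] cannot vanish. *)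
pose e_bar gamma := Num.min 1 (Num.min (mu gamma / 4 / (C1 gamma + 1))
  (Num.min (rho / 16 / (C2 gamma + 1))
  (Num.min (1 / (C3 gamma + 1)) (rho / 8 / G gamma)))).
have G0 gamma : 0 <= gamma -> 0 < G gamma by move=> ?; apply: gradient_rate_gt0.
have mu0 gamma : 0 <= gamma -> 0 < mu gamma.
  by move=> g0; rewrite lt_min hlambda !divr_gt0 ?G0.
have V0 gamma : 0 <= gamma -> 0 <= V gamma by move=> ?; apply: speed_bound_ge0.
have C10 gamma : 0 <= gamma -> 0 <= C1 gamma.
  by move=> /V0 Vg; rewrite /C1; nonneg.
have C20 gamma : 0 <= gamma -> 0 <= C2 gamma.
  by move=> /V0 Vg; rewrite /C2; nonneg.
have C30 gamma : 0 <= gamma -> 0 <= C3 gamma.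
  move=> g0; apply: addr_ge0; apply: mulr_ge0 => //; last exact: sqr_ge0.
  exact: remainder_bound_ge0.
have e_bar0 gamma : 0 <= gamma -> 0 < e_bar gamma.
  move=> g0; have quot (p q : R) : 0 < p -> 0 <= q -> 0 < p / (q + 1).
    by move=> p0 q0; rewrite divr_gt0 // ltr_wpDl.
  rewrite !lt_min ltr01 /=; apply/and4P; split.
  - by apply: quot; [rewrite divr_gt0 ?mu0|exact: C10].
  - by apply: quot; [rewrite divr_gt0|exact: C20].
  - by apply: quot; last exact: C30.
  - by apply: divr_gt0; [rewrite divr_gt0|exact: G0].
(* The least gain compatible with [gamma_large]; like [e_bar], it is fixed before [t0] is
   introduced. *)
pose gamma_bar := (LPt + 2) / (rho / 2) ^+ 2.
have gamma_bar0 : 0 < gamma_bar.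
  by rewrite divr_gt0 ?ltr_wpDl ?exprn_gt0 ?divr_gt0.
(* All smallness conditions bear on [e], the square root of [eps], whence the square. *)
exists gamma_bar => //; exists (fun gamma => e_bar gamma ^+ 2).
  by move=> gamma gg; rewrite exprn_gt0 // e_bar0 // (le_trans (ltW gamma_bar0)).
move=> gamma eps t0 gg /andP[eps0 epsb] t00.
have g0 := le_trans (ltW gamma_bar0) gg.
pose e := Num.sqrt eps.
have epsE : eps = e ^+ 2 by rewrite sqr_sqrtr // ltW.
have e0 : 0 < e by rewrite sqrtr_gt0.
have : e <= e_bar gamma.
  by rewrite -(@ler_pXn2r _ 2) ?nnegrE ?(ltW e0) ?(ltW (e_bar0 _ g0)) // -epsE.
rewrite !le_min => /and5P[e1 eC1 eC2 eC3 eG].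
have ee := ltW e0.
have smP := small_factor (C10 _ g0) ee eC1.
have smg := small_factor (C20 _ g0) ee eC2.
have smr := small_factor (C30 _ g0) ee eC3.
have smG : e ^+ 2 * G gamma <= rho / 8.
  rewrite -ler_pdivlMr ?G0 //; apply: le_trans eG.
  by rewrite expr2 ler_piMl.
have glarge : LPt + 2 <= gamma * (rho / 2) ^+ 2.
  by rewrite -ler_pdivrMr // exprn_gt0 // divr_gt0.
have mul : mu gamma <= lambda by rewrite ge_min lexx.
have mur : mu gamma <= rho / 8 / G gamma by rewrite ge_min lexx orbT.
pose c := P x0 t0 + lambda.
have lev t (tt : t0 <= t) := hlevel t0 t t00 tt.
have hLK t : t0 <= t -> sublevel D P c t `<=` K t.
  by move=> tt y Ly; exists t0; rewrite ?t00.
have hgr t : t0 <= t -> grad_sublevel D P rho t `<=` sublevel D P c t.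
  by move=> tt; have [] := lev t tt.
have hcv t : t0 <= t -> convex_set (sublevel D P c t).
  by move=> tt; have [] := lev t tt.
have hcp t : t0 <= t -> compact (sublevel D P c t).
  by move=> tt; have [] := lev t tt.
rewrite epsE; split.
  exact: (pi_solution_exists oD hA1 hA2 hA3 hkappa_pos hkappa_inj Mf0 L2f0 Lft0 Hfx0
    Hft0 MF0 LPx0 L2Px0 L2Pt0 LPt0 hKf hKF hKg hKP g0 t00 hrho (mu0 _ g0) e0 e1 hLK hgr
    hcv smP smg smr hx0 erefl hcp glarge mul mur smG).
move=> x.
exact: (pi_solution_conclusion oD hA1 hA2 hA3 hkappa_pos hkappa_inj Mf0 L2f0 Lft0 Hfx0
  Hft0 MF0 LPx0 L2Px0 L2Pt0 LPt0 hKf hKF hKg hKP g0 t00 hrho (mu0 _ g0) e0 e1 hLK hgr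
  hcv smP smg smr erefl hmP glarge mul mur smG).
Qed.
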